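(* Let $S\subset[0,\infty)$ be an additive sub-semigroup satisfying (S1) and (S2), let $c$ be the constant in (S2), and let $\mu$ be a probability measure on $\mathbb{R}$. Then the following are equivalent. (1) $\mu\in\mathcal{P}_S$. (2) There are $(d_\gamma)_{\gamma\in S}\subset\mathbb{C}$ with $d_0=1$ and $A>0$ such that $|d_\gamma|\le A^\gamma$ for every $\gamma\in S$ and $G_\mu(z)=\sum_{\gamma\in S}\frac{d_\gamma}{z^{\gamma+1}}$ for all $z\in\mathbb{C}_-$ with $|z|>cA$. (3) There are $(b_\gamma)_{\gamma\in S}\subset\mathbb{C}$ with $b_0=1$ and $A>0$ such that $|b_\gamma|\le A^\gamma$ for every $\gamma\in S$ and $F_\mu(z)=z\sum_{\gamma\in S}\frac{b_\gamma}{z^{\gamma}}$ for all $z\in\mathbb{C}_-$ with $|z|>cA$.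
   Context: $\mathbb{N}=\{0,1,2,\dots\}$. Conditions on the additive sub-semigroup $S\subset[0,\infty)$: (S1) $\mathbb{N}\subset S$; (S2) there is a constant $c>0$ such that $\sharp(S\cap[n,n+1))\le c^{n+1}$ for every $n\in\mathbb{N}$. Such a constant $c$ is fixed. The class $\mathcal{P}_S$: a probability measure $\mu$ on $\mathbb{R}$ belongs to $\mathcal{P}_S$ if there exist $\{a_\beta\}_{\beta\in S,\beta>0}\subset\mathbb{C}$ and $r,R>0$ such that the restriction of $\mu$ to $\{|x|\ge R\}$ is $$\mu|_{|x|\ge R}(dx)=\sum_{\beta\in S,\,\beta>0}\mathrm{Im}\left(a_\beta\left(\tfrac1x\right)^{\beta+1}\right)dx,$$ with $|a_\beta|\le r^\beta$ for all $\beta$ and $r<c^{-1}R$. Here $(1/x)^{\beta+1}$ is understood as $e^{i(\beta+1)\pi}|x|^{-\beta-1}$ for $x\le -R$ (and as the usual positive power for $x\ge R$). $\mathbb{C}_-=\{z\in\mathbb{C}:\mathrm{Im}\,z<0\}$. $G_\mu(z)=\int_{\mathbb{R}}\frac{1}{z-x}\mu(dx)$ is the Cauchy–Stieltjes transform and $F_\mu(z)=1/G_\mu(z)$ the reciprocal Cauchy transform, both considered on $\mathbb{C}_-$. Powers are principal: $z^\beta=e^{\beta\log z}$ on $\mathbb{C}\setminus(-\infty,0]$ with $-\pi<\mathrm{Im}\log z<\pi$. *)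

(* Defs.v *)
From mathcomp Require Import all_boot all_order all_algebra.
From mathcomp Require Import finmap complex.
From mathcomp Require Import all_classical all_reals all_analysis.
From mathcomp Require summability.

Set Implicit Arguments.
Unset Strict Implicit.
Unset Printing Implicit Defensive.
Import Order.TTheory GRing.Theory Num.Theory numFieldNormedType.Exports.

Local Open Scope classical_set_scope.
Local Open Scope complex_scope.
Local Open Scope ring_scope.

(* Unconditional summation over an arbitrary index set: [l] is the limit of the
   finite partial sums along the finite subsets of [S] directed by inclusion. *)
Definition has_sum (R : realType) (K : numFieldType) (S : set R)
    (f : R -> K) (l : K) : Prop :=
  summability.partial_sum (fun s : S => f (set_val s) : K^o)
    @ summability.totally --> (l : K^o).

Section complex_powers.
Variable R : realType.
Implicit Types (z : R[i]) (x s : R).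

Definition cexp z : R[i] :=
  (expR (complex.Re z))%:C * (cos (complex.Im z) +i* sin (complex.Im z)).

(* Principal argument, in ]-pi, pi] for z != 0; it is strictly inside the
   interval off the negative real axis. *)
Definition carg z : R :=
  let t := acos (complex.Re z / complex.Re `|z|) in
  if 0 <= complex.Im z then t else - t.

Definition clog z : R[i] := ln (complex.Re `|z|) +i* carg z.

Definition cpow z s : R[i] := cexp (s%:C * clog z).

(* (1/x)^s for real x != 0; for x < 0 it is the boundary value of z^(-s) as z
   tends to x from the lower half-plane. *)
Definition inv_pow x s : R[i] :=
  if 0 < x then (x^-1 `^ s)%:C
  else cexp (0 +i* (s * pi)) * (`|x| `^ (- s))%:C.

End complex_powers.

Section transforms.
Variables (R : realType) (mu : probability (measurableTypeR R) R).

Definition cintegral (f : R -> R[i]) : R[i] :=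
  (\int[mu]_x complex.Re (f x)) +i* (\int[mu]_x complex.Im (f x)).

Definition cauchy_transform (z : R[i]) : R[i] :=
  cintegral (fun x => (z - x%:C)^-1).

Definition recip_cauchy_transform (z : R[i]) : R[i] := (cauchy_transform z)^-1.

End transforms.

Definition additive_subsemigroup (R : realType) (S : set R) : Prop :=
  S `<=` [set x | 0 <= x] /\ (forall x y, S x -> S y -> S (x + y)).

Definition condition_S1 (R : realType) (S : set R) : Prop :=
  forall n : nat, S n%:R.

Definition condition_S2 (R : realType) (S : set R) (c : R) : Prop :=
  forall n : nat, let Sn := (S `&` `[n%:R, n.+1%:R[) in
    finite_set Sn /\ #|` fset_set Sn|%:R <= c ^+ n.+1.

(* [f] is the density on {|x| >= rho}, given there pointwise by the series. *)
Definition class_P (R : realType) (S : set R) (c : R)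
    (mu : probability (measurableTypeR R) R) : Prop :=
  exists (a : R -> R[i]) (r rho : R) (f : R -> R),
    [/\ 0 < r, 0 < rho, r < c^-1 * rho &
      (forall b, S b -> 0 < b -> `|a b| <= (r `^ b)%:C)] /\
    (forall x, rho <= `|x| ->
      has_sum (S `&` [set b | 0 < b])
        (fun b => complex.Im (a b * inv_pow x (b + 1))) (f x)) /\
    (forall B : set R, measurable B ->
      let D := [set x | rho <= `|x|] in
      mu (B `&` D) = (\int[lebesgue_measure]_(x in B `&` D) (f x)%:E)%E).

(* Main.v *)
(* (2) <-> (3): the formal series over S form a convolution algebra in which a
   series with constant term 1 has an inverse; (S2) turns geometric bounds into
   absolute convergence for |z| > c A, so the formal inverse is the actual one.

   (2) -> (1): by Stieltjes inversion the density on {|x| >= rho} is the limit of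
   Im G(x - i / n) / pi, computed term by term.

   (1) -> (2): split the integral defining G at |x| = rho. The inner part has an
   expansion in the powers z^(-n-1). For one term of the density, of exponent be,
   let H(z) be the outer integral. In logarithmic coordinates z = e^zeta the kernel
   k = e^((be+1) zeta) x^(-be-1) / (e^zeta - s x), with s = 1 or -1, satisfies
   dk/dzeta = - d(x k)/dx, so the derivative of z^(be+1) H(z) is a boundary term at
   |x| = rho, and expanding it in a geometric series shows that
   z^(be+1) (H(z) + E(z)) is a constant for an explicit Laurent series E in the
   powers z^(-n-1). That constant is the coefficient at the exponent be; its bound
   at one base point allows the sum over be by dominated convergence. Finally
   z G(z) -> 1 gives d_0 = 1. *)

Require Import Defs.
From HB Require Import structures.
From mathcomp Require Import all_boot all_order all_algebra.
From mathcomp Require Import finmap complex.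
From mathcomp Require Import all_classical all_reals all_analysis.
From mathcomp Require Import measurable_realfun.
From mathcomp Require summability.
From mathcomp Require Import ring lra.
Set Implicit Arguments.
Unset Strict Implicit.
Unset Printing Implicit Defensive.
Import Order.TTheory GRing.Theory Num.Theory numFieldNormedType.Exports.

Local Open Scope classical_set_scope.
Local Open Scope complex_scope.
Local Open Scope ring_scope.

(** The identity for k is Euler's relation for a kernel homogeneous of degree -1 in (z, x); it takes
    the place of contour deformation, and only derivatives in one real parameter occur. The
    logarithmic coordinate also settles the geometry: the part of the lower half-plane outside a
    disc becomes a convex half-strip. The obstacle is resonance. The density x^(-be-1) on one
    half-line alone produces a term z^(-n-1) log z when be is the natural number n, and a
    coefficient of size 1/|n - be| when be is near n. The phase in [inv_pow] ties the two half-lines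
    together: the numerator becomes Im (a (1 - e^(i (be - n) pi))), which vanishes to first order at
    be = n. The Laurent coefficients are thus bounded uniformly in be, which permits summing over
    all of S. Several estimates lose constant factors. The pure form A^g is recovered because (S2)
    leaves a gap above 0 in S, so a factor can be absorbed in the base; only the exponent 0 needs
    its exact value. *)

Local Notation normc := ComplexField.Normc.normc.

(** * Modulus, exponential, logarithm and powers of complex numbers *)

Section complex_basics.
Variable R : realType.
Implicit Types (z w : R[i]) (x y s t : R).

Lemma normr_normc z : `|z| = (normc z)%:C.
Proof. by []. Qed.

Lemma normc_ge0 z : 0 <= normc z.
Proof. by case: z => a b /=; rewrite sqrtr_ge0. Qed.

Lemma normc_gt0 z : (0 < normc z) = (z != 0).
Proof. by rewrite -ltcR -normr_normc normr_gt0. Qed.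

Lemma normc0 : normc (0 : R[i]) = 0.
Proof. exact: ComplexField.Normc.normc0. Qed.

Lemma normc1 : normc (1 : R[i]) = 1.
Proof. exact: ComplexField.Normc.normc1. Qed.

Lemma normcM z w : normc (z * w) = normc z * normc w.
Proof. exact: ComplexField.Normc.normcM. Qed.

Lemma normcV z : normc z^-1 = (normc z)^-1.
Proof. exact: ComplexField.Normc.normcV. Qed.

Lemma normcX z n : normc (z ^+ n) = normc z ^+ n.
Proof. by elim: n => [|n IH]; rewrite ?expr0 ?normc1// !exprS normcM IH. Qed.

Lemma normcN z : normc (- z) = normc z.
Proof. exact: normcN. Qed.

Lemma normcD z w : normc (z + w) <= normc z + normc w.
Proof. exact: le_normcD. Qed.

Lemma normcBC z w : normc (z - w) = normc (w - z).
Proof. by rewrite -normcN opprB. Qed.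

Lemma normcB_ge z w : normc z - normc w <= normc (z - w).
Proof. by rewrite lerBlDr (le_trans _ (normcD _ _))// subrK. Qed.

Lemma normc_sum (I : Type) (r : seq I) (P : pred I) (F : I -> R[i]) :
  normc (\sum_(i <- r | P i) F i) <= \sum_(i <- r | P i) normc (F i).
Proof.
elim/big_rec2: _ => [|i x z _ h]; first by rewrite normc0.
by rewrite (le_trans (normcD _ _))// lerD2l.
Qed.

Lemma normc_real x : normc x%:C = `|x|.
Proof. by rewrite /= expr0n /= addr0 sqrtr_sqr. Qed.

Lemma normc_realM x z : normc (x%:C * z) = `|x| * normc z.
Proof. by rewrite normcM normc_real. Qed.

Lemma normc_leRI z : normc z <= `|complex.Re z| + `|complex.Im z|.
Proof.
case: z => a b /=; rewrite -[leRHS]ger0_norm ?addr_ge0// -sqrtr_sqr ler_wsqrtr//.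
rewrite sqrrD !real_normK ?num_real// lerD2r lerDl.
by rewrite mulrn_wge0 ?mulr_ge0.
Qed.

Lemma normc_geRe z : `|complex.Re z| <= normc z.
Proof.
by case: z => a b /=; rewrite -sqrtr_sqr ler_wsqrtr// lerDl sqr_ge0.
Qed.

Lemma normc_geIm z : `|complex.Im z| <= normc z.
Proof.
by case: z => a b /=; rewrite -sqrtr_sqr ler_wsqrtr// lerDr sqr_ge0.
Qed.

Lemma ReD z w : complex.Re (z + w) = complex.Re z + complex.Re w.
Proof. by case: z; case: w. Qed.
Lemma ImD z w : complex.Im (z + w) = complex.Im z + complex.Im w.
Proof. by case: z; case: w. Qed.
Lemma ReN z : complex.Re (- z) = - complex.Re z.
Proof. by case: z. Qed.
Lemma ImN z : complex.Im (- z) = - complex.Im z.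
Proof. by case: z. Qed.
Lemma ReM z w : complex.Re (z * w) =
  complex.Re z * complex.Re w - complex.Im z * complex.Im w.
Proof. by case: z; case: w. Qed.
Lemma ImM z w : complex.Im (z * w) =
  complex.Re z * complex.Im w + complex.Im z * complex.Re w.
Proof. by case: z => a b; case: w. Qed.

Lemma complex_ext z w : complex.Re z = complex.Re w ->
  complex.Im z = complex.Im w -> z = w.
Proof. by case: z => a b; case: w => c d /= -> ->. Qed.

Lemma Im_sum (I : Type) (r : seq I) (P : pred I) (F : I -> R[i]) :
  complex.Im (\sum_(i <- r | P i) F i) = \sum_(i <- r | P i) complex.Im (F i).
Proof. by elim/big_rec2: _ => // i x z _ <-; rewrite ImD. Qed.

Lemma cexpD z w : cexp (z + w) = cexp z * cexp w.
Proof.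
apply: complex_ext; rewrite /cexp ?ReM ?ImM /= !ReD !ImD expRD ?cosD ?sinD; ring.
Qed.

Lemma cexp0 : cexp (0 : R[i]) = 1.
Proof. by rewrite /cexp /= expR0 cos0 sin0 mul1r. Qed.

Lemma normc_cexp z : normc (cexp z) = expR (complex.Re z).
Proof.
rewrite /cexp normcM normc_real ger0_norm ?expR_ge0//=.
by rewrite cos2Dsin2 sqrtr1 mulr1.
Qed.

Lemma cexp_neq0 z : cexp z != 0.
Proof. by rewrite -normc_gt0 normc_cexp expR_gt0. Qed.

Lemma cexpN z : cexp (- z) = (cexp z)^-1.
Proof.
by apply: (mulfI (cexp_neq0 z)); rewrite -cexpD subrr cexp0 mulfV ?cexp_neq0.
Qed.

Lemma cexpMn z n : cexp (n%:R * z) = cexp z ^+ n.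
Proof.
elim: n => [|n IH]; first by rewrite mul0r cexp0.
by rewrite -natr1 mulrDl mul1r cexpD IH exprSr.
Qed.

Lemma Re_realM x z : complex.Re (x%:C * z) = x * complex.Re z.
Proof. by rewrite ReM /= mul0r subr0. Qed.
Lemma Im_realM x z : complex.Im (x%:C * z) = x * complex.Im z.
Proof. by rewrite ImM /= mul0r addr0. Qed.

Lemma Re_cexp z : complex.Re (cexp z) = expR (complex.Re z) * cos (complex.Im z).
Proof. by rewrite /cexp Re_realM. Qed.

Lemma Im_cexp z : complex.Im (cexp z) = expR (complex.Re z) * sin (complex.Im z).
Proof. by rewrite /cexp Im_realM. Qed.

Lemma Im_lt0_neq0 z : complex.Im z < 0 -> z != 0.
Proof. by apply: contraTneq => ->; rewrite ltxx. Qed.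

Lemma clogK z : z != 0 -> cexp (clog z) = z.
Proof.
move=> z0; have n0 : 0 < normc z by rewrite normc_gt0.
rewrite /cexp /clog /= lnK ?posrE// /carg /=.
have h : -1 <= complex.Re z / normc z <= 1.
  by rewrite -ler_norml normrM normfV (ger0_norm (ltW n0)) ler_pdivrMr ?mul1r ?normc_geRe.
set t := acos _; have ct : cos t = complex.Re z / normc z by rewrite acosK ?in_itv.
have st : sin t = `|complex.Im z| / normc z.
  rewrite sin_acos// -[RHS]ger0_norm ?divr_ge0// ?normc_ge0// -sqrtr_sqr; congr Num.sqrt.
  have n2 : normc z ^+ 2 = complex.Re z ^+ 2 + complex.Im z ^+ 2.
    by case: (z) => a b /=; rewrite sqr_sqrtr// addr_ge0 ?sqr_ge0.
  rewrite !expr_div_n real_normK ?num_real//.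
  rewrite -[1](@divff _ (normc z ^+ 2)) ?expf_neq0 ?gt_eqF// -mulrBl.
  by congr (_ / _); rewrite n2 addrAC subrr add0r.
have E u v : ln (normc z) = u -> (normc z)%:C *
   (complex.Re z / normc z +i* (v / normc z)) = complex.Re z +i* v :> R[i].
  by move=> _; apply: complex_ext; rewrite ?Re_realM ?Im_realM /=; field; rewrite gt_eqF.
case: ifPn => [i0|]; first by rewrite ct st ger0_norm// (E _ _ erefl); case: (z).
rewrite -ltNge => i0; rewrite cosN sinN ct st ltr0_norm// mulNr opprK (E _ _ erefl).
by case: (z).
Qed.

Lemma Re_clog z : complex.Re (clog z) = ln (normc z).
Proof. by []. Qed.

(** In the lower half-plane the argument is minus an [acos], hence in [-pi, 0]. Both ends are
    excluded since their sine vanishes, whereas [cexp (clog z) = z] has negative imaginary part. *)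
Lemma Im_clog_lt0 z : complex.Im z < 0 -> - pi < complex.Im (clog z) < 0.
Proof.
move=> z0; have nz := Im_lt0_neq0 z0; have n0 : 0 < normc z by rewrite normc_gt0.
have st : sin (complex.Im (clog z)) < 0.
  have := Im_cexp (clog z); rewrite clogK// => h.
  by move: z0; rewrite h pmulr_rlt0 ?expR_gt0.
rewrite /clog /= /carg /= in st *; rewrite leNgt z0 /= in st *.
set t := acos _ in st *.
have h : -1 <= complex.Re z / normc z <= 1.
  by rewrite -ler_norml normrM normfV (ger0_norm (ltW n0)) ler_pdivrMr ?mul1r ?normc_geRe.
have t0 : 0 <= t by exact: acos_ge0.
have t1 : t <= pi by exact: acos_lepi.
rewrite ltrN2 oppr_lt0 !lt_neqAle t0 t1 !andbT.
by apply/andP; split; [apply: contraTneq st => ->|apply: contraTneq st => <-];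
  rewrite sinN ?sin0 ?sinpi oppr0 ltxx.
Qed.

Lemma cpowE z s : cpow z s = cexp (s%:C * clog z).
Proof. by []. Qed.

Lemma cpow_neq0 z s : cpow z s != 0.
Proof. exact: cexp_neq0. Qed.

Lemma normc_cpow z s : z != 0 -> normc (cpow z s) = normc z `^ s.
Proof.
by move=> z0; rewrite normc_cexp Re_realM Re_clog /powR gt_eqF// normc_gt0.
Qed.

Lemma cpowD z s t : cpow z (s + t) = cpow z s * cpow z t.
Proof. by rewrite /cpow rmorphD mulrDl cexpD. Qed.

Lemma cpow0 z : cpow z 0 = 1.
Proof. by rewrite /cpow mul0r cexp0. Qed.

Lemma cpow_nat z n : z != 0 -> cpow z n%:R = z ^+ n.
Proof. by move=> z0; rewrite /cpow rmorph_nat cexpMn clogK. Qed.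

Lemma cpow1 z : z != 0 -> cpow z 1 = z.
Proof. by move=> z0; rewrite -(mulr1n 1) cpow_nat. Qed.

End complex_basics.

(** * Unconditional sums in terms of finite sets of reals *)

Section unconditional_sums.
Variables (R : realType) (S : set R).

(** Replaces finite subsets of the subtype [S] by finite sets of reals included in [S], so that sums
    over different index sets can be compared. *)
Lemma has_sumP (K : numFieldType) (f : R -> K) (l : K) :
  has_sum S f l <-> forall e : K, 0 < e -> exists2 A : {fset R},
    [set` A] `<=` S & forall B : {fset R}, [set` B] `<=` S -> (A `<=` B)%fset ->
    `|l - \sum_(b <- B) f b| < e.
Proof.
have psE (B : {fset S}) : summability.partial_sum (fun s : S => f (set_val s) : K^o) B
    = \sum_(b <- ((@set_val _ S) @` B)%fset) f b.
  rewrite /summability.partial_sum big_imfset/=; last by move=> x y _ _ /val_inj.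
  by rewrite big_seq_fsetE.
have liftB (B : {fset R}) : [set` B] `<=` S ->
    exists B' : {fset S}, ((@set_val _ S) @` B')%fset = B.
  move=> BS; exists (fset_set ((@set_val _ S) @^-1` [set` B])).
  have fin : finite_set ((@set_val _ S) @^-1` [set` B]).
    by apply: finite_preimage => //; move=> x y _ _ /val_inj.
  apply/fsetP => x; apply/imfsetP/idP => [[y /=]|xB].
    by rewrite in_fset_set// inE/= => yB ->.
  by exists (SigSub (mem_set (BS _ xB))) => //=; rewrite in_fset_set// inE.
have tF : Filter (@summability.totally S) by have [] := @summability.totally_filter S.
split=> [/cvgrPdist_lt h e e0|h].
  have [A _ AB] := h e e0.
  exists ((@set_val _ S) @` A)%fset.
    by move=> x /= /imfsetP[y /= _ ->]; exact: set_valP.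
  move=> B /liftB[B' <-] /fsubsetP sAB; rewrite -psE; apply: AB => /=.
  apply/fsubsetP => x xA; have /sAB/imfsetP[y /= yB /val_inj ->] // :
    set_val x \in ((@set_val _ S) @` A)%fset by apply/imfsetP; exists x.
apply/cvgrPdist_lt => e e0.
have [A /liftB[A' A'E] AB] := h e e0.
exists A' => // B /= /fsubsetP sAB; rewrite psE; apply: AB.
  by move=> x /= /imfsetP[y /= _ ->]; exact: set_valP.
rewrite -A'E; apply/fsubsetP => x /imfsetP[y /= /sAB yB ->].
by apply/imfsetP; exists y.
Qed.

Lemma has_sum_Im (f : R -> R[i]) (l : R[i]) :
  has_sum S f l -> has_sum S (fun b => complex.Im (f b)) (complex.Im l).
Proof.
move=> /has_sumP h; apply/has_sumP => e e0.
have [|A AS AB] := h e%:C; first by rewrite ltcR.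
exists A => // B BS sAB; have := AB B BS sAB.
rewrite normr_normc ltcR; apply: le_lt_trans.
by apply: le_trans (normc_geIm _); rewrite ImD ImN Im_sum.
Qed.

Lemma eq_has_sum (K : numFieldType) (f g : R -> K) l :
  (forall b, S b -> f b = g b) -> has_sum S f l -> has_sum S g l.
Proof.
move=> fg /has_sumP h; apply/has_sumP => e /h[A AS AB].
exists A => // B BS sAB; have := AB B BS sAB; congr (`|l - _| < _).
by apply: eq_big_seq => b bB; rewrite fg//; exact: BS.
Qed.

End unconditional_sums.

(** * Counting the exponents by unit slices *)

Section levels.
Variables (R : realType) (S : set R) (c : R).
Hypothesis S_ge0 : S `<=` [set x | 0 <= x].
Hypothesis S2 : condition_S2 S c.

Definition slice (n : nat) : {fset R} := fset_set (S `&` `[n%:R, n.+1%:R[).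
Definition slices (m n : nat) : seq R := flatten [seq (slice k : seq R) | k <- index_iota m n].
(** By (S2) these lists are finite, and they exhaust [S]. Unconditional sums thereby become limits
    of sequences indexed by an integer cut-off. *)
Definition below (N : nat) : seq R := slices 0 N.

Lemma mem_slice n b : (b \in slice n) = `[< S b >] && (n%:R <= b < n.+1%:R).
Proof.
rewrite in_fset_set; last by have [] := S2 n.
by apply/idP/idP; rewrite in_setE; [case=> /asboolP -> /= |move=> /andP[/asboolP ? ?]; split];
  rewrite /= ?in_itv.
Qed.

Lemma mem_slices m n b : (b \in slices m n) = `[< S b >] && (m%:R <= b < n%:R).
Proof.
apply/flattenP/idP => [[s /mapP[k]]|/andP[Sb /andP[mb bn]]].
  rewrite mem_index_iota => /andP[mk kn] -> ; rewrite mem_slice.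
  move=> /andP[-> /andP[kb bk]]/=; apply/andP; split.
    by rewrite (le_trans _ kb)// ler_nat.
  by rewrite (lt_le_trans bk)// ler_nat.
have b0 : 0 <= b by rewrite (le_trans _ mb).
have /andP[t1 t2] := truncn_itv b0.
exists (slice (Num.truncn b) : seq R); last by rewrite mem_slice Sb t1 t2.
apply/mapP; exists (Num.truncn b) => //; rewrite mem_index_iota.
apply/andP; split.
  by rewrite -ltnS -(ltr_nat R) (le_lt_trans mb).
by rewrite -(ltr_nat R) (le_lt_trans t1).
Qed.

Lemma mem_below N b : (b \in below N) = `[< S b >] && (b < N%:R).
Proof.
rewrite mem_slices; case: asboolP => //= Sb.
by rewrite (S_ge0 Sb).
Qed.

Lemma uniq_slices m n : uniq (slices m n).
Proof.
rewrite /slices; have : uniq (index_iota m n) by exact: iota_uniq.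
elim: (index_iota m n) => //= k s IH /andP[ks us].
rewrite cat_uniq fset_uniq IH// andbT /=; apply/hasPn => b /flattenP[t /mapP[j js ->]].
rewrite !mem_slice => /andP[-> /andP[jb bj]]/=; apply/negP => /andP[kb bk].
have : (k < j.+1)%N by rewrite -(ltr_nat R) (le_lt_trans kb).
have : (j < k.+1)%N by rewrite -(ltr_nat R) (le_lt_trans jb).
rewrite !ltnS => jk kj; have ekj : k = j by apply/eqP; rewrite eqn_leq jk kj.
by rewrite ekj js in ks.
Qed.

Lemma uniq_below N : uniq (below N).
Proof. exact: uniq_slices. Qed.

Lemma below_cat m n : (m <= n)%N -> below n = below m ++ slices m n.
Proof.
move=> mn; rewrite /below /slices -flatten_cat -map_cat; congr flatten.
by rewrite /index_iota !subn0 -{1}(subnKC mn) iotaD add0n.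
Qed.

Lemma sumr_sub (s t : seq R) (g : R -> R) : uniq s -> uniq t -> {subset s <= t} ->
  (forall b, b \in t -> 0 <= g b) -> \sum_(b <- s) g b <= \sum_(b <- t) g b.
Proof.
move=> us ut st g0; have -> : \sum_(b <- s) g b = \sum_(b <- t | b \in s) g b.
  rewrite -[RHS]big_filter; apply: perm_big; apply: uniq_perm => //; first exact: filter_uniq.
  by move=> b; rewrite mem_filter; case: (boolP (b \in s)) => //= /st ->.
rewrite big_mkcond/= big_seq [leRHS]big_seq ler_sum// => b bt.
by case: ifP => // _; exact: g0.
Qed.

Lemma subset_below (B : seq R) : (forall b, b \in B -> S b) ->
  exists N, {subset B <= below N}.
Proof.
elim: B => [|b B IH] h; first by exists 0%N.
have [|N BN] := IH; first by move=> x xB; apply: h; rewrite inE xB orbT.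
have Sb : S b by apply: h; rewrite mem_head.
exists (maxn N (Num.truncn b).+1) => x; rewrite inE => /orP[/eqP ->|/BN].
  rewrite mem_below; apply/andP; split; first exact/asboolP.
  have /andP[_ /lt_le_trans] := truncn_itv (S_ge0 Sb); apply.
  by rewrite ler_nat leq_maxr.
rewrite !mem_below => /andP[-> /lt_le_trans]; apply.
by rewrite ler_nat leq_maxl.
Qed.

(** The first slice contains the exponent 0, so its cardinality, at most [c], is at least 1. *)
Lemma condition_S2_ge1 : S 0 -> 0 <= c -> 1 <= c.
Proof.
move=> S0 c0; have [fS] := S2 0; rewrite expr1; apply: le_trans.
rewrite ler1n cardfs_gt0; apply/fset0Pn; exists 0.
by rewrite (mem_slice 0) lexx ltr01 !andbT; exact/asboolP.
Qed.

(** A slice has at most [c ^+ n.+1] exponents, each contributing at most [q ^+ n] because [q <= 1].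
    This is where the condition [c * q < 1] for summability over [S] comes from. *)
Lemma slice_bound q n : 0 < q -> q <= 1 ->
  \sum_(b <- slice n) q `^ b <= c * (c * q) ^+ n.
Proof.
move=> q0 q1; apply: (@le_trans _ _ (\sum_(b <- slice n) q ^+ n)).
  rewrite big_seq [leRHS]big_seq ler_sum// => b; rewrite mem_slice => /andP[_ /andP[nb _]].
  by rewrite -powR_mulrn ?(ltW q0)//; apply: ger_powR; rewrite ?q0.
rewrite big_const_seq count_predT iter_addr_0 -[X in X <= _]mulr_natl.
by rewrite exprMn mulrA -exprS ler_wpM2r ?exprn_ge0 ?(ltW q0)//; have [] := S2 n.
Qed.

Lemma sum_geo_le (x : R) m n : 0 <= x -> x < 1 ->
  \sum_(m <= k < n) x ^+ k <= x ^+ m / (1 - x).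
Proof.
move=> x0 x1; rewrite ler_pdivlMr ?subr_gt0//.
case: (leqP m n) => mn; last first.
  by rewrite big_geq ?mul0r ?exprn_ge0// ltnW.
apply: (@le_trans _ _ (x ^+ m - x ^+ n)); last by rewrite gerBl exprn_ge0.
rewrite le_eqVlt; apply/orP; left; apply/eqP.
rewrite mulr_suml -(opprB (x ^+ n)) -(@telescope_sumr _ m n (fun k => x ^+ k))// -sumrN.
by apply: eq_bigr => k _; rewrite exprS; ring.
Qed.

Lemma slices_bound q m n : 0 < q -> q <= 1 -> 0 <= c -> c * q < 1 ->
  \sum_(b <- slices m n) q `^ b <= c * ((c * q) ^+ m / (1 - c * q)).
Proof.
move=> q0 q1 c0 cq; rewrite /slices big_flatten big_map.
apply: (@le_trans _ _ (\sum_(m <= k < n) c * (c * q) ^+ k)).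
  by apply: ler_sum => k _; exact: slice_bound.
by rewrite -mulr_sumr ler_wpM2l// sum_geo_le// mulr_ge0// ltW.
Qed.

Lemma tail_bound (B : seq R) q m : uniq B -> (forall b, b \in B -> S b /\ m%:R <= b) ->
  0 < q -> q <= 1 -> 0 <= c -> c * q < 1 ->
  \sum_(b <- B) q `^ b <= c * ((c * q) ^+ m / (1 - c * q)).
Proof.
move=> uB hB q0 q1 c0 cq.
have [|N BN] := @subset_below B; first by move=> b /hB[].
apply: le_trans (@slices_bound q m N q0 q1 c0 cq).
apply: sumr_sub => //; first exact: uniq_slices.
  move=> b bB; have := BN _ bB; rewrite mem_below mem_slices => /andP[-> ->].
  by have [_ ->] := hB _ bB.
by move=> b _; exact: powR_ge0.
Qed.

End levels.

(** * Limits of complex sequences *)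

Section complex_limits.
Variable R : realType.
Implicit Types (u v : nat -> R[i]) (l : R[i]).

Lemma cvgn0D (e f : nat -> R) : e @ \oo --> (0 : R) -> f @ \oo --> (0 : R) ->
  (fun n => e n + f n) @ \oo --> (0 : R).
Proof. by move=> he hf; rewrite -(addr0 0); exact: cvgD. Qed.

Lemma cvgn0Z (k : R) (e : nat -> R) : e @ \oo --> (0 : R) ->
  (fun n => k * e n) @ \oo --> (0 : R).
Proof. by move=> he; rewrite -(mulr0 k); exact: cvgMl_tmp. Qed.

Lemma cvgn0M (e f : nat -> R) : e @ \oo --> (0 : R) -> f @ \oo --> (0 : R) ->
  (fun n => e n * f n) @ \oo --> (0 : R).
Proof. by move=> he hf; rewrite -(mulr0 0); exact: cvgM. Qed.

(** Convergence is read off the real sequence of moduli, so that squeezing and real limits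
    suffice. *)
Definition ccvg u l := (fun n => normc (u n - l)) @ \oo --> (0 : R).

Lemma ccvg_squeeze u l (e : nat -> R) :
  (forall n, normc (u n - l) <= e n) -> e @ \oo --> (0 : R) -> ccvg u l.
Proof.
move=> h e0; apply: (@squeeze_cvgr _ _ _ _ (cst 0) e) => //; last exact: cvg_cst.
by near=> n; rewrite normc_ge0 h.
Unshelve. all: end_near. Qed.

Lemma ccvg_squeeze_near u l (e : nat -> R) :
  (\forall n \near \oo, normc (u n - l) <= e n) -> e @ \oo --> (0 : R) -> ccvg u l.
Proof.
move=> h e0; apply: (@squeeze_cvgr _ _ _ _ (cst 0) e) => //; last exact: cvg_cst.
by near=> n; rewrite normc_ge0 /=; near: n.
Unshelve. all: end_near. Qed.

Lemma ccvg_near u v l : (\forall n \near \oo, u n = v n) -> ccvg u l -> ccvg v l.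
Proof.
by move=> uv; apply: cvg_trans; apply: near_eq_cvg; apply: filterS uv => n /= ->.
Qed.

Lemma ccvg_cst l : ccvg (fun=> l) l.
Proof. by rewrite /ccvg subrr normc0; exact: cvg_cst. Qed.

Lemma ccvgD u v l m : ccvg u l -> ccvg v m -> ccvg (fun n => u n + v n) (l + m).
Proof.
move=> ul vm; apply: (@ccvg_squeeze _ _ (fun n => normc (u n - l) + normc (v n - m))).
  by move=> n; apply: le_trans (normcD _ _); rewrite opprD addrACA.
exact: cvgn0D.
Qed.

Lemma ccvgZ u l (k : R[i]) : ccvg u l -> ccvg (fun n => k * u n) (k * l).
Proof.
move=> ul; rewrite /ccvg; under eq_fun do rewrite -mulrBr normcM.
exact: cvgn0Z.
Qed.

Lemma ccvgN u l : ccvg u l -> ccvg (fun n => - u n) (- l).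
Proof.
by move=> ul; rewrite /ccvg; under eq_fun do rewrite -opprD normcN.
Qed.

Lemma ccvgB u v l m : ccvg u l -> ccvg v m -> ccvg (fun n => u n - v n) (l - m).
Proof. by move=> ul vm; apply: ccvgD => //; exact: ccvgN. Qed.

Lemma ccvgM u v l m : ccvg u l -> ccvg v m -> ccvg (fun n => u n * v n) (l * m).
Proof.
move=> ul vm; apply: (@ccvg_squeeze _ _ (fun n => normc (u n - l) * normc (v n - m) +
    (normc l * normc (v n - m) + normc m * normc (u n - l)))).
  move=> n; rewrite -!normcM; have -> : u n * v n - l * m =
    (u n - l) * (v n - m) + (l * (v n - m) + m * (u n - l)) by ring.
  by rewrite (le_trans (normcD _ _))// lerD2l normcD.
by apply: cvgn0D; [exact: cvgn0M|apply: cvgn0D; exact: cvgn0Z].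
Qed.

Lemma ccvg_unique u l m : ccvg u l -> ccvg u m -> l = m.
Proof.
move=> ul um; have := ccvgB ul um; rewrite /ccvg.
under eq_fun do rewrite subrr sub0r normcN.
move=> /(cvg_unique _ (cvg_cst _)) h; apply/eqP; rewrite -subr_eq0.
by have := normc_gt0 (l - m); rewrite h// ltxx => /esym/negbFE.
Qed.

Lemma ccvg_Re u l : ccvg u l -> (fun n => complex.Re (u n)) @ \oo --> complex.Re l.
Proof.
move=> ul; apply/subr_cvg0; apply/norm_cvg0P.
apply: (@squeeze_cvgr _ _ _ _ (cst 0) (fun n => normc (u n - l))) => //; last exact: cvg_cst.
by near=> n; rewrite normr_ge0 /= -ReN -ReD normc_geRe.
Unshelve. all: end_near. Qed.

Lemma ccvg_Im u l : ccvg u l -> (fun n => complex.Im (u n)) @ \oo --> complex.Im l.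
Proof.
move=> ul; apply/subr_cvg0; apply/norm_cvg0P.
apply: (@squeeze_cvgr _ _ _ _ (cst 0) (fun n => normc (u n - l))) => //; last exact: cvg_cst.
by near=> n; rewrite normr_ge0 /= -ImN -ImD normc_geIm.
Unshelve. all: end_near. Qed.

Lemma ccvg_ReIm u l : (fun n => complex.Re (u n)) @ \oo --> complex.Re l ->
  (fun n => complex.Im (u n)) @ \oo --> complex.Im l -> ccvg u l.
Proof.
move=> /subr_cvg0/cvg_norm; rewrite normr0 => hr /subr_cvg0/cvg_norm; rewrite normr0 => hi.
apply: (@ccvg_squeeze _ _ (fun n => `|complex.Re (u n) - complex.Re l| +
  `|complex.Im (u n) - complex.Im l|)).
  by move=> n; rewrite (le_trans (normc_leRI _))// ReD ImD ReN ImN.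
by rewrite -(addr0 0); apply: cvgD.
Qed.

Lemma ccvg_normc u l : ccvg u l -> (fun n => normc (u n)) @ \oo --> normc l.
Proof.
move=> ul; apply/subr_cvg0; apply/norm_cvg0P.
apply: (@squeeze_cvgr _ _ _ _ (cst 0) (fun n => normc (u n - l))) => //; last exact: cvg_cst.
near=> n; rewrite normr_ge0 /= ler_norml normcB_ge andbT lerNl opprB normcBC.
by rewrite normcB_ge.
Unshelve. all: end_near. Qed.

Lemma ccvg_le u l (M : R) : (forall n, normc (u n) <= M) -> ccvg u l -> normc l <= M.
Proof.
move=> h /ccvg_normc ul; rewrite -(cvg_lim _ ul)//; apply: limr_le; first by apply/cvg_ex; exists (normc l).
by near=> n.
Unshelve. all: end_near. Qed.

End complex_limits.

(** * Sums over the exponents dominated by a geometric bound *)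

Section dominated_sums.
Variables (R : realType) (S : set R) (c : R).
Hypothesis S_ge0 : S `<=` [set x | 0 <= x].
Hypothesis S2 : condition_S2 S c.
Hypothesis c0 : 0 <= c.

Definition psum (f : R -> R[i]) (N : nat) : R[i] := \sum_(b <- below S N) f b.

Lemma has_sum_psum f l : has_sum S f l -> ccvg (psum f) l.
Proof.
move=> /has_sumP h; apply/cvgrPdist_lt => e e0.
have [|A AS AB] := h e%:C; first by rewrite ltcR.
have [|N BN] := @subset_below _ _ _ S_ge0 S2 A; first by move=> b /AS.
exists N => // n /= Nn; rewrite sub0r normrN ger0_norm ?normc_ge0// normcBC.
have /= := AB [fset b in below S n]%fset.
have -> : \sum_(b <- [fset b in below S n]%fset) f b = psum f n.
  apply: perm_big; apply: uniq_perm => //; first exact: uniq_below S2 _.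
  by move=> b; rewrite inE.
rewrite normr_normc ltcR; apply.
  by move=> b /=; rewrite !inE (mem_below S_ge0 S2) => /andP[/asboolP].
apply/fsubsetP => b /BN; rewrite !inE !(mem_below S_ge0 S2) => /andP[-> /lt_le_trans]; apply.
by rewrite ler_nat.
Qed.

Variables (f : R -> R[i]) (M q : R).
Hypothesis (q0 : 0 < q) (q1 : q <= 1) (cq : c * q < 1).
Hypothesis fb : forall b, S b -> normc (f b) <= M * q `^ b.
Hypothesis M0 : 0 <= M.

Let tail N := M * (c * ((c * q) ^+ N / (1 - c * q))).

Let tail0 : tail @ \oo --> (0 : R).
Proof.
have -> : tail = fun N => (M * (c / (1 - c * q))) * (c * q) ^+ N.
  by apply/funext => N; rewrite /tail; ring.
apply: cvgn0Z.
apply: cvg_expr; rewrite ger0_norm// mulr_ge0// ltW//.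
Qed.

Lemma normc_sum_tail (B : seq R) N : uniq B -> (forall b, b \in B -> S b /\ N%:R <= b) ->
  normc (\sum_(b <- B) f b) <= M * (c * ((c * q) ^+ N / (1 - c * q))).
Proof.
move=> uB hB; apply: le_trans (normc_sum _ _ _) _.
apply: (@le_trans _ _ (\sum_(b <- B) M * q `^ b)).
  by rewrite big_seq [leRHS]big_seq ler_sum// => b /hB[Sb _]; exact: fb.
by rewrite -mulr_sumr ler_wpM2l// (tail_bound S_ge0 S2).
Qed.

Lemma psum_tail m n : (m <= n)%N ->
  normc (psum f n - psum f m) <= M * (c * ((c * q) ^+ m / (1 - c * q))).
Proof.
move=> mn; rewrite /psum (below_cat _ mn) big_cat /= addrAC subrr add0r.
apply: normc_sum_tail; first exact: uniq_slices S2 _ _.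
move=> b; rewrite (mem_slices S2) => /andP[/asboolP ? /andP[]//].
Qed.

Lemma psum_bound n : normc (psum f n) <= M * (c * ((1 - c * q)^-1)).
Proof.
have := psum_tail (leq0n n).
by rewrite {2}/psum /below /slices big_nil subr0 expr0 mul1r.
Qed.

Lemma psum_ccvg : exists l, ccvg (psum f) l.
Proof.
have cau (F : nat -> R) : (forall m n, (m <= n)%N -> `|F n - F m| <= tail m) -> cvgn F.
  move=> h; apply: cauchy_cvg; apply/cauchy_exP => e e0.
  have /cvgrPdist_lt /(_ e e0)[N _ hN] := tail0.
  exists (F N); exists N => // n /= Nn; rewrite /ball /= distrC (le_lt_trans (h _ _ Nn))//.
  have := hN N (leqnn _); rewrite /= sub0r normrN; apply: le_lt_trans; exact: ler_norm.
have /cvg_ex[x hx] : cvgn (fun n => complex.Re (psum f n)).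
  apply: cau => m n mn; rewrite -ReN -ReD; apply: le_trans (normc_geRe _) _; exact: psum_tail.
have /cvg_ex[y hy] : cvgn (fun n => complex.Im (psum f n)).
  apply: cau => m n mn; rewrite -ImN -ImD; apply: le_trans (normc_geIm _) _; exact: psum_tail.
by exists (x +i* y); apply: ccvg_ReIm.
Qed.

Lemma psum_lim_tail l N : ccvg (psum f) l ->
  normc (l - psum f N) <= M * (c * ((c * q) ^+ N / (1 - c * q))).
Proof.
move=> hl; have h : ccvg (fun n => psum f (n + N) - psum f N) (l - psum f N).
  apply: ccvgB; last exact: ccvg_cst.
  by rewrite /ccvg (cvg_shiftn N (fun n => normc (psum f n - l))).
by apply: ccvg_le h => n; apply: psum_tail; rewrite leq_addl.
Qed.

(** Under the geometric domination, convergence along the cut-offs is already unconditional: a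
    finite set containing [below S N] adds to it only exponents at least [N], whose total modulus is
    bounded by the tail. *)
Lemma psum_has_sum l : ccvg (psum f) l -> has_sum S f l.
Proof.
move=> hl; apply/has_sumP => e e0.
(* A positive element of [R[i]] is real, so the estimate can be run on its real part. *)
have e0' : 0 < complex.Re e by move: e0; rewrite ltcE => /andP[].
have eE : e = (complex.Re e)%:C.
  by move: e0; rewrite ltcE => /andP[/eqP /= + _]; case: (e) => x y /= ->.
have e2 : 0 < complex.Re e / 2 by rewrite divr_gt0.
have /cvgrPdist_lt /(_ _ e2)[N _ hN] := tail0.
have tN : tail N < complex.Re e / 2.
  have := hN N (leqnn _); rewrite /= sub0r normrN; apply: le_lt_trans; exact: ler_norm.
exists [fset b in below S N]%fset.
  by move=> b /=; rewrite inE (mem_below S_ge0 S2) => /andP[/asboolP].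
move=> B BS /fsubsetP AB; rewrite eE normr_normc ltcR.
have -> : \sum_(b <- B) f b = psum f N + \sum_(b <- B | b \notin below S N) f b.
  rewrite (bigID (mem (below S N)))/=; congr (_ + _).
  rewrite -big_filter; apply: perm_big; apply: uniq_perm; rewrite ?filter_uniq ?(uniq_below S2) ?fset_uniq//.
  move=> b; rewrite mem_filter andb_idr// => bN; apply: AB; by rewrite inE.
rewrite opprD addrA (le_lt_trans (normcD _ _))//.
rewrite [ltRHS]splitr; apply: ltrD; first exact: le_lt_trans (psum_lim_tail _ hl) tN.
rewrite normcN -big_filter; apply: le_lt_trans tN; apply: normc_sum_tail.
  by rewrite filter_uniq// fset_uniq.
move=> b; rewrite mem_filter (mem_below S_ge0 S2) => /andP[nb /BS Sb]; split=> //.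
by move: nb; rewrite (asboolT Sb) /= -leNgt.
Qed.

End dominated_sums.

(** * The convolution algebra of formal series and its inverses *)

Section convolution.
Variables (R : realType) (S : set R) (c : R).
Hypothesis S_ge0 : S `<=` [set x | 0 <= x].
Hypothesis S_add : forall x y, S x -> S y -> S (x + y).
Hypothesis S_0 : S 0.
Hypothesis S2 : condition_S2 S c.
Hypothesis c0 : 0 < c.

Let c1 : 1 <= c. Proof. exact: condition_S2_ge1 S2 S_0 (ltW c0). Qed.

(** Only finitely many exponents lie in [0, 1), so the positive ones among them have a positive
    minimum. *)
Lemma semigroup_gap : exists2 dl : R, 0 < dl & forall e, S e -> 0 < e -> dl <= e.
Proof.
have gap (s : seq R) : exists2 dl : R, 0 < dl & forall e, e \in s -> 0 < e -> dl <= e.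
  elim: s => [|x s [dl dl0 h]]; first by exists 1.
  case: (ltP 0 x) => x0.
    exists (Num.min x dl); first by rewrite lt_min x0.
    by move=> e; rewrite inE => /orP[/eqP -> _|/h he /he]; rewrite ge_min ?lexx// => ->; rewrite orbT.
  exists dl => // e; rewrite inE => /orP[/eqP -> |/h//].
  by move=> /(le_lt_trans x0); rewrite ltxx.
have [dl dl0 h] := gap (slice S 0).
exists (Num.min dl 1); first by rewrite lt_min dl0 ltr01.
move=> e Se e0; rewrite ge_min; case: (ltP e 1) => e1; last by rewrite orbT.
by rewrite h// (mem_slice S2) (ltW e0) e1 asboolT.
Qed.

(** For [K >= 1] and [g >= dl] one has K <= K^(g/dl), so the factor can be moved into the base as
    K^(1/dl). This fails at exponent 0, which is therefore excluded. *)
Lemma absorb_constant (K r : R) : 0 < r ->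
  exists2 A, r <= A & forall g, S g -> 0 < g -> K * r `^ g <= A `^ g.
Proof.
move=> r0; have [dl dl0 hdl] := semigroup_gap.
pose K' := Num.max K 1.
have K1 : 1 <= K' by rewrite le_max lexx orbT.
have K0 : 0 < K' by exact: lt_le_trans K1.
exists (r * K' `^ dl^-1).
  by rewrite ler_pMr// -(powRr0 K') ler_powR// invr_ge0 ltW.
move=> g Sg g0; rewrite powRM ?powR_ge0 ?(ltW r0)// mulrC ler_wpM2l ?powR_ge0//.
apply: (@le_trans _ _ K'); first by rewrite le_max lexx.
rewrite -powRrM -[leLHS]powRr1 ?(ltW K0)// ler_powR//.
by rewrite ler_pdivlMl// mulr1 hdl.
Qed.

(** Closes the induction that bounds the formal inverse. With [c * q = 1/2] and t^dl = q, the choice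
    A / B = q t gives t^e <= q for every positive exponent, so the sum is at most q c / (1 - c q) =
    1. *)
Lemma positive_part_small (A : R) : 0 < A ->
  exists2 B, 0 < B & forall s : seq R, uniq s -> (forall e, e \in s -> S e /\ 0 < e) ->
    \sum_(e <- s) (A / B) `^ e <= 1.
Proof.
move=> A0; have [dl dl0 hdl] := semigroup_gap.
pose q := (2 * c)^-1; pose t := q `^ dl^-1.
have q0 : 0 < q by rewrite invr_gt0 mulr_gt0.
have q1 : q <= 1.
  by rewrite invf_le1 ?mulr_gt0// (le_trans c1)// ler_peMl// ?(ltW c0)// ler1n.
have cq : c * q = 2^-1 by rewrite /q; field; rewrite gt_eqF.
have t0 : 0 < t by exact: powR_gt0.
have t1 : t <= 1.
  by rewrite /t -(powRr0 q); apply: ger_powR; rewrite ?q0 ?q1 ?invr_ge0 ?(ltW dl0).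
have tdl : t `^ dl = q by rewrite -powRrM mulVf ?gt_eqF// powRr1// ltW.
exists (A / (q * t)); first by rewrite divr_gt0// mulr_gt0.
move=> s us hs; have -> : A / (A / (q * t)) = q * t by field; rewrite !gt_eqF.
apply: (@le_trans _ _ (\sum_(e <- s) q * q `^ e)).
  rewrite big_seq [leRHS]big_seq ler_sum// => e /hs[Se e0].
  rewrite powRM ?(ltW q0) ?(ltW t0)// mulrC ler_wpM2r ?powR_ge0// -tdl.
  by apply: ger_powR; rewrite ?t0 ?t1// hdl.
rewrite -mulr_sumr; apply: (@le_trans _ _ (q * (c * ((c * q) ^+ 0 / (1 - c * q))))).
  rewrite ler_wpM2l ?(ltW q0)//; apply: (tail_bound S_ge0 S2) => //; rewrite ?(ltW c0)//.
    by move=> e /hs[Se /ltW].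
  by rewrite cq invf_lt1// ltr1n.
have -> : q * (c * ((c * q) ^+ 0 / (1 - c * q))) = c * q / (1 - c * q) by rewrite expr0; ring.
by rewrite cq le_eqVlt; apply/orP; left; apply/eqP; field.
Qed.

(** The condition that [g - e] lies in [S] forces [e <= g], so a cut-off just above [g] misses no
    pair of exponents with sum [g]. *)
Definition conv (d b : R -> R[i]) (g : R) : R[i] :=
  \sum_(e <- below S (Num.truncn g).+1 | `[< S (g - e) >]) d e * b (g - e).

Lemma conv_below (d b : R -> R[i]) g N : S g -> g < N%:R ->
  conv d b g = \sum_(e <- below S N | `[< S (g - e) >]) d e * b (g - e).
Proof.
move=> Sg gN; rewrite /conv -big_filter -[RHS]big_filter; apply: perm_big.
apply: uniq_perm; rewrite ?filter_uniq ?(uniq_below S2)// => e.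
rewrite !mem_filter !(mem_below S_ge0 S2).
case: asboolP => //= /S_ge0; rewrite /= subr_ge0 => eg; congr (_ && _).
rewrite (le_lt_trans eg gN) (le_lt_trans eg)//.
by have /andP[] := truncn_itv (S_ge0 Sg).
Qed.

Variables (d : R -> R[i]) (A : R).
Hypotheses (d0 : d 0 = 1) (A0 : 0 < A) (dA : forall g, S g -> normc (d g) <= A `^ g).

(** The coefficients of the inverse satisfy b(g) = - sum over e > 0 of d(e) b(g - e). This recursion
    runs over real exponents, hence the fuel [n]; every step lowers the exponent by at least the gap
    of [S], so finitely many steps reach 0. *)
Fixpoint inv_approx (n : nat) (g : R) : R[i] :=
  if n isn't n'.+1 then (g == 0)%:R else
  if g == 0 then 1 else
  - \sum_(e <- below S (Num.truncn g).+1 | `[< S (g - e) >] && (0 < e))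
      d e * inv_approx n' (g - e).

(** Inductively the recursion gives at most B^g times the sum of (A/B)^e over positive e, and
    [positive_part_small] makes that sum at most 1. The same B serves every amount of fuel. *)
Lemma inv_approx_bound : exists2 B, 0 < B &
  forall n g, S g -> normc (inv_approx n g) <= B `^ g.
Proof.
have [B B0 hB] := positive_part_small A0; exists B => //.
elim=> [|n IH] g Sg /=.
  case: eqP => [->|_]; first by rewrite normc1 powRr0.
  by rewrite normc0 powR_ge0.
case: eqP => [->|/eqP g0]; first by rewrite normc1 powRr0.
rewrite normcN; apply: le_trans (normc_sum _ _ _) _.
rewrite -big_filter; set s := seq.filter _ _.
have hs e : e \in s -> [/\ S e, S (g - e) & 0 < e].
  by rewrite mem_filter (mem_below S_ge0 S2) => /and3P[/andP[/asboolP ? ?] /asboolP].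
apply: (@le_trans _ _ (\sum_(e <- s) B `^ g * (A / B) `^ e)).
  rewrite big_seq [leRHS]big_seq ler_sum// => e /hs[Se Sge e0].
  rewrite normcM powRM ?(ltW A0) ?invr_ge0 ?(ltW B0)//.
  rewrite mulrCA ler_pM ?normc_ge0 ?dA//.
  apply: le_trans (IH _ Sge) _; rewrite powRB ?(gt_eqF B0) ?implybT//.
  suff -> : B^-1 `^ e = (B `^ e)^-1 by [].
  by rewrite -(powR_inv1 (ltW B0)) -powRrM mulN1r powRN.
rewrite -mulr_sumr ler_piMr ?powR_ge0// hB//.
  by rewrite filter_uniq// (uniq_below S2).
by move=> e /hs[].
Qed.

Lemma conv_inverse : exists (b : R -> R[i]) (B : R),
  [/\ b 0 = 1, 0 < B, (forall g, S g -> normc (b g) <= B `^ g) &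
    forall g, S g -> 0 < g -> conv d b g = 0].
Proof.
have [dl dl0 hdl] := semigroup_gap; have [B B0 hB] := inv_approx_bound.
(* Once the fuel exceeds [g / dl], more fuel does not change the value. *)
have stable n m g : S g -> g < n%:R * dl -> (n <= m)%N -> inv_approx m g = inv_approx n g.
  elim: n m g => [|n IH] m g Sg; first by rewrite mul0r => /(le_lt_trans (S_ge0 Sg)); rewrite ltxx.
  move=> gn; case: m => // m nm /=; case: eqP => // _; congr (- _).
  rewrite big_seq_cond [RHS]big_seq_cond; apply: eq_bigr => e.
  rewrite (mem_below S_ge0 S2) => /and3P[/andP[/asboolP Se _] /asboolP Sge e0].
  rewrite (IH m)//; rewrite ltrBlDr (lt_le_trans gn)// -natr1 mulrDl mul1r lerD2l.
  exact: hdl.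
pose ix g := (Num.truncn (g / dl)).+1.
have ixP g : S g -> g < (ix g)%:R * dl.
  move=> Sg; rewrite -ltr_pdivrMr//.
  have gd : 0 <= g / dl by rewrite divr_ge0 ?(S_ge0 Sg) ?(ltW dl0).
  by have /andP[] := truncn_itv gd.
pose b g := inv_approx (ix g) g.
have bE n g : S g -> g < n%:R * dl -> inv_approx n g = b g.
  move=> Sg gn; rewrite /b -(stable _ (maxn n (ix g)) _ _ gn) ?leq_maxl//.
  by rewrite (stable _ (maxn n (ix g)) _ _ (ixP _ Sg)) ?leq_maxr.
exists b, B; split => //; first by rewrite /b /ix /= eqxx.
  by move=> g Sg; exact: hB.
move=> g Sg g0.
have h0 : 0 \in below S (Num.truncn g).+1 by rewrite (mem_below S_ge0 S2) asboolT// ltr0Sn.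
rewrite /conv -big_filter (bigD1_seq 0)/= ?filter_uniq ?(uniq_below S2)//; last first.
  by rewrite mem_filter subr0 asboolT.
rewrite big_filter_cond/= subr0.
(* The term [e = 0] is [b g]. It is unfolded with one unit of fuel beyond [ix g], so that its
   recursive calls use fuel [ix g], which is enough for all the remaining terms. *)
rewrite d0 mul1r -(bE (ix g).+1)//; last first.
  by rewrite (lt_trans (ixP _ Sg))// ltr_pM2r// ltr_nat.
rewrite [inv_approx _ _]/= -/(ix g) gt_eqF// addrC; apply/eqP; rewrite subr_eq0; apply/eqP.
rewrite big_seq_cond [RHS]big_seq_cond; apply: eq_big => e.
  case: (boolP (e \in _)) => //=; rewrite (mem_below S_ge0 S2) => /andP[/asboolP Se _].
  by congr (_ && _); rewrite lt_def (S_ge0 Se) andbT.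
rewrite (mem_below S_ge0 S2) => /and3P[/andP[/asboolP Se _] /asboolP Sge _].
congr (_ * _).
by rewrite -(bE (ix g))// (le_lt_trans _ (ixP _ Sg))// gerBl S_ge0.
Qed.

End convolution.

(** * Products of absolutely convergent series *)

Section product.
Variables (R : realType) (S : set R) (c : R).
Hypothesis S_ge0 : S `<=` [set x | 0 <= x].
Hypothesis S_add : forall x y, S x -> S y -> S (x + y).
Hypothesis S_0 : S 0.
Hypothesis S2 : condition_S2 S c.
Hypothesis c0 : 0 < c.

(** The substitution [f = g - e] turns the convolutions below [N] into the triangle [e + f < N] of
    the product; additivity of [S] ensures that every pair of the triangle occurs. *)
Lemma conv_psum (u v : R -> R[i]) N :
  \sum_(g <- below S N) conv S u v g =
  \sum_(e <- below S N) \sum_(f <- below S N | e + f < N%:R) u e * v f.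
Proof.
transitivity (\sum_(g <- below S N) \sum_(e <- below S N | `[< S (g - e) >]) u e * v (g - e)).
  apply: eq_big_seq => g; rewrite (mem_below S_ge0 S2) => /andP[/asboolP Sg gN].
  by rewrite (@conv_below _ _ _ S_ge0 S2 _ _ _ N).
under eq_bigr do rewrite big_mkcond/=.
rewrite exchange_big/=; apply: eq_big_seq => e.
rewrite (mem_below S_ge0 S2) => /andP[/asboolP Se eN].
rewrite -big_mkcond/= -big_filter -[RHS]big_filter.
rewrite -(big_map (fun g => g - e) predT (fun f => u e * v f))/=.
apply: perm_big; apply: uniq_perm; rewrite ?filter_uniq ?(uniq_below S2)//.
  rewrite map_inj_uniq ?filter_uniq ?(uniq_below S2)//.
  by move=> x y /(congr1 (fun z => z + e)); rewrite !subrK.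
move=> f; rewrite mem_filter (mem_below S_ge0 S2); apply/mapP/idP => [[g]|].
  rewrite mem_filter (mem_below S_ge0 S2) => /and3P[/asboolP Sge /asboolP Sg gN] ->.
  by rewrite addrC subrK gN asboolT//= (le_lt_trans _ gN)// gerBl S_ge0.
move=> /and3P[efN /asboolP Sf fN]; exists (e + f); last by rewrite addrAC subrr add0r.
rewrite mem_filter (mem_below S_ge0 S2) efN !asboolT//; first exact: S_add.
by rewrite addrAC subrr add0r.
Qed.

Variables (u v : R -> R[i]) (q : R).
Hypotheses (q0 : 0 < q) (q1 : q <= 1) (cq : c * q < 1).
Hypotheses (uq : forall b, S b -> normc (u b) <= q `^ b)
  (vq : forall b, S b -> normc (v b) <= q `^ b).
Hypotheses (uv0 : u 0 * v 0 = 1) (uv : forall g, S g -> 0 < g -> conv S u v g = 0).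

Let sum_bound (s : seq R) m : uniq s -> (forall b, b \in s -> S b /\ m%:R <= b) ->
  \sum_(b <- s) q `^ b <= c * ((c * q) ^+ m / (1 - c * q)).
Proof. by move=> us hs; apply: (tail_bound S_ge0 S2) => //; exact: ltW. Qed.

(* A pair of exponents with sum at least N has a component at least N/2, and the
   pairs with smaller sum are grouped into the convolution. *)
Lemma psum_mul_error N : (0 < N)%N ->
  normc (psum S u N * psum S v N - 1) <=
    2 * (c * ((c * q) ^+ N./2 / (1 - c * q))) * (c * (1 - c * q)^-1).
Proof.
move=> N0; set T := below S N; set Q := c * (1 - c * q)^-1; set D := c * (_ / _).
have TS b : b \in T -> S b by rewrite (mem_below S_ge0 S2) => /andP[/asboolP].
have -> : psum S u N * psum S v N - 1 =
    \sum_(e <- T) \sum_(f <- T | ~~ (e + f < N%:R)) u e * v f.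
  (* Only the exponent 0 contributes, with [u 0 * v 0 = 1]; all other convolutions vanish by
     hypothesis. *)
  have -> : 1 = \sum_(g <- T) conv S u v g.
    have h0 : 0 \in T by rewrite (mem_below S_ge0 S2) asboolT// ltr0n.
    rewrite (bigD1_seq 0)//= ?(uniq_below S2)// big_seq_cond big1 ?addr0; last first.
      move=> g /andP[/TS Sg g0]; apply: uv => //.
      by rewrite lt_def g0 S_ge0.
    rewrite (@conv_below _ _ _ S_ge0 S2 _ _ _ 1) ?ltr01// -big_filter.
    rewrite (bigD1_seq 0)/= ?filter_uniq ?(uniq_below S2)//; last first.
      by rewrite mem_filter (mem_below S_ge0 S2) subr0 !asboolT// ltr01.
    rewrite subr0 uv0 big_filter_cond/= big_seq_cond big1 ?addr0// => e.
    rewrite (mem_below S_ge0 S2) sub0r => /and3P[/andP[/asboolP/S_ge0 /= e0 _] /asboolP/S_ge0 /= ].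
    by rewrite oppr_ge0 => e0' /eqP[]; apply/eqP; rewrite eq_le e0 e0'.
  rewrite conv_psum /psum mulr_suml -sumrB; apply: eq_bigr => e _.
  rewrite mulr_sumr (bigID (fun f => e + f < N%:R))/= addrAC subrr add0r.
  by [].
have Tq : \sum_(b <- T) q `^ b <= Q.
  have := @sum_bound T 0; rewrite expr0 mul1r; apply; first exact: uniq_below S2 _.
  by move=> b /TS Sb; split=> //; exact: S_ge0.
have Tq' : \sum_(b <- T | (N./2)%:R <= b) q `^ b <= D.
  rewrite -big_filter; apply: sum_bound; first by rewrite filter_uniq// (uniq_below S2).
  by move=> b; rewrite mem_filter => /andP[? /TS].
have Q0 : 0 <= Q by apply: mulr_ge0; rewrite ?invr_ge0 ?subr_ge0 ltW.
have D0 : 0 <= D.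
  rewrite mulr_ge0 ?(ltW c0)// divr_ge0 ?subr_ge0 ?(ltW cq)// exprn_ge0 ?mulr_ge0 ?(ltW c0) ?(ltW q0)//.
apply: (@le_trans _ _ (\sum_(e <- T) \sum_(f <- T)
   ((if (N./2)%:R <= e then q `^ e else 0) * q `^ f +
    q `^ e * (if (N./2)%:R <= f then q `^ f else 0)))).
  apply: le_trans (normc_sum _ _ _) _.
  rewrite big_seq [leRHS]big_seq ler_sum// => e /TS Se.
  apply: le_trans (normc_sum _ _ _) _.
  rewrite big_mkcond/= big_seq [leRHS]big_seq ler_sum// => f /TS Sf.
  case: ifPn => [|_]; last by rewrite addr_ge0// mulr_ge0 ?powR_ge0//; case: ifP => // _; exact: powR_ge0.
  rewrite -leNgt => ef; rewrite normcM.
  have uvb : normc (u e) * normc (v f) <= q `^ e * q `^ f.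
    by rewrite ler_pM ?normc_ge0 ?uq ?vq.
  case: ifPn => [_|he].
    by rewrite (le_trans uvb)// lerDl mulr_ge0 ?powR_ge0//; case: ifP => // _; exact: powR_ge0.
  case: ifPn => [_|hf]; first by rewrite mul0r add0r.
  move: he hf; rewrite -!ltNge => he hf.
  have := le_lt_trans ef (ltrD he hf); rewrite -natrD addnn ltr_nat ltnNge => /negP[].
  by rewrite -[leqRHS]odd_double_half leq_addl.
rewrite (_ : \sum_(e <- T) _ = (\sum_(e <- T | (N./2)%:R <= e) q `^ e) * (\sum_(f <- T) q `^ f)
   + (\sum_(f <- T) q `^ f) * (\sum_(e <- T | (N./2)%:R <= e) q `^ e)); last first.
  rewrite !(big_mkcond (fun e => (N./2)%:R <= e))/= !mulr_suml -big_split/=.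
  by apply: eq_bigr => e _; rewrite !mulr_sumr -big_split.
have -> : 2 * D * Q = D * Q + Q * D by ring.
by apply: lerD; apply: ler_pM => //; apply: sumr_ge0 => *; exact: powR_ge0.
Qed.

Lemma psum_mul_ccvg : ccvg (fun N => psum S u N * psum S v N) 1.
Proof.
apply: (@ccvg_squeeze_near _ _ _ (fun N => 2 * (c * (1 - c * q)^-1) * (c * (1 - c * q)^-1) *
    (c * q) ^+ N./2)).
  near=> N; apply: le_trans (psum_mul_error _) _; first by near: N; exists 1%N.
  by rewrite le_eqVlt; apply/orP; left; apply/eqP; ring.
apply: cvgn0Z.
have h : (fun n => (c * q) ^+ n) @ \oo --> (0 : R).
  by apply: cvg_expr; rewrite ger0_norm// mulr_ge0 ?(ltW c0) ?(ltW q0).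
apply/cvgrPdist_lt => e e0; have /cvgrPdist_lt /(_ e e0)[M _ hM] := h.
exists (M.*2) => // n /= Mn; apply: (hM n./2) => /=.
by rewrite -(doubleK M) half_leq.
Unshelve. all: end_near. Qed.

End product.

(** * The reciprocal of a series with constant term 1 *)

Section reciprocal.
Variables (R : realType) (S : set R) (c : R).
Hypothesis S_ge0 : S `<=` [set x | 0 <= x].
Hypothesis S_add : forall x y, S x -> S y -> S (x + y).
Hypothesis S_0 : S 0.
Hypothesis S2 : condition_S2 S c.
Hypothesis c0 : 0 < c.

(** The region |z| > c A is where the ratio q = A / |z| satisfies [c * q < 1]. The bound [q <= 1],
    required on each slice, then comes from [c >= 1]. *)
Lemma ratio_small (A n : R) : 0 < A -> c * A < n ->
  [/\ 0 < A / n, A / n <= 1 & c * (A / n) < 1].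
Proof.
move=> A0 An; have n0 : 0 < n by rewrite (lt_trans _ An)// mulr_gt0.
have c1 := condition_S2_ge1 S2 S_0 (ltW c0).
split; first by rewrite divr_gt0.
  by rewrite ler_pdivrMr// mul1r (le_trans _ (ltW An))// ler_peMl// ltW.
by rewrite mulrA ltr_pdivrMr// mul1r.
Qed.

Lemma normc_term (d : R -> R[i]) (K A : R) (z : R[i]) g : z != 0 -> 0 < A ->
  normc (d g) <= K * A `^ g -> normc (d g / cpow z g) <= K * (A / normc z) `^ g.
Proof.
move=> z0 A0 h; have n0 : 0 < normc z by rewrite normc_gt0.
rewrite normcM normcV normc_cpow// powRM ?invr_ge0 ?(ltW A0) ?(ltW n0)// mulrA.
have -> : (normc z)^-1 `^ g = (normc z `^ g)^-1.
  by rewrite -(powR_inv1 (ltW n0)) -powRrM mulN1r powRN.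
by rewrite ler_wpM2r// invr_ge0 powR_ge0.
Qed.

Lemma psumZ (k : R[i]) (f : R -> R[i]) N :
  psum S (fun b => k * f b) N = k * psum S f N.
Proof. by rewrite /psum mulr_sumr. Qed.

Lemma has_sumZ (k : R[i]) (f : R -> R[i]) (K q : R) l :
  0 < q -> q <= 1 -> c * q < 1 -> 0 <= K ->
  (forall b, S b -> normc (f b) <= K * q `^ b) ->
  has_sum S f l -> has_sum S (fun b => k * f b) (k * l).
Proof.
move=> q0 q1 cq K0 fb /(has_sum_psum S_ge0 S2) hl.
apply: (psum_has_sum S_ge0 S2 (ltW c0) (M := normc k * K) (q := q)) => //.
- by move=> b Sb; rewrite normcM -mulrA ler_wpM2l ?normc_ge0 ?fb.
- by rewrite mulr_ge0 ?normc_ge0.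
have -> : psum S (fun b => k * f b) = (fun N => k * psum S f N).
  by apply/funext => N; exact: psumZ.
exact: ccvgZ.
Qed.

(** Serves both directions between (2) and (3). The limits of the two series at z have product 1
    because the partial products converge to the constant term of the convolution. *)
Lemma reciprocal_series (d : R -> R[i]) (A : R) : d 0 = 1 -> 0 < A ->
  (forall g, S g -> normc (d g) <= A `^ g) ->
  exists (b : R -> R[i]) (B : R),
  [/\ b 0 = 1, A <= B, (forall g, S g -> normc (b g) <= B `^ g) &
   forall z l, c * B < normc z -> has_sum S (fun g => d g / cpow z g) l ->
     has_sum S (fun g => b g / cpow z g) l^-1].
Proof.
move=> d0 A0 dA.
have [b [B0 [b0 B0pos bB uv]]] := conv_inverse S_ge0 S_0 S2 c0 d0 A0 dA.
(* One base for both series, so that both converge absolutely for |z| > c B. *)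
exists b, (Num.max A B0).
set B := Num.max A B0.
have Bpos : 0 < B by rewrite lt_max A0.
have AB : A <= B by rewrite le_max lexx.
have BB : B0 <= B by rewrite le_max lexx orbT.
have le_pow x g : S g -> 0 < x -> x <= B -> x `^ g <= B `^ g.
  by move=> /S_ge0 g0 x0 xB; rewrite ge0_ler_powR// nnegrE ltW.
have bB' g : S g -> normc (b g) <= B `^ g.
  by move=> Sg; rewrite (le_trans (bB _ Sg))// le_pow.
split; [exact: b0|exact: AB|exact: bB'|move=> z l cBz hl].
have z0 : z != 0.
  by rewrite -normc_gt0 (lt_trans _ cBz)// mulr_gt0.
have [q0 q1 cq] := ratio_small Bpos cBz.
have dq g : S g -> normc (d g / cpow z g) <= 1 * (B / normc z) `^ g.
  by move=> Sg; apply: normc_term => //; rewrite mul1r (le_trans (dA _ Sg))// le_pow.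
have bq g : S g -> normc (b g / cpow z g) <= 1 * (B / normc z) `^ g.
  by move=> Sg; apply: normc_term => //; rewrite mul1r bB'.
have [m hm] := psum_ccvg S_ge0 S2 (ltW c0) q0 q1 cq bq ler01.
have hl' := has_sum_psum S_ge0 S2 hl.
suff lm : l * m = 1.
  have l0 : l != 0 by apply: contra_eq_neq lm => ->; rewrite mul0r eq_sym oner_neq0.
  have <- : m = l^-1 by apply: (mulfI l0); rewrite lm mulfV.
  exact: (psum_has_sum S_ge0 S2 (ltW c0) q0 q1 cq bq ler01 hm).
apply: ccvg_unique (ccvgM hl' hm) _.
apply: (psum_mul_ccvg S_ge0 S_add S_0 S2 c0 q0 q1 cq) => //.
- by move=> g Sg; rewrite -[leRHS]mul1r dq.
- by move=> g Sg; rewrite -[leRHS]mul1r bq.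
- by rewrite d0 b0 cpow0 invr1 !mulr1.
move=> g Sg g0.
(* Powers are multiplicative in the exponent, so z^(-g) factors out of all terms of the convolution
   at [g]. *)
have -> : conv S (fun g => d g / cpow z g) (fun g => b g / cpow z g) g =
   conv S d b g / cpow z g; last by rewrite uv// mul0r.
rewrite /conv mulr_suml; apply: eq_bigr => e _.
have -> : cpow z g = cpow z e * cpow z (g - e) by rewrite -cpowD addrC subrK.
by rewrite mulrACA -invfM.
Qed.

End reciprocal.

(** * Dominated convergence for sums over the exponents *)

Section tannery.
Variables (R : realType) (S : set R) (c : R).
Hypothesis S_ge0 : S `<=` [set x | 0 <= x].
Hypothesis S2 : condition_S2 S c.
Hypothesis c0 : 0 <= c.
Variables (M q : R).
Hypothesis (q0 : 0 < q) (q1 : q <= 1) (cq : c * q < 1) (M0 : 0 <= M).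

Lemma ccvg_sum (s : seq R) (u : nat -> R -> R[i]) (v : R -> R[i]) :
  (forall b, b \in s -> ccvg (fun k => u k b) (v b)) ->
  ccvg (fun k => \sum_(b <- s) u k b) (\sum_(b <- s) v b).
Proof.
elim: s => [|b s IH] h.
  by rewrite big_nil; under eq_fun do rewrite big_nil; exact: ccvg_cst.
rewrite big_cons; under eq_fun do rewrite big_cons; apply: ccvgD.
  by apply: h; rewrite mem_head.
by apply: IH => x xs; apply: h; rewrite inE xs orbT.
Qed.

(** The tails beyond a cut-off are small uniformly in the parameter, and the finite sum below the
    cut-off converges term by term. *)
Lemma tannery (u : nat -> R -> R[i]) (v : R -> R[i]) (l : nat -> R[i]) (m : R[i]) :
  (forall k b, S b -> normc (u k b) <= M * q `^ b) ->
  (forall b, S b -> ccvg (fun k => u k b) (v b)) ->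
  (forall k, ccvg (psum S (u k)) (l k)) -> ccvg (psum S v) m -> ccvg l m.
Proof.
move=> ub uv ul vm.
have vb b : S b -> normc (v b) <= M * q `^ b.
  by move=> Sb; apply: ccvg_le (uv _ Sb) => k; exact: ub.
have t0 : (fun N => (M * (c / (1 - c * q))) * (c * q) ^+ N) @ \oo --> (0 : R).
  by apply: cvgn0Z; apply: cvg_expr; rewrite ger0_norm// mulr_ge0// ltW.
apply/cvgrPdist_lt => e e0; have e3 : 0 < e / 3 by rewrite divr_gt0.
have /cvgrPdist_lt /(_ _ e3)[N _ hN] := t0.
have {hN} tN : M * (c * ((c * q) ^+ N / (1 - c * q))) < e / 3.
  have := hN N (leqnn _); rewrite /= sub0r normrN => /(le_lt_trans (ler_norm _)).
  by apply: le_lt_trans; rewrite le_eqVlt; apply/orP; left; apply/eqP; ring.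
have huv : ccvg (fun k => psum S (u k) N) (psum S v N).
  apply: ccvg_sum => b; rewrite (mem_below S_ge0 S2) => /andP[/asboolP Sb _]; exact: uv.
have /cvgrPdist_lt /(_ _ e3) h := huv.
near=> k; rewrite sub0r normrN ger0_norm ?normc_ge0//.
have -> : l k - m = (l k - psum S (u k) N) + ((psum S (u k) N - psum S v N) + - (m - psum S v N)) by ring.
have -> : e = e / 3 + (e / 3 + e / 3) by field.
apply: le_lt_trans (normcD _ _) _; apply: ltrD.
  exact: le_lt_trans (psum_lim_tail S_ge0 S2 c0 q0 q1 cq (ub k) M0 _ (ul k)) tN.
apply: le_lt_trans (normcD _ _) _; apply: ltrD.
  suff : `|0 - normc (psum S (u k) N - psum S v N)| < e / 3.
    by rewrite sub0r normrN; apply: le_lt_trans; exact: ler_norm.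
  by near: k; exact: h.
rewrite normcN; exact: le_lt_trans (psum_lim_tail S_ge0 S2 c0 q0 q1 cq vb M0 _ vm) tN.
Unshelve. all: end_near. Qed.

End tannery.

(** * Boundary values of powers from the lower half-plane *)

Section boundary_values.
Variable R : realType.
Implicit Types (x s e : R).

Lemma ccvg_cexp (u : nat -> R[i]) l : ccvg u l -> ccvg (fun n => cexp (u n)) (cexp l).
Proof.
move=> ul; have hr := ccvg_Re ul; have hi := ccvg_Im ul.
have he : (fun n => expR (complex.Re (u n))) @ \oo --> expR (complex.Re l).
  by apply: continuous_cvg hr; exact: continuous_expR.
have hc : (fun n => cos (complex.Im (u n))) @ \oo --> cos (complex.Im l).
  by apply: continuous_cvg hi; exact: continuous_cos.
have hs : (fun n => sin (complex.Im (u n))) @ \oo --> sin (complex.Im l).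
  by apply: continuous_cvg hi; exact: continuous_sin.
apply: ccvg_ReIm.
  by rewrite Re_cexp; under eq_fun do rewrite Re_cexp; exact: cvgM.
by rewrite Im_cexp; under eq_fun do rewrite Im_cexp; exact: cvgM.
Qed.

(** Adding [pi / 2] moves the argument into the range of [atan], where its tangent is - cos / sin =
    x / e. The limit on the real axis is then that of an arctangent. *)
Lemma Im_clog_atan x e : 0 < e ->
  complex.Im (clog (x +i* (- e))) = atan (x / e) - pi / 2.
Proof.
move=> e0; set z := x +i* (- e).
have z0 : complex.Im z < 0 by rewrite /= oppr_lt0.
have /andP[t1 t2] := Im_clog_lt0 z0; set t := complex.Im (clog z) in t1 t2 *.
have zE := clogK (Im_lt0_neq0 z0).
have xE : x = expR (complex.Re (clog z)) * cos t by rewrite -[LHS]/(complex.Re z) -{1}zE Re_cexp.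
have eE : - e = expR (complex.Re (clog z)) * sin t by rewrite -[LHS]/(complex.Im z) -{1}zE Im_cexp.
apply/eqP; rewrite -subr_eq opprK; apply/eqP; rewrite -(@tanK _ (t + pi / 2)); last first.
  by rewrite in_itv/=; apply/andP; split; have := pi_gt0 R; lra.
congr atan; rewrite /tan sinDpihalf cosDpihalf xE -[e]opprK eE.
have s0 : sin t != 0.
  by apply: contra_eq_neq eE => ->; rewrite mulr0 oppr_eq0 gt_eqF.
by field; rewrite s0 gt_eqF ?expR_gt0.
Qed.

Definition below_axis x (k : nat) : R[i] := x +i* (- k.+1%:R^-1).

Lemma Im_below_axis x k : complex.Im (below_axis x k) < 0.
Proof. by rewrite /= oppr_lt0 invr_gt0 ltr0Sn. Qed.

Lemma normc_below_axis x k : `|x| <= normc (below_axis x k).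
Proof. exact: (normc_geRe (below_axis x k)). Qed.

Lemma ccvg_below_axis x : ccvg (below_axis x) x%:C.
Proof.
apply: ccvg_ReIm => /=; first exact: cvg_cst.
rewrite -oppr0; apply: cvgN; exact: cvg_harmonic.
Qed.

Lemma atan_pinfty x : 0 < x -> (fun k => atan (x / k.+1%:R^-1)) @ \oo --> pi / 2.
Proof.
move=> x0; apply: (@cvg_comp _ _ _ (fun k : nat => x / k.+1%:R^-1) (@atan R) \oo +oo%R); last exact: cvgy_atan.
apply/cvgryPge => A; near=> k; rewrite invrK.
rewrite -ler_pdivrMl// (le_trans (ler_norm _))//.
near: k; exists (Num.truncn `|x^-1 * A|).+1 => // n /= hn.
have /andP[_ /ltW h] := truncn_itv (normr_ge0 (x^-1 * A)).
by rewrite (le_trans h)// ler_nat ltnW// ltnS.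
Unshelve. all: end_near. Qed.

Lemma ccvg_clog x : x != 0 ->
  ccvg (fun k => clog (below_axis x k)) (ln `|x| +i* (if 0 < x then 0 else - pi)).
Proof.
move=> x0; apply: ccvg_ReIm => /=.
  have h := ccvg_normc (ccvg_below_axis x); rewrite normc_real in h.
  by apply: continuous_cvg h; apply: continuous_ln; rewrite normr_gt0.
have -> : (fun k => carg (below_axis x k)) = (fun k => atan (x / k.+1%:R^-1) - pi / 2).
  apply/funext => k; apply: (@Im_clog_atan x k.+1%:R^-1).
  by rewrite invr_gt0 ltr0Sn.
case: ifPn => xp.
  rewrite -(subrr (pi / 2)); apply: cvgB; [exact: atan_pinfty|exact: cvg_cst].
have xn : 0 < - x by rewrite oppr_gt0 lt_neqAle x0 leNgt.
have -> : - pi = - (pi / 2) - pi / 2 :> R by field.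
apply: cvgB; last exact: cvg_cst.
have -> : (fun k => atan (x / k.+1%:R^-1)) = (fun k => - atan (- x / k.+1%:R^-1)).
  by apply/funext => k; rewrite mulNr atanN opprK.
by apply: cvgN; exact: atan_pinfty.
Qed.

(** From below, the argument tends to 0 at positive x and to - pi at negative x; the latter produces
    the factor e^(i s pi) of [inv_pow]. *)
Lemma inv_cpow_boundary x s : x != 0 ->
  ccvg (fun k => (cpow (below_axis x k) s)^-1) (inv_pow x s).
Proof.
move=> x0; under eq_fun do rewrite /cpow -cexpN -mulNr -rmorphN.
have := ccvg_cexp (ccvgZ (- s)%:C (ccvg_clog x0)).
congr (ccvg _ _); rewrite /inv_pow; case: ifPn => xp.
  apply: complex_ext; rewrite ?Re_cexp ?Im_cexp Re_realM Im_realM /= mulr0 ?cos0 ?sin0 ?mulr1 ?mulr0//.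
  by rewrite gtr0_norm// /powR invr_eq0 gt_eqF// lnV ?posrE// mulrN mulNr.
apply: complex_ext; rewrite ?ReM ?ImM ?Re_cexp ?Im_cexp ?Re_realM ?Im_realM /powR normr_eq0 (negPf x0) /=;
  by rewrite mulrNN expR0 !(mul0r, mul1r, mulr0, subr0, addr0, add0r) mulrC.
Qed.

Lemma normc_inv_pow x s : x != 0 -> normc (inv_pow x s) = `|x| `^ (- s).
Proof.
move=> x0; rewrite /inv_pow; case: ifPn => xp.
  rewrite normc_real ger0_norm ?powR_ge0// gtr0_norm// powRN -(powR_inv1 (ltW xp)).
  by rewrite -powRrM mulN1r powRN.
by rewrite normcM normc_cexp expR0 mul1r normc_real ger0_norm ?powR_ge0.
Qed.

End boundary_values.

Lemma dominated_convergence_real (d : measure_display) (T : measurableType d)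
    (R : realType) (m : {measure set T -> \bar R}) (D : set T)
    (f_ : nat -> T -> R) (f g : T -> R) : measurable D ->
  (forall n, measurable_fun D (f_ n)) ->
  (forall x, D x -> f_ ^~ x @ \oo --> f x) ->
  m.-integrable D (EFin \o g) -> (forall n x, D x -> `|f_ n x| <= g x) ->
  [/\ measurable_fun D f, m.-integrable D (EFin \o f),
    (fun n => (\int[m]_(x in D) (f_ n x)%:E)%E) @ \oo --> (\int[m]_(x in D) (f x)%:E)%E &
    (fun n => \int[m]_(x in D) f_ n x) @ \oo --> \int[m]_(x in D) f x].
Proof.
move=> mD mf ff ig fg.
have mff : measurable_fun D f by exact: measurable_fun_cvg ff.
have mfE n : measurable_fun D (EFin \o f_ n) by exact/measurable_EFinP.
have mffE : measurable_fun D (EFin \o f) by exact/measurable_EFinP.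
have ffE : {ae m, forall x, D x -> (EFin \o f_ n) x @[n --> \oo] --> (EFin \o f) x}.
  by apply: aeW => x Dx; apply: cvg_EFin; [near=> n|exact: ff].
have fgE : {ae m, forall x n, D x -> (`|(EFin \o f_ n) x| <= (EFin \o g) x)%E}.
  by apply: aeW => x n Dx; rewrite /= lee_fin; exact: fg.
have [i _ cf] := dominated_convergence mD mfE mffE ffE ig fgE.
split => //.
have : (\int[m]_(x in D) (f x)%:E)%E \is a fin_num by exact: integrable_fin_num.
by move=> /fineK fE; rewrite /Rintegral; apply: fine_cvg; rewrite fE.
Unshelve. all: end_near. Qed.

(** * Stieltjes inversion by the Poisson kernel *)

Section stieltjes_inversion.
Variables (R : realType) (mu : probability (measurableTypeR R) R).
Local Notation leb := (@lebesgue_measure R).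
Implicit Types (e t a b u x : R).

(** The Poisson kernel of the half-plane without its factor 1 / pi, that is, the imaginary part of 1
    / (t - i e). *)
Definition poisson (e t : R) : R := e / (t ^+ 2 + e ^+ 2).

Lemma poisson_ge0 e t : 0 < e -> 0 <= poisson e t.
Proof. by move=> e0; rewrite divr_ge0 ?addr_ge0 ?sqr_ge0 ?ltW. Qed.

Lemma poisson_den_gt0 e t : 0 < e -> 0 < t ^+ 2 + e ^+ 2.
Proof. by move=> e0; rewrite ltr_wpDl ?sqr_ge0 ?exprn_gt0. Qed.

Lemma poisson_le e t : 0 < e -> poisson e t <= e^-1.
Proof.
move=> e0; rewrite ler_pdivrMr ?poisson_den_gt0// -subr_ge0.
have -> : e^-1 * (t ^+ 2 + e ^+ 2) - e = e^-1 * t ^+ 2 by field; rewrite gt_eqF.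
by rewrite mulr_ge0 ?sqr_ge0 ?invr_ge0 ?ltW.
Qed.

Lemma continuous_poisson e : 0 < e -> continuous (poisson e).
Proof.
move=> e0 t; apply: cvgM; first exact: cvg_cst.
apply: cvgV; first by rewrite gt_eqF// poisson_den_gt0.
by apply: cvgD; [exact: exprn_continuous|exact: cvg_cst].
Qed.

Lemma measurable_poisson e : 0 < e -> measurable_fun setT (poisson e).
Proof. by move=> e0; apply: continuous_measurable_fun; exact: continuous_poisson. Qed.

Lemma Im_inv_poisson (x e u : R) :
  complex.Im ((x +i* (- e) - u%:C)^-1) = poisson e (x - u).
Proof. by rewrite /poisson /= oppr0 addr0 mulNr opprK sqrrN. Qed.

Lemma measurable_poisson_sub e x : 0 < e ->
  measurable_fun [set: measurableTypeR R] (fun u : R => poisson e (x - u)).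
Proof.
move=> e0; apply: measurableT_comp; first exact: measurable_poisson.
exact: measurable_funB.
Qed.

Lemma Im_cauchy_poisson x e : 0 < e ->
  (complex.Im (cauchy_transform mu (x +i* (- e))))%:E =
  (\int[mu]_u (poisson e (x - u))%:E)%E.
Proof.
move=> e0; rewrite [complex.Im _](_ : _ = \int[mu]_u poisson e (x - u))%R; last first.
  by apply: eq_Rintegral => u _; exact: Im_inv_poisson.
rewrite /Rintegral fineK//; apply: integrable_fin_num => //.
apply: measurable_bounded_integrable => //.
- by rewrite (le_lt_trans (probability_le1 _ _))// ltry.
- exact: measurable_poisson_sub.
exists e^-1; split; first by rewrite realE invr_ge0 ltW.
move=> M eM u _ /=; rewrite ger0_norm ?poisson_ge0//.
exact: le_trans (poisson_le _ e0) (ltW eM).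
Qed.

Lemma is_derive_atan_div e u x : 0 < e ->
  is_derive x 1 (fun y => atan ((y - u) / e)) (poisson e (x - u)).
Proof.
move=> e0.
have -> : (fun y : R => atan ((y - u) / e)) = atan \o (fun y => e^-1 *: (y - u)).
  by apply/funext => y /=; rewrite mulrC.
apply: is_derive_eq.
rewrite -[_ *: (x - u)]/(e^-1 * (x - u)) -[_ *: (1 - 0)]/(e^-1 * (1 - 0)) subr0 /poisson.
have den := poisson_den_gt0 (x - u) e0.
have -> : 1 + (e^-1 * (x - u)) ^+ 2 = ((x - u) ^+ 2 + e ^+ 2) / e ^+ 2.
  by field; rewrite gt_eqF.
by field; rewrite !gt_eqF.
Qed.

Lemma integral_poisson e a b u : 0 < e -> a < b ->
  (\int[leb]_(x in `[a, b]) (poisson e (x - u))%:E =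
   (atan ((b - u) / e) - atan ((a - u) / e))%:E)%E.
Proof.
move=> e0 ab.
have dF x := is_derive_atan_div u x e0.
have cF : continuous (fun y => atan ((y - u) / e)).
  by move=> x; apply: differentiable_continuous; apply/derivable1_diffP; have [] := dF x.
rewrite (@continuous_FTC2 _ _ (fun y => atan ((y - u) / e)))//.
- apply: continuous_subspaceT => x; apply: (@continuous_comp _ _ _ (fun y => y - u) (poisson e)); last exact: continuous_poisson.
  by apply: cvgB; [exact: cvg_id|exact: cvg_cst].
- split.
  + by move=> x _; have [] := dF x.
  + exact/cvg_at_right_filter/cF.
  + exact/cvg_at_left_filter/cF.
- by move=> x _; rewrite derive1E; have [_ ->] := dF x.
Qed.

(** The kernel is nonnegative, so Tonelli exchanges the two integrals, and its integral in x is a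
    difference of arctangents. *)
Lemma integral_Im_cauchy e a b : 0 < e -> a < b ->
  (\int[leb]_(x in `[a, b]) (complex.Im (cauchy_transform mu (x +i* (- e))))%:E =
   \int[mu]_u (atan ((b - u) / e) - atan ((a - u) / e))%:E)%E.
Proof.
move=> e0 ab.
pose K (p : measurableTypeR R * measurableTypeR R) : \bar R :=
  ((\1_`[a, b] p.1 * poisson e (p.1 - p.2))%:E)%E.
have mK : measurable_fun setT K.
  apply/measurable_EFinP; apply: measurable_funM.
    by apply: measurableT_comp => //; exact: measurable_indic.
  apply: measurableT_comp; first exact: measurable_poisson.
  by apply: measurable_funB; [exact: measurable_fst|exact: measurable_snd].
have K0 p : (0 <= K p)%E.
  by rewrite lee_fin mulr_ge0 ?poisson_ge0// indicE.
have := @fubini_tonelli _ _ _ _ R leb mu K mK K0.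
rewrite (_ : (\int[leb]_x \int[mu]_y K (x, y) =
  \int[leb]_(x in `[a, b]) (complex.Im (cauchy_transform mu (x +i* (- e))))%:E)%E); last first.
  rewrite [RHS]integral_mkcond; apply: eq_integral => x _ /=.
  rewrite patchE /K /=; case: ifPn => xab.
    by rewrite Im_cauchy_poisson//; apply: eq_integral => u _; rewrite indicE xab mul1r.
  by rewrite integral0_eq// => u _; rewrite indicE (negbTE xab) mul0r.
move=> ->; apply: eq_integral => u _.
rewrite -(integral_poisson _ e0 ab) [RHS]integral_mkcond; apply: eq_integral => x _.
by rewrite /K patchE /= indicE; case: ifPn => _; rewrite ?mul1r ?mul0r.
Qed.

Lemma atan_step t : (fun k : nat => atan (t / k.+1%:R^-1)) @ \oo -->
  (pi / 2 * ((0 < t)%R%:R - (t < 0)%R%:R) : R).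
Proof.
case: (ltgtP 0 t) => t0.
- by rewrite subr0 mulr1; exact: atan_pinfty.
- rewrite sub0r mulrN1.
  have -> : (fun k => atan (t / k.+1%:R^-1)) = (fun k => - atan (- t / k.+1%:R^-1)).
    by apply/funext => k; rewrite mulNr atanN opprK.
  by apply: cvgN; apply: atan_pinfty; rewrite oppr_gt0.
rewrite subrr mulr0 -t0; under eq_fun do rewrite mul0r atan0; exact: cvg_cst.
Qed.

Lemma integrable_bounded_prob (D : set R) (f : R -> R) (M : R) :
  measurable D -> measurable_fun D f -> (forall x, D x -> `|f x| <= M) ->
  mu.-integrable D (EFin \o f).
Proof.
move=> mD mf fM; apply: measurable_bounded_integrable => //.
  by rewrite (le_lt_trans (probability_le1 _ _))// ltry.
exists M; split; first exact: num_real.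
by move=> N MN x Dx /=; rewrite (le_trans (fM _ Dx))// ltW.
Qed.

Lemma measurable_Im_cauchy k :
  measurable_fun [set: measurableTypeR R] (fun x => complex.Im (cauchy_transform mu (below_axis x k))).
Proof.
have e0 : 0 < k.+1%:R^-1 :> R by rewrite invr_gt0.
apply/measurable_EFinP.
pose K (p : measurableTypeR R * measurableTypeR R) : \bar R :=
  (poisson k.+1%:R^-1 (p.1 - p.2))%:E.
have mK : measurable_fun setT K.
  apply/measurable_EFinP; apply: measurableT_comp; first exact: measurable_poisson.
  by apply: measurable_funB; [exact: measurable_fst|exact: measurable_snd].
have := @measurable_fun_fubini_tonelli_F _ _ _ _ R mu K mK (fun p => poisson_ge0 _ e0).
congr (measurable_fun _ _); apply/funext => x /=.
by rewrite /fubini_F Im_cauchy_poisson.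
Qed.

Lemma Im_cauchy_ge0 x k : 0 <= complex.Im (cauchy_transform mu (below_axis x k)).
Proof.
have e0 : 0 < k.+1%:R^-1 :> R by rewrite invr_gt0.
rewrite -lee_fin Im_cauchy_poisson//; apply: integral_ge0 => u _.
by rewrite lee_fin poisson_ge0.
Qed.

(** As the height tends to 0, the difference of arctangents tends to pi inside the interval, to pi /
    2 at its ends and to 0 outside, staying below pi. The half weight of the ends explains the open
    and the closed interval on the left. The constant M dominates the other side. *)
Lemma stieltjes_inversion (a b M : R) (g : R -> R) : a < b ->
  (forall k x, a <= x <= b ->
    `|complex.Im (cauchy_transform mu (below_axis x k))| <= M) ->
  (forall x, a <= x <= b ->
    (fun k => complex.Im (cauchy_transform mu (below_axis x k))) @ \oo --> g x) ->
  ((pi / 2)%:E * (mu `]a, b[%classic + mu `[a, b]%classic) = \int[leb]_(x in `[a, b]) (g x)%:E)%E.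
Proof.
move=> ab hM hg.
have e0 k : 0 < k.+1%:R^-1 :> R by rewrite invr_gt0.
pose F k x := complex.Im (cauchy_transform mu (below_axis x k)).
have mF k : measurable_fun `[a, b] (F k).
  by apply: measurable_funTS; exact: measurable_Im_cauchy.
have mg : measurable_fun `[a, b] g.
  by apply: (@measurable_fun_cvg _ _ _ _ F) => // x /=; rewrite in_itv => /hg.
have intM : leb.-integrable `[a, b] (EFin \o cst M).
  by apply: continuous_compact_integrable; [exact: segment_compact|exact: continuous_subspaceT (fun=> cvg_cst _)].
have [|x|k x|_ _ cF _] := @dominated_convergence_real _ _ R leb `[a, b] F g (cst M) _ mF _ intM.
- exact: measurable_itv.
- by rewrite /= in_itv => /hg.
- by rewrite /= in_itv => /(hM k).
pose h k u : R := atan ((b - u) / k.+1%:R^-1) - atan ((a - u) / k.+1%:R^-1).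
pose l u : R := pi / 2 * (\1_`]a, b[ u + \1_`[a, b] u).
have cl u : (fun k => h k u) @ \oo --> l u.
  suff -> : l u = pi / 2 * ((0 < b - u)%R%:R - (b - u < 0)%R%:R) -
     pi / 2 * ((0 < a - u)%R%:R - (a - u < 0)%R%:R) by apply: cvgB; exact: atan_step.
  rewrite /l !indicE -mulrBr; congr (_ * _).
  rewrite !mem_setE !in_itv /= !subr_gt0 !subr_lt0.
  by have [ua|ua|ua] := ltgtP u a; have [ub|ub|ub] := ltgtP u b => /=; lra.
have mh k : measurable_fun [set: measurableTypeR R] (h k).
  have matan (p : R) : measurable_fun [set: R] (fun u : R => atan ((p - u) / k.+1%:R^-1)).
    apply: measurableT_comp.
      by apply: continuous_measurable_fun => x; exact: continuous_atan.
    by apply: measurable_funM => //; exact: measurable_funB.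
  by apply: measurable_funB; exact: matan.
have hpi k u : `|h k u| <= pi.
  have [h1 h2] := (atan_gtNpi2 ((b - u) / k.+1%:R^-1), atan_ltpi2 ((b - u) / k.+1%:R^-1)).
  have [h3 h4] := (atan_gtNpi2 ((a - u) / k.+1%:R^-1), atan_ltpi2 ((a - u) / k.+1%:R^-1)).
  by rewrite ler_norml /h; apply/andP; split; lra.
have ipi : mu.-integrable setT (EFin \o cst pi).
  by apply: (@integrable_bounded_prob _ _ pi) => // x _; rewrite ger0_norm// pi_ge0.
have [_ _ ch _] := dominated_convergence_real measurableT mh (fun u _ => cl u) ipi
  (fun k u _ => hpi k u).
have {}cF : (fun k => (\int[mu]_u (h k u)%:E)%E) @ \oo --> (\int[leb]_(x in `[a, b]) (g x)%:E)%E.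
  by apply: cvg_trans cF; apply: near_eq_cvg; near=> k; exact: (@integral_Im_cauchy _ a b (e0 k)).
rewrite -(cvg_lim _ cF)//.
rewrite (cvg_lim _ ch)// /l.
rewrite (_ : (fun u => _) = fun u => ((pi / 2)%:E * ((\1_`]a, b[ u)%:E + (\1_`[a, b] u)%:E))%E); last first.
  by apply/funext => u; rewrite EFinM EFinD.
rewrite ge0_integralZl//; first last.
- by rewrite lee_fin divr_ge0 ?pi_ge0.
- by move=> u _; rewrite adde_ge0 ?lee_fin ?indicE.
- by apply: emeasurable_funD; apply/measurable_EFinP; exact: measurable_indic.
rewrite ge0_integralD//;
  try by [move=> u _; rewrite lee_fin indicE|apply/measurable_EFinP; exact: measurable_indic].
by rewrite !integral_indic// !setIT.
Unshelve. all: end_near. Qed.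

End stieltjes_inversion.

(** * From the inversion formula to a density away from the origin *)

Section density.
Variables (R : realType) (mu : probability (measurableTypeR R) R).
Local Notation leb := (@lebesgue_measure R).
Variables (rho M : R) (f : R -> R).
Local Notation D := [set x : R | rho <= `|x|].

Lemma measurable_outside : measurable (D : set (measurableTypeR R)).
Proof.
have -> : D = (`]-oo, - rho] `|` `[rho, +oo[)%classic.
  apply/seteqP; split => x /=; rewrite !in_itv /= andbT ler_normr [rho <= - x]lerNr.
    by move=> /orP[h|h]; [right|left].
  by move=> [->|->]; rewrite ?orbT.
by apply: measurableU; exact: measurable_itv.
Qed.

Hypothesis rho0 : 0 < rho.
Hypothesis mf : measurable_fun D f.
Hypothesis f0 : forall x, D x -> 0 <= f x.
Hypothesis fM : forall x, D x -> f x <= M.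
Hypothesis half_atoms : forall a b, a < b -> (`[a, b]%classic : set R) `<=` D ->
  (2^-1%:E * (mu `]a, b[%classic + mu `[a, b]%classic) =
   \int[leb]_(x in `[a, b]) (f x)%:E)%E.

Let M0 : 0 <= M.
Proof.
have Dr : D rho by rewrite /= ger0_norm// ltW.
exact: le_trans (f0 Dr) (fM Dr).
Qed.

Let int_le a b : a < b -> (`[a, b]%classic : set R) `<=` D ->
  (\int[leb]_(x in `[a, b]) (f x)%:E <= (M * (b - a))%:E)%E.
Proof.
move=> ab abD; apply: (@le_trans _ _ (\int[leb]_(x in `[a, b]) M%:E)%E).
  apply: ge0_le_integral => //.
  - by move=> x /abD Dx; rewrite lee_fin f0.
  - apply/measurable_EFinP; apply: (measurable_funS _ abD mf); exact: measurable_outside.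
  - by move=> x /abD Dx; rewrite lee_fin fM.
by rewrite integral_cst//= lebesgue_measure_itv /= lte_fin ab -EFinB -EFinM.
Qed.

(** Half of an atom at an end of an interval is at most the integral of the bounded density over it.
    Intervals issuing from [x] away from the origin stay in the region and can be arbitrarily
    short. *)
Lemma no_atom x : D x -> mu [set x] = 0%E.
Proof.
move=> Dx.
have key e : 0 < e -> exists a b, [/\ a < b, b - a <= e, (`[a, b]%classic : set R) `<=` D & [set x] `<=` `[a, b]%classic].
  move=> e0; case: (ltP 0 x) => x0.
    exists x, (x + e); split; rewrite ?ltrDl//; first by rewrite addrAC subrr add0r.
      move=> y /=; rewrite in_itv /= => /andP[xy _]; move: Dx.
      by rewrite /= !ger0_norm ?(ltW x0)// ?(le_trans (ltW x0) xy)// => /le_trans ->.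
    by move=> y /= ->; rewrite in_itv /= lexx lerDl ltW.
  exists (x - e), x; split; rewrite ?gtrBl//; first by rewrite opprB addrCA subrr addr0.
    move=> y /=; rewrite in_itv /= => /andP[_ yx]; move: Dx.
    by rewrite /= !ler0_norm// ?(le_trans yx x0)// => /le_trans ->//; rewrite lerN2.
  by move=> y /= ->; rewrite in_itv /= lexx gerBl ltW.
apply/eqP; rewrite eq_le measure_ge0 andbT; apply/lee_addgt0Pr => e e0; rewrite add0e.
(* [M + 1] rather than [M] keeps the denominator positive when the bound is 0. *)
have e'0 : 0 < e / (2 * (M + 1)) by rewrite divr_gt0// mulr_gt0// ltr_wpDl.
have [a [b [ab bae abD xab]]] := key _ e'0.
have h := half_atoms ab abD.
have h1 : (2^-1%:E * mu [set x] <= (M * (b - a))%:E)%E.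
  apply: le_trans (int_le ab abD); rewrite -h lee_pmul2l ?lte_fin//.
  apply: (@le_trans _ _ (mu `[a, b]%classic)); first by apply: le_measure; rewrite ?inE.
  by rewrite leeDr.
have muf : mu [set x] \is a fin_num.
  by rewrite ge0_fin_numE// (le_lt_trans (probability_le1 _ _))// ltry.
move: h1; rewrite -(fineK muf) -EFinM !lee_fin => h1.
have h2 : M * (b - a) <= M * (e / (2 * (M + 1))) by rewrite ler_wpM2l.
have h3 : M * (e / (2 * (M + 1))) <= e / 2.
  have -> : e / 2 = (M + 1) * (e / (2 * (M + 1))) by field; rewrite gt_eqF// ltr_wpDl.
  by rewrite ler_wpM2r ?(ltW e'0)// lerDl.
have -> : fine (mu [set x]) = 2 * (2^-1 * fine (mu [set x])) by field.
by have := le_trans h1 (le_trans h2 h3); lra.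
Qed.

Lemma mu_segment a b : a <= b -> (`[a, b]%classic : set R) `<=` D ->
  mu `[a, b]%classic = (\int[leb]_(x in `[a, b]) (f x)%:E)%E.
Proof.
rewrite le_eqVlt => /predU1P[<-|ab] abD.
  rewrite set_itv1 in abD *; rewrite no_atom ?integral_set1//; exact: abD.
have Da : D a by apply: abD; rewrite /= in_itv /= lexx ltW.
have Db : D b by apply: abD; rewrite /= in_itv /= lexx ltW.
rewrite -half_atoms//.
have -> : mu `]a, b[%classic = mu `[a, b]%classic.
  have -> : `[a, b]%classic = ([set a] `|` [set b]) `|` `]a, b[%classic.
    apply/seteqP; split => x /=; rewrite !in_itv /=.
      rewrite !le_eqVlt => /andP[/predU1P[->|ax]]; first by left; left.
      by move=> /predU1P[->|xb]; [left; right|right; rewrite ax xb].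
    by move=> [[->|->]|/andP[ax xb]]; rewrite ?lexx ?ltW.
  rewrite measureU//; last first.
  - by rewrite -subset0 => x /= [[->|->]]; rewrite in_itv /= ltxx ?andbF.
  - exact: measurableU.
  rewrite [X in (X + _)%E](_ : _ = 0%E) ?add0e//.
  apply/eqP; rewrite eq_le measure_ge0 andbT.
  have : (mu ([set a] `|` [set b]) <= mu [set a] + mu [set b])%E by exact: measureU2.
  by rewrite !no_atom// adde0.
have muf : mu `[a, b]%classic \is a fin_num.
  by rewrite ge0_fin_numE// (le_lt_trans (probability_le1 _ _))// ltry.
by rewrite -(fineK muf) -EFinD -EFinM; congr EFin; field.
Qed.

Let f1 := f \_ D.

Let mf1 : measurable_fun setT f1.
Proof. by apply/(measurable_restrictT f) => //; exact: measurable_outside. Qed.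

Let f1_ge0 x : 0 <= f1 x.
Proof. by rewrite /f1 patchE; case: ifPn => // /set_mem /f0. Qed.

(** Extending the density by 0 gives a measure on the whole line, to be compared with the
    restriction of [mu] to the outer region. *)
Let nu (A : set (measurableTypeR R)) : \bar R := (\int[leb]_(x in A) (f1 x)%:E)%E.

Let nuE A : nu A = (\int[leb]_(x in A `&` D) (f x)%:E)%E.
Proof.
rewrite integral_mkcondr; apply: eq_integral => x _.
by rewrite /f1 !patchE; case: ifP.
Qed.

Let nu_set0 : nu set0 = 0%E.
Proof. exact: integral_set0. Qed.

Let nu_ge0 A : (0 <= nu A)%E.
Proof. by apply: integral_ge0 => x _; rewrite lee_fin. Qed.

Let nu_sigma_additive : semi_sigma_additive nu.
Proof.
apply: semi_sigma_additive_nng_induced => [|x]; last by rewrite lee_fin.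
exact/measurable_EFinP.
Qed.

HB.instance Definition _ := isMeasure.Build _ _ _ nu nu_set0 nu_ge0 nu_sigma_additive.

Let mu_segmentI a b : mu (`[a, b]%classic `&` D) = nu `[a, b]%classic.
Proof.
rewrite nuE.
(* The outer region meets a segment in one segment on each side of the origin, either of which may
   be empty. *)
have -> : `[a, b]%classic `&` D =
  `[a, Num.min b (- rho)]%classic `|` `[Num.max a rho, b]%classic.
  apply/seteqP; split => x /=; rewrite !in_itv /= ler_normr [rho <= - x]lerNr ge_max le_min.
    by move=> [/andP[-> ->] /orP[->|->]]; [right|left].
  by move=> [/and3P[-> -> ->]|/andP[/andP[-> ->] ->]]; rewrite ?orbT.
set I := `[a, _]%classic; set J := `[_, b]%classic.
have ID : I `<=` D.
  move=> x; rewrite /I /= in_itv /= le_min ler_normr [rho <= - x]lerNr => /and3P[_ _ ->].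
  by rewrite orbT.
have JD : J `<=` D.
  by move=> x; rewrite /J /= in_itv /= ge_max ler_normr => /andP[/andP[_ ->]].
have IJ : I `&` J = set0.
  rewrite -subset0 /I /J => x [] /=; rewrite !in_itv /= ge_max le_min => /and3P[_ _ h] /andP[/andP[_ h'] _].
  by move: rho0 h h'; lra.
have seg p q : (`[p, q]%classic : set R) `<=` D ->
    mu `[p, q]%classic = (\int[leb]_(x in `[p, q]) (f x)%:E)%E.
  case: (leP p q) => pq; first exact: mu_segment.
  by move=> _; rewrite set_itv_ge ?bnd_simp -?ltNge// measure0 integral_set0.
have mI : measurable I by exact: measurable_itv.
have mJ : measurable J by exact: measurable_itv.
rewrite measureU//= ge0_integral_setU//=.
- by congr (_ + _)%E; exact: seg.
- apply/measurable_EFinP; apply: measurable_funS mf; first exact: measurable_outside.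
  by move=> x [/ID|/JD].
- by move=> x [/ID|/JD] Dx; rewrite lee_fin f0.
- by apply/disj_setPS; rewrite IJ.
Qed.

(** Two measures that agree on half-open intervals coincide. Agreement is known on segments, and the
    left end can be removed because both measures give it mass 0. *)
Lemma density_of_half_atoms B : measurable B ->
  mu (B `&` D) = (\int[leb]_(x in B `&` D) (f x)%:E)%E.
Proof.
move=> mB; rewrite -nuE.
pose m1 : {measure set (measurableTypeR R) -> \bar R} := mrestr mu measurable_outside.
pose m2 : {measure set (measurableTypeR R) -> \bar R} := nu.
rewrite -[LHS]/(m1 B) -[RHS]/(m2 B).
apply: (@measure_unique _ R (measurableTypeR R) (@ocitv R) (fun n => `](- n%:R), n%:R]%classic)) => //.
- exact: ocitvI.
- by move=> n; exact: is_ocitv.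
- apply/seteqP; split => // x _; exists (Num.truncn `|x|).+1 => //=.
  have /andP[_ xn] := truncn_itv (normr_ge0 x).
  by rewrite in_itv /= ltrNl (le_lt_trans (ler_norm _)) ?normrN// ltW// (le_lt_trans (ler_norm _)).
- move=> A /ocitvP[->|[[a b] /= ab ->]]; first by rewrite !measure0.
  have abE : (`[a, b]%classic : set R) = [set a] `|` `]a, b]%classic.
    by rewrite setU1itv// bnd_simp ltW.
  have dj : [set a] `&` `]a, b]%classic = set0.
    by rewrite -subset0 => x /= [->]; rewrite in_itv /= ltxx.
  have h1 := mu_segmentI a b; have h2 := mu_segmentI a a.
  rewrite set_itv1 in h2.
  have h3 : nu [set a] = 0%E by exact: integral_set1.
  have h4 : m1 `[a, b]%classic = m2 `[a, b]%classic by exact: h1.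
  have add (m : {measure set (measurableTypeR R) -> \bar R}) :
      m [set a] = 0%E -> m `[a, b]%classic = m `]a, b]%classic.
    move=> ma; rewrite abE measureU// -[RHS]add0e; congr (_ + _)%E; exact: ma.
  have z1 : m1 [set a] = 0%E by exact: etrans h2 h3.
  by rewrite -(add m1 z1) -(add m2 h3).
- move=> n; have mn : measurable (`](- n%:R), n%:R]%classic `&` D : set (measurableTypeR R)).
    by apply: measurableI => //; exact: measurable_outside.
  by apply: le_lt_trans (ltry 1); exact: (probability_le1 mu mn).
Qed.

End density.

(** * A series for the Cauchy transform yields a density *)

Lemma has_sum_support (R : realType) (S S' : set R) (K : numFieldType) (f : R -> K) (l : K) :
  S' `<=` S -> (forall b, S b -> ~ S' b -> f b = 0) -> has_sum S f l -> has_sum S' f l.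
Proof.
move=> S'S f0 /has_sumP h; apply/has_sumP => e e0; have [A AS AB] := h e e0.
exists [fset x in A | `[< S' x >]]%fset.
  by move=> x /=; rewrite !inE /= => /andP[_ /asboolP].
move=> B BS' /fsubsetP sAB.
have US : [set` (A `|` B)%fset] `<=` S.
  by move=> x /=; rewrite inE => /orP[/AS//|/BS'/S'S].
have := AB _ US (fsubsetUl _ _); congr (`|l - _| < e).
rewrite (bigID (mem B))/= [X in _ + X]big1_seq ?addr0; last first.
  move=> x /andP[xB]; rewrite inE (negPf xB) orbF => xA; apply: f0; first exact: AS.
  move=> S'x; move/negP: xB; apply; apply: sAB.
  by rewrite !inE /= xA asboolT.
rewrite -big_filter; apply: perm_big; apply: uniq_perm; rewrite ?filter_uniq ?fset_uniq//.
by move=> x; rewrite mem_filter inE; case: (x \in B); rewrite ?orbT ?andbF.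
Qed.

Section series_to_density.
Variables (R : realType) (S : set R) (c : R) (mu : probability (measurableTypeR R) R).
Hypothesis S_ge0 : S `<=` [set x | 0 <= x].
Hypothesis S_0 : S 0.
Hypothesis S2 : condition_S2 S c.
Hypothesis c0 : 0 < c.
Variables (d : R -> R[i]) (A : R).
Hypotheses (d0 : d 0 = 1) (A0 : 0 < A).
Hypothesis dA : forall g, S g -> normc (d g) <= A `^ g.
Hypothesis dG : forall z : R[i], complex.Im z < 0 -> c * A < normc z ->
  has_sum S (fun g => d g / cpow z (g + 1)) (cauchy_transform mu z).

(** Any radius beyond [c * A] makes the ratio [q] admissible on all of |z| >= rho at once. *)
Let rho := c * A + 1.
Let q := A / rho.

Let rho0 : 0 < rho. Proof. by rewrite /rho ltr_wpDl ?mulr_ge0 ?ltW. Qed.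

Let ratio : [/\ 0 < q, q <= 1 & c * q < 1].
Proof. by apply: (ratio_small S_0 S2) => //; rewrite ltrDl. Qed.

Let term_bound z b : S b -> rho <= normc z ->
  normc (d b / cpow z (b + 1)) <= rho^-1 * q `^ b.
Proof.
move=> Sb rz; have n0 : 0 < normc z by exact: lt_le_trans rz.
have z0 : z != 0 by rewrite -normc_gt0.
rewrite cpowD cpow1// invfM mulrA normcM normcV mulrC.
apply: ler_pM; rewrite ?normc_ge0 ?invr_ge0 ?(ltW n0)//; first by rewrite lef_pV2.
apply: (@le_trans _ _ ((A / normc z) `^ b)).
  by rewrite -[leRHS]mul1r; apply: normc_term => //; rewrite mul1r dA.
apply: ge0_ler_powR; rewrite ?nnegrE ?divr_ge0 ?(ltW n0) ?(ltW A0) ?(ltW rho0)//; first exact: S_ge0.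
by rewrite ler_pM2l// lef_pV2.
Qed.

Lemma series_class_P : class_P S c mu.
Proof.
have [q0 q1 cq] := ratio.
have K0 : 0 <= rho^-1 by rewrite invr_ge0 ltW.
pose D := [set x : R | rho <= `|x|].
have Dn0 x : D x -> x != 0 by move=> Dx; rewrite -normr_gt0 (lt_le_trans rho0).
have nD x k : D x -> rho <= normc (below_axis x k).
  by move=> Dx; exact: le_trans Dx (normc_below_axis x k).
pose u x k b := d b / cpow (below_axis x k) (b + 1).
pose v x b := d b * inv_pow x (b + 1).
have ub x k b : D x -> S b -> normc (u x k b) <= rho^-1 * q `^ b.
  by move=> Dx Sb; apply: term_bound => //; exact: nD.
have uv x b : D x -> ccvg (fun k => u x k b) (v x b).
  by move=> Dx; apply: ccvgZ; apply: inv_cpow_boundary; exact: Dn0.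
have vb x b : D x -> S b -> normc (v x b) <= rho^-1 * q `^ b.
  by move=> Dx Sb; apply: ccvg_le (uv x b Dx) => k; exact: ub.
(* The boundary value of the transform. The default 0 is never taken in the outer region, where the
   series converges. *)
pose W x := xget 0 [set w | ccvg (psum S (v x)) w].
have vW x : D x -> ccvg (psum S (v x)) (W x).
  move=> Dx; have [l hl] := psum_ccvg S_ge0 S2 (ltW c0) q0 q1 cq (fun b => @vb x b Dx) K0.
  by rewrite /W; case: xgetP => // /(_ l).
have uG x k : D x -> ccvg (psum S (u x k)) (cauchy_transform mu (below_axis x k)).
  move=> Dx; apply: (has_sum_psum S_ge0 S2); apply: dG; first exact: Im_below_axis.
  by rewrite (lt_le_trans _ (nD _ _ Dx))// ltrDl.
have GW x : D x -> ccvg (fun k => cauchy_transform mu (below_axis x k)) (W x).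
  move=> Dx; apply: (tannery S_ge0 S2 (ltW c0) q0 q1 cq K0 (u := u x) (v := v x)).
  - by move=> k b; exact: ub.
  - by move=> b _; exact: uv.
  - by move=> k; exact: uG.
  - exact: vW.
pose M := rho^-1 * (c * (1 - c * q)^-1).
have GM x k : D x -> normc (cauchy_transform mu (below_axis x k)) <= M.
  move=> Dx; apply: ccvg_le (uG x k Dx) => n.
  exact: (psum_bound S_ge0 S2 (ltW c0) q0 q1 cq (fun b => @ub x k b Dx) K0).
have p0 := pi_gt0 R.
have W0 x : D x -> 0 <= complex.Im (W x).
  move=> Dx; have h := ccvg_Im (GW x Dx); rewrite -(cvg_lim _ h)//.
  apply: limr_ge; first by apply/cvg_ex; exists (complex.Im (W x)).
  by near=> k; exact: Im_cauchy_ge0.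
have mW : measurable_fun D (fun x => complex.Im (W x)).
  apply: (@measurable_fun_cvg _ _ _ _ (fun k x => complex.Im (cauchy_transform mu (below_axis x k)))).
    by move=> k; apply: measurable_funTS; exact: measurable_Im_cauchy.
  by move=> x Dx; apply: ccvg_Im; exact: GW.
pose f x := pi^-1 * complex.Im (W x).
(* Inversion divides by pi. The base [A] stays valid because 1 / pi <= 1, and it lies below rho / c
   by the choice of [rho]. *)
exists (fun b => (pi^-1)%:C * d b), A, rho, f; split; first split => //.
- by rewrite -ltr_pdivrMl ?invr_gt0// invrK ltrDl.
- move=> b Sb _; rewrite normr_normc lecR normc_realM ger0_norm ?invr_ge0 ?pi_ge0//.
  apply: le_trans (dA Sb); rewrite ler_piMl ?normc_ge0// invf_le1//.
  by have := pi_ge2 R; lra.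
split=> [x Dx|B mB].
  have h : has_sum S (fun b => complex.Im ((pi^-1)%:C * d b * inv_pow x (b + 1))) (f x).
    have -> : f x = complex.Im ((pi^-1)%:C * W x) by rewrite Im_realM.
    apply: has_sum_Im; apply: (psum_has_sum S_ge0 S2 (ltW c0) (M := pi^-1 * rho^-1) q0 q1 cq).
    - move=> b Sb; rewrite -mulrA normc_realM ger0_norm ?invr_ge0 ?pi_ge0//.
      by rewrite -mulrA ler_wpM2l ?invr_ge0 ?pi_ge0// vb.
    - by rewrite mulr_ge0// invr_ge0 pi_ge0.
    have -> : psum S (fun b => (pi^-1)%:C * d b * inv_pow x (b + 1)) =
        (fun N => (pi^-1)%:C * psum S (v x) N).
      apply/funext => N; rewrite /psum mulr_sumr; apply: eq_bigr => b _.
      by rewrite -mulrA.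
    by apply: ccvgZ; exact: vW.
  (* The exponent 0 drops out: [d 0 = 1] and the boundary value of 1 / z are real, so this term has
     no imaginary part. *)
  apply: has_sum_support h => [b []//|b Sb nb].
  have -> : b = 0.
    apply/eqP; rewrite eq_le S_ge0// andbT leNgt; apply/negP => b0; exact: nb.
  rewrite d0 mulr1 Im_realM add0r /inv_pow; case: ifPn => _; first by rewrite mulr0.
  by rewrite ImM Re_cexp Im_cexp /= mul1r sinpi !(mulr0, mul0r) addr0 mulr0.
apply: (@density_of_half_atoms _ _ rho (pi^-1 * M)) => //.
- exact: measurable_funM.
- by move=> x Dx; rewrite mulr_ge0 ?invr_ge0 ?pi_ge0 ?W0.
- move=> x Dx; rewrite ler_wpM2l ?invr_ge0 ?pi_ge0//.
  apply: le_trans (ler_norm _) (le_trans (normc_geIm _) _).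
  by apply: ccvg_le (GW x Dx) => k; exact: GM.
move=> a b ab abD.
have h := @stieltjes_inversion _ mu a b M (fun x => complex.Im (W x)) ab.
have abD' x : a <= x <= b -> D x by move=> axb; apply: abD; rewrite /= in_itv.
have mab : measurable_fun `[a, b] (fun x => complex.Im (W x)).
  by apply: (measurable_funS _ abD mW); exact: measurable_outside.
rewrite /f; under eq_integral do rewrite EFinM.
rewrite ge0_integralZl//; first last.
- by rewrite lee_fin invr_ge0 pi_ge0.
- by move=> x /abD Dx; rewrite lee_fin W0.
- exact/measurable_EFinP.
have pn : pi != 0 :> R by rewrite gt_eqF.
rewrite -h.
- by rewrite muleA -EFinM mulrA mulVf// mul1r.
- move=> k x /abD' Dx; apply: le_trans (normc_geIm _) _; exact: GM.
- by move=> x /abD' Dx; apply: ccvg_Im; exact: GW.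
Unshelve. all: end_near. Qed.

End series_to_density.

(** * Derivatives of complex functions of a real variable *)

Lemma inv_derivative_Re (R : realType) (a b lr li : R) : a * a + b * b != 0 ->
  a * (- (a * a + b * b) ^- 2 * (2 * (a * lr + b * li))) + (a * a + b * b)^-1 * lr =
  - lr * (a / (a * a + b * b) * (a / (a * a + b * b)) -
    - b / (a * a + b * b) * (- b / (a * a + b * b))) -
  - li * (a / (a * a + b * b) * (- b / (a * a + b * b)) +
    - b / (a * a + b * b) * (a / (a * a + b * b))).
Proof. by move=> n0; field. Qed.

Lemma inv_derivative_Im (R : realType) (a b lr li : R) : a * a + b * b != 0 ->
  - b * (- (a * a + b * b) ^- 2 * (2 * (a * lr + b * li))) + (a * a + b * b)^-1 * (- li) =
  - lr * (a / (a * a + b * b) * (- b / (a * a + b * b)) +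
    - b / (a * a + b * b) * (a / (a * a + b * b))) +
  - li * (a / (a * a + b * b) * (a / (a * a + b * b)) -
    - b / (a * a + b * b) * (- b / (a * a + b * b))).
Proof. by move=> n0; field. Qed.

Section complex_derivative.
Variable R : realType.
Implicit Types (f g : R -> R[i]) (t x : R) (l m : R[i]).

Lemma is_derive_conv (a : R -> R) t (a' b' : R) :
  is_derive t 1 a a' -> a' = b' -> is_derive t 1 a b'.
Proof. by move=> h <-. Qed.

(** Differentiation in a real variable, taken on real and imaginary parts. Complex analyticity
    enters only through such derivatives along paths. *)
Definition cderiv f t l : Prop :=
  is_derive t 1 (fun x => complex.Re (f x)) (complex.Re l) /\
  is_derive t 1 (fun x => complex.Im (f x)) (complex.Im l).

Lemma cderiv_eq f t l m : cderiv f t l -> l = m -> cderiv f t m.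
Proof. by move=> h <-. Qed.

Lemma cderiv_ext f g t l : (forall x, f x = g x) -> cderiv f t l -> cderiv g t l.
Proof. by move=> /funext ->. Qed.

Lemma cderiv_cst l t : cderiv (fun=> l) t 0.
Proof. by split; exact: is_derive_cst. Qed.

Lemma cderivD f g t l m : cderiv f t l -> cderiv g t m ->
  cderiv (fun x => f x + g x) t (l + m).
Proof.
move=> [f1 f2] [g1 g2]; split.
  by under eq_fun do rewrite ReD; rewrite ReD; exact: is_deriveD.
by under eq_fun do rewrite ImD; rewrite ImD; exact: is_deriveD.
Qed.

Lemma is_derive_mul (a b : R -> R) t (a' b' : R) : is_derive t 1 a a' -> is_derive t 1 b b' ->
  is_derive t 1 (fun x => a x * b x) (a t * b' + b t * a').
Proof. by move=> ha hb; exact: is_deriveM. Qed.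

Lemma cderivM f g t l m : cderiv f t l -> cderiv g t m ->
  cderiv (fun x => f x * g x) t (l * g t + f t * m).
Proof.
move=> [f1 f2] [g1 g2]; split.
  under eq_fun do rewrite ReM; rewrite ReD !ReM.
  have := is_deriveB (is_derive_mul f1 g1) (is_derive_mul f2 g2).
  by move/is_derive_conv; apply; ring.
under eq_fun do rewrite ImM; rewrite ImD !ImM.
have := is_deriveD (is_derive_mul f1 g2) (is_derive_mul f2 g1).
by move/is_derive_conv; apply; ring.
Qed.

Lemma cderivZ f t l m : cderiv f t l -> cderiv (fun x => m * f x) t (m * l).
Proof.
move=> h; apply: cderiv_eq (cderivM (cderiv_cst m t) h) _.
by rewrite mul0r add0r.
Qed.

Lemma cderivN f t l : cderiv f t l -> cderiv (fun x => - f x) t (- l).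
Proof.
move=> h; apply: cderiv_ext (fun x => mulN1r (f x)) _.
by apply: cderiv_eq (cderivZ (-1) h) _; rewrite mulN1r.
Qed.

Lemma cderivB f g t l m : cderiv f t l -> cderiv g t m ->
  cderiv (fun x => f x - g x) t (l - m).
Proof. by move=> hf hg; apply: cderivD => //; exact: cderivN. Qed.

Lemma cderiv_real (a : R -> R) t (a' : R) : is_derive t 1 a a' ->
  cderiv (fun x => (a x)%:C) t a'%:C.
Proof. by move=> h; split => //=; exact: is_derive_cst. Qed.

Lemma cderiv_sum (I : Type) (s : seq I) (F : I -> R -> R[i]) t (l : I -> R[i]) :
  (forall i, cderiv (F i) t (l i)) ->
  cderiv (fun x => \sum_(i <- s) F i x) t (\sum_(i <- s) l i).
Proof.
move=> h; elim: s => [|i s IH].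
  by under eq_fun do rewrite big_nil; rewrite big_nil; exact: cderiv_cst.
by under eq_fun do rewrite big_cons; rewrite big_cons; exact: cderivD.
Qed.

Lemma cderiv_cexp f t l : cderiv f t l -> cderiv (fun x => cexp (f x)) t (l * cexp (f t)).
Proof.
move=> [f1 f2].
have he : is_derive t 1 (fun x => expR (complex.Re (f x))) (expR (complex.Re (f t)) * complex.Re l).
  have h := @is_derive1_comp _ expR (fun x => complex.Re (f x)) t _ _ (is_derive_expR _) f1.
  exact: h.
have hc : is_derive t 1 (fun x => cos (complex.Im (f x))) (- sin (complex.Im (f t)) * complex.Im l).
  exact: (@is_derive1_comp _ cos (fun x => complex.Im (f x)) t _ _ (is_derive_cos _) f2).
have hs : is_derive t 1 (fun x => sin (complex.Im (f x))) (cos (complex.Im (f t)) * complex.Im l).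
  exact: (@is_derive1_comp _ sin (fun x => complex.Im (f x)) t _ _ (is_derive_sin _) f2).
split.
  under eq_fun do rewrite Re_cexp; rewrite ReM Re_cexp Im_cexp.
  by have := is_derive_mul he hc; move/is_derive_conv; apply; ring.
under eq_fun do rewrite Im_cexp; rewrite ImM Re_cexp Im_cexp.
by have := is_derive_mul he hs; move/is_derive_conv; apply; ring.
Qed.

Lemma cderivV f t l : f t != 0 -> cderiv f t l ->
  cderiv (fun x => (f x)^-1) t (- l / f t ^+ 2).
Proof.
move=> ft0 [f1 f2].
pose n x := complex.Re (f x) * complex.Re (f x) + complex.Im (f x) * complex.Im (f x).
have nt0 : n t != 0.
  rewrite /n -!expr2 paddr_eq0 ?sqr_ge0// !sqrf_eq0; apply/negP => /andP[/eqP h1 /eqP h2].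
  by move/eqP: ft0; apply; apply: complex_ext.
have hn : is_derive t 1 n (2 * (complex.Re (f t) * complex.Re l + complex.Im (f t) * complex.Im l)).
  have := is_deriveD (is_derive_mul f1 f1) (is_derive_mul f2 f2).
  by move/is_derive_conv; apply; ring.
have hv : is_derive t 1 (fun x => (n x)^-1) (- (n t) ^- 2 *
   (2 * (complex.Re (f t) * complex.Re l + complex.Im (f t) * complex.Im l))).
  by have := is_deriveV nt0 hn.
have E z : z^-1 = (complex.Re z * (complex.Re z * complex.Re z + complex.Im z * complex.Im z)^-1)
   +i* (- complex.Im z * (complex.Re z * complex.Re z + complex.Im z * complex.Im z)^-1).
  by case: z => a b; rewrite /GRing.inv /= !expr2 mulNr.
have -> : - l / f t ^+ 2 = - l * ((f t)^-1 * (f t)^-1) by rewrite -invfM expr2.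
under eq_fun do rewrite E; split => /=.
  have := is_derive_mul f1 hv; move/is_derive_conv; apply.
  by rewrite E !ReM ReN ImN !ImM; exact: inv_derivative_Re nt0.
have := is_derive_mul (is_deriveN f2) hv; move/is_derive_conv; apply.
by rewrite E !ImM ReN ImN !ReM; exact: inv_derivative_Im nt0.
Qed.

End complex_derivative.

(** * Integrals of complex functions *)

Section complex_integral.
Variables (d : measure_display) (T : measurableType d) (R : realType).
Variable m : {measure set T -> \bar R}.
Implicit Types (f g : T -> R[i]) (D : set T).

Definition cint D f : R[i] :=
  (\int[m]_(x in D) complex.Re (f x)) +i* (\int[m]_(x in D) complex.Im (f x)).

Lemma Re_cint D f : complex.Re (cint D f) = \int[m]_(x in D) complex.Re (f x).
Proof. by []. Qed.

Lemma Im_cint D f : complex.Im (cint D f) = \int[m]_(x in D) complex.Im (f x).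
Proof. by []. Qed.

Definition cintegrable D f :=
  m.-integrable D (fun x => (complex.Re (f x))%:E) /\
  m.-integrable D (fun x => (complex.Im (f x))%:E).

Lemma eq_cint D f g : (forall x, D x -> f x = g x) -> cint D f = cint D g.
Proof.
by move=> fg; rewrite /cint; congr (_ +i* _); apply: eq_Rintegral => x /set_mem Dx; rewrite fg.
Qed.

Lemma cintegrableD D f g : measurable D -> cintegrable D f -> cintegrable D g ->
  cintegrable D (fun x => f x + g x).
Proof.
move=> mD [f1 f2] [g1 g2]; split.
  by under eq_fun do rewrite ReD EFinD; exact: integrableD.
by under eq_fun do rewrite ImD EFinD; exact: integrableD.
Qed.

Lemma cintD D f g : measurable D -> cintegrable D f -> cintegrable D g ->
  cint D (fun x => f x + g x) = cint D f + cint D g.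
Proof.
move=> mD [f1 f2] [g1 g2]; apply: complex_ext; rewrite ?ReD ?ImD !(Re_cint, Im_cint).
  by rewrite -RintegralD//; apply: eq_Rintegral => x _; rewrite ReD.
by rewrite -RintegralD//; apply: eq_Rintegral => x _; rewrite ImD.
Qed.

Lemma cintegrableZ D f (k : R[i]) : measurable D -> cintegrable D f ->
  cintegrable D (fun x => k * f x).
Proof.
move=> mD [f1 f2]; split.
  under eq_fun do rewrite ReM EFinB !EFinM.
  by apply: integrableB => //; exact: integrableZl.
under eq_fun do rewrite ImM EFinD !EFinM.
by apply: integrableD => //; exact: integrableZl.
Qed.

Lemma cintZ D f (k : R[i]) : measurable D -> cintegrable D f ->
  cint D (fun x => k * f x) = k * cint D f.
Proof.
move=> mD [f1 f2]; apply: complex_ext; rewrite ?ReM ?ImM !(Re_cint, Im_cint).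
  rewrite -!RintegralZl// -RintegralB//; first by apply: eq_Rintegral => x _; rewrite ReM.
    exact: (integrableZl mD (complex.Re k) f1).
  exact: (integrableZl mD (complex.Im k) f2).
rewrite -!RintegralZl// -RintegralD//; first by apply: eq_Rintegral => x _; rewrite ImM.
  exact: (integrableZl mD (complex.Re k) f2).
exact: (integrableZl mD (complex.Im k) f1).
Qed.

Lemma cint0 D : cint D (fun=> 0) = 0.
Proof.
by apply: complex_ext; rewrite ?Re_cint ?Im_cint /= /Rintegral integral0.
Qed.

Lemma cintegrable0 D : cintegrable D (fun=> 0).
Proof. by split; exact: integrable0. Qed.

Lemma cintegrable_sum D (I : eqType) (s : seq I) (F : I -> T -> R[i]) : measurable D ->
  (forall i, i \in s -> cintegrable D (F i)) -> cintegrable D (fun x => \sum_(i <- s) F i x).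
Proof.
move=> mD; elim: s => [|i s IH] h.
  by under eq_fun do rewrite big_nil; exact: cintegrable0.
under eq_fun do rewrite big_cons; apply: cintegrableD => //; first by apply: h; rewrite mem_head.
by apply: IH => j js; apply: h; rewrite inE js orbT.
Qed.

Lemma cint_sum D (I : eqType) (s : seq I) (F : I -> T -> R[i]) : measurable D ->
  (forall i, i \in s -> cintegrable D (F i)) ->
  cint D (fun x => \sum_(i <- s) F i x) = \sum_(i <- s) cint D (F i).
Proof.
move=> mD; elim: s => [|i s IH] h.
  by under eq_fun do rewrite big_nil; rewrite big_nil cint0.
have hs j : j \in s -> cintegrable D (F j) by move=> js; apply: h; rewrite inE js orbT.
under eq_fun do rewrite big_cons; rewrite big_cons cintD ?IH//; last exact: cintegrable_sum.
by apply: h; rewrite mem_head.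
Qed.

(** The factor 2 comes from estimating the real and imaginary parts separately. *)
Lemma normc_cint_le D f (g : T -> R) : measurable D -> cintegrable D f ->
  m.-integrable D (EFin \o g) -> (forall x, D x -> normc (f x) <= g x) ->
  normc (cint D f) <= 2 * \int[m]_(x in D) g x.
Proof.
move=> mD [f1 f2] ig fg; apply: le_trans (normc_leRI _) _.
have half (h : T -> R) : m.-integrable D (fun x => (h x)%:E) ->
    (forall x, D x -> `|h x| <= g x) -> `|\int[m]_(x in D) h x| <= \int[m]_(x in D) g x.
  move=> ih hg; apply: le_trans (le_normr_Rintegral _ _) _ => //.
  by apply: le_Rintegral => //; exact: integrable_norm ih.
have -> : 2 * \int[m]_(x in D) g x = \int[m]_(x in D) g x + \int[m]_(x in D) g x.
  by rewrite mulrDl mul1r.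
by apply: lerD; apply: half => // x Dx; apply: le_trans (fg x Dx); rewrite ?normc_geRe ?normc_geIm.
Qed.

Lemma cint_dct D (f_ : nat -> T -> R[i]) (f : T -> R[i]) (g : T -> R) : measurable D ->
  (forall n, measurable_fun D (fun x => complex.Re (f_ n x))) ->
  (forall n, measurable_fun D (fun x => complex.Im (f_ n x))) ->
  (forall x, D x -> ccvg (f_ ^~ x) (f x)) ->
  m.-integrable D (EFin \o g) -> (forall n x, D x -> normc (f_ n x) <= g x) ->
  cintegrable D f /\ ccvg (fun n => cint D (f_ n)) (cint D f).
Proof.
move=> mD mr mi ff ig fg.
have [_ ir _ cr] := dominated_convergence_real mD mr (fun x Dx => ccvg_Re (ff x Dx)) ig
  (fun n x Dx => le_trans (normc_geRe (f_ n x)) (fg n x Dx)).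
have [_ ii _ ci] := dominated_convergence_real mD mi (fun x Dx => ccvg_Im (ff x Dx)) ig
  (fun n x Dx => le_trans (normc_geIm (f_ n x)) (fg n x Dx)).
by split => //; exact: ccvg_ReIm.
Qed.

End complex_integral.

(** * Fundamental theorem, parameter derivatives and mean value inequality *)

Section complex_calculus.
Variable R : realType.
Local Notation leb := (@lebesgue_measure R).
Implicit Types (f : R -> R[i]) (t x : R) (l : R[i]).

Lemma cderiv_continuous f t l : cderiv f t l ->
  {for t, continuous (fun x => complex.Re (f x))} /\
  {for t, continuous (fun x => complex.Im (f x))}.
Proof.
by move=> [[h1 _] [h2 _]]; split; apply: differentiable_continuous; exact/derivable1_diffP.
Qed.

(** Differentiability of [dh] supplies its continuity, hence its integrability on the segment. *)
Lemma complex_FTC2 (h dh : R -> R[i]) (a b : R) : a < b ->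
  (forall x, a <= x <= b -> cderiv h x (dh x)) ->
  (forall x, a <= x <= b -> exists l, cderiv dh x l) ->
  cintegrable leb `[a, b] dh /\ cint leb `[a, b] dh = h b - h a.
Proof.
move=> ab hdh cdh.
have real (F G : R -> R) : (forall x, a <= x <= b -> is_derive x 1 F (G x)) ->
    (forall x, a <= x <= b -> {for x, continuous G}) ->
    leb.-integrable `[a, b] (fun x => (G x)%:E) /\ \int[leb]_(x in `[a, b]) G x = F b - F a.
  move=> hF cG.
  have wG : {within `[a, b], continuous G}.
    by apply: continuous_in_subspaceT => x /set_mem /=; rewrite in_itv; exact: cG.
  split; first by apply: continuous_compact_integrable => //; exact: segment_compact.
  have cF x : a <= x <= b -> {for x, continuous F}.
    by move=> /hF[h1 _]; apply: differentiable_continuous; exact/derivable1_diffP.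
  rewrite /Rintegral (@continuous_FTC2 _ G F)//.
  - split.
    + by move=> x; rewrite in_itv /= => /andP[ax xb]; have [] := hF x ltac:(by rewrite !ltW).
    + by apply: cvg_at_right_filter; apply: cF; rewrite lexx ltW.
    + by apply: cvg_at_left_filter; apply: cF; rewrite lexx ltW.
  - move=> x; rewrite in_itv /= => /andP[ax xb]; rewrite derive1E.
    by have [_ ->] := hF x ltac:(by rewrite !ltW).
have [i1 e1] := real _ _ (fun x hx => (hdh x hx).1)
  (fun x hx => let: ex_intro _ hl := cdh x hx in (cderiv_continuous hl).1).
have [i2 e2] := real _ _ (fun x hx => (hdh x hx).2)
  (fun x hx => let: ex_intro _ hl := cdh x hx in (cderiv_continuous hl).2).
by split => //; apply: complex_ext; rewrite ?ReD ?ImD ?ReN ?ImN.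
Qed.

Lemma cderiv_under_integral (g dg : R -> R -> R[i]) (u v a lo hi K : R) :
  u < a < v -> lo <= hi ->
  (forall t x, u < t < v -> lo <= x <= hi -> cderiv (g ^~ x) t (dg t x)) ->
  (forall t, u < t < v -> cintegrable leb `[lo, hi] (g t)) ->
  (forall t x, u < t < v -> lo <= x <= hi -> normc (dg t x) <= K) ->
  cderiv (fun t => cint leb `[lo, hi] (g t)) a (cint leb `[lo, hi] (dg a)).
Proof.
move=> uav lohi hg ig hK.
(* The dominating function has to be nonnegative everywhere, hence the maximum with 0. *)
have iK : leb.-integrable `[lo, hi] (EFin \o cst (Num.max K 0)).
  apply: continuous_compact_integrable; first exact: segment_compact.
  by apply: continuous_subspaceT => x; exact: cvg_cst.
have real (f df : R -> R -> R) :
    (forall t x, u < t < v -> lo <= x <= hi -> is_derive t 1 (f ^~ x) (df t x)) ->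
    (forall t, u < t < v -> leb.-integrable `[lo, hi] (fun x => (f t x)%:E)) ->
    (forall t x, u < t < v -> lo <= x <= hi -> `|df t x| <= K) ->
    is_derive a 1 (fun t => \int[leb]_(x in `[lo, hi]) f t x) (\int[leb]_(x in `[lo, hi]) df a x).
  move=> hf i_f dfK.
  have Ia : (`]u, v[%classic : set R) a by rewrite /= in_itv.
  have d1 x y : (`]u, v[%classic : set R) x -> (`[lo, hi]%classic : set R) y -> derivable (f ^~ y) x 1.
    by rewrite /= !in_itv => hx hy; have [] := hf x y hx hy.
  have d1E x y : (`]u, v[%classic : set R) x -> (`[lo, hi]%classic : set R) y ->
      partial1of2 f x y = df x y.
    by rewrite /= !in_itv partial1of2E => hx hy; have [_ ->] := hf x y hx hy.
  have bnd x y : (`]u, v[%classic : set R) x -> (`[lo, hi]%classic : set R) y ->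
      `|partial1of2 f x y| <= cst (Num.max K 0) y.
    move=> hx hy; rewrite d1E//; move: hx hy; rewrite /= !in_itv => hx hy.
    by rewrite le_max dfK.
  have i1 x : (`]u, v[%classic : set R) x -> leb.-integrable `[lo, hi] (EFin \o f x).
    by rewrite /= in_itv; exact: i_f.
  have K0 (y : R) : 0 <= cst (Num.max K 0) y :> R by rewrite /= le_max lexx orbT.
  have mI : measurable (`[lo, hi]%classic : set (measurableTypeR R)) by exact: measurable_itv.
  have E : \int[leb]_(x in `[lo, hi]) df a x = \int[leb]_(y in `[lo, hi]) partial1of2 f a y.
    by apply: eq_Rintegral => y /set_mem hy; rewrite d1E.
  rewrite E; apply: DeriveDef; first exact: (derivable_under_integral mI Ia i1 d1 K0 iK bnd).
  by rewrite -derive1E; exact: (differentiation_under_integral mI Ia i1 d1 K0 iK bnd).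
split => /=.
  apply: (real (fun t x => complex.Re (g t x)) (fun t x => complex.Re (dg t x))) => [t x ht hx|t ht|t x ht hx].
  - by have [] := hg t x ht hx.
  - exact: (ig t ht).1.
  - exact: le_trans (normc_geRe _) (hK t x ht hx).
apply: (real (fun t x => complex.Im (g t x)) (fun t x => complex.Im (dg t x))) => [t x ht hx|t ht|t x ht hx].
- exact: (hg t x ht hx).2.
- exact: (ig t ht).2.
- exact: le_trans (normc_geIm _) (hK t x ht hx).
Qed.

Lemma complex_mean_value f (df : R -> R[i]) (e : R) :
  (forall t, 0 <= t <= 1 -> cderiv f t (df t)) ->
  (forall t, 0 <= t <= 1 -> normc (df t) <= e) ->
  normc (f 1 - f 0) <= 2 * e.
Proof.
move=> hf he.
have real (F G : R -> R) : (forall t, 0 <= t <= 1 -> is_derive t 1 F (G t)) ->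
    (forall t, 0 <= t <= 1 -> `|G t| <= e) -> `|F 1 - F 0| <= e.
  move=> hF hG.
  have [| |t] := @MVT_segment _ F G 0 1 ler01.
  - by move=> x; rewrite in_itv /= => /andP[x0 x1]; apply: hF; rewrite !ltW.
  - apply: continuous_in_subspaceT => x /set_mem /=; rewrite in_itv => /hF[h1 _].
    by apply: differentiable_continuous; exact/derivable1_diffP.
  - by rewrite in_itv => /hG h ->; rewrite subr0 mulr1.
apply: le_trans (normc_leRI _) _; rewrite mulrDl mul1r ReD ReN ImD ImN; apply: lerD.
  apply: (real (fun t => complex.Re (f t)) (fun t => complex.Re (df t))) => t ht; first exact: (hf t ht).1.
  exact: le_trans (normc_geRe _) (he t ht).
apply: (real (fun t => complex.Im (f t)) (fun t => complex.Im (df t))) => t ht; first exact: (hf t ht).2.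
exact: le_trans (normc_geIm _) (he t ht).
Qed.

End complex_calculus.

(** * The kernel of one power along a logarithmic path *)

Section power_kernel.
Variable R : realType.
Local Notation leb := (@lebesgue_measure R).

Lemma cintegrable_derivable (f : R -> R[i]) (a b : R) :
  (forall x, a <= x <= b -> exists l, cderiv f x l) -> cintegrable leb `[a, b] f.
Proof.
move=> hf; split; apply: continuous_compact_integrable; try exact: segment_compact;
  apply: continuous_in_subspaceT => x /set_mem /=; rewrite in_itv => /hf[l /cderiv_continuous[]//].
Qed.

Lemma cderiv_powR (e x : R) : 0 < x ->
  cderiv (fun y => (y `^ e)%:C) x (e * x `^ (e - 1))%:C.
Proof. by move=> x0; apply: cderiv_real; exact: is_derive1_powR. Qed.

Lemma cderiv_affine (z0 : R[i]) (s x : R) : cderiv (fun y => z0 - (s * y)%:C) x (- s%:C).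
Proof.
apply: cderiv_eq (cderivB (cderiv_cst z0 x) (cderiv_real (a' := s) _)) _; last by rewrite sub0r.
have := @is_derive_mul R (cst s) id x 0 1 (is_derive_cst _ _ _) (is_derive_id _ _).
by move/is_derive_conv; apply; rewrite mulr0 addr0 mulr1.
Qed.

Variables (sg rho be : R) (ze0 De : R[i]).
Hypotheses (rho0 : 0 < rho) (be0 : 0 < be).

(** A segment in the logarithmic coordinate; its exponential [zpath] runs along a logarithmic
    spiral. *)
Definition path (t : R) : R[i] := ze0 + t%:C * De.

Lemma cderiv_path t : cderiv path t De.
Proof.
have := @cderiv_real _ id t 1 (is_derive_id _ _).
move=> h; apply: cderiv_eq (cderivD (cderiv_cst ze0 t) (cderivM h (cderiv_cst De t))) _.
by rewrite add0r mulr0 addr0 mul1r.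
Qed.

Lemma cderiv_cexp_path (k : R) t :
  cderiv (fun t => cexp (k%:C * path t)) t (k%:C * De * cexp (k%:C * path t)).
Proof. by apply: cderiv_cexp; apply: cderivZ; exact: cderiv_path. Qed.

Definition zpath t := cexp (path t).

Lemma cderiv_zpath t : cderiv zpath t (De * zpath t).
Proof. by apply: cderiv_cexp; exact: cderiv_path. Qed.

Definition kern t x : R[i] :=
  cexp ((be + 1)%:C * path t) * (x `^ (- (be + 1)))%:C * (zpath t - (sg * x)%:C)^-1.
Definition flux t x : R[i] :=
  cexp ((be + 1)%:C * path t) * (x `^ (- be))%:C * (zpath t - (sg * x)%:C)^-1.
(** The common derivative: [flux], which is x times [kern] for positive x, has x-derivative [dkern],
    and [kern] has t-derivative [- De * dkern]. Behind this is Euler's relation, as (z / x)^(be+1) /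
    (z - sg x) is homogeneous of degree -1. *)
Definition dkern t x : R[i] :=
  cexp ((be + 1)%:C * path t) * (x `^ (- (be + 1)))%:C *
  (- (be + 1)%:C * (zpath t - (sg * x)%:C)^-1 + zpath t * (zpath t - (sg * x)%:C) ^- 2).

Lemma cderiv_kern t x : zpath t - (sg * x)%:C != 0 -> cderiv (kern ^~ x) t (- De * dkern t x).
Proof.
move=> nz.
have hw : cderiv (fun t => zpath t - (sg * x)%:C) t (De * zpath t).
  by apply: cderiv_eq (cderivB (cderiv_zpath t) (cderiv_cst _ t)) _; rewrite subr0.
apply: cderiv_eq (cderivM (cderivM (cderiv_cexp_path (be + 1) t) (cderiv_cst _ t)) (cderivV nz hw)) _.
have key (w0 z E p b D : R[i]) : w0 != 0 -> (b * D * E * p + E * 0) / w0 +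
    E * p * (- (D * z) / w0 ^+ 2) = - D * (E * p * (- b / w0 + z / w0 ^+ 2)).
  by move=> h; field.
exact: key.
Qed.

Lemma cderiv_flux t x : 0 < x -> zpath t - (sg * x)%:C != 0 ->
  cderiv (flux t) x (dkern t x).
Proof.
move=> x0 nz.
apply: cderiv_eq (cderivM (cderivM (cderiv_cst _ x) (cderiv_powR (- be) x0))
  (cderivV nz (cderiv_affine (zpath t) sg x))) _.
have key (w0 z E p b y s : R[i]) : w0 != 0 -> z = w0 + s * y ->
    (0 * (p * y) + E * (- b * p)) / w0 + E * (p * y) * (- - s / w0 ^+ 2) =
    E * p * (- (b + 1) / w0 + z / w0 ^+ 2).
  by move=> h ->; field.
have px : x `^ (- be) = x `^ (- (be + 1)) * x.
  rewrite -[X in _ = _ * X](powRr1 (ltW x0)) -powRD; last by rewrite (gt_eqF x0) implybT.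
  by congr (_ `^ _); ring.
have pb : - be - 1 = - (be + 1) by ring.
rewrite /dkern; cbv beta; rewrite pb px !rmorphM !rmorphN [(be + 1)%:C]rmorphD rmorph1.
by apply: key; [rewrite -rmorphM|rewrite subrK].
Qed.

Lemma derivable_dkern t x : 0 < x -> zpath t - (sg * x)%:C != 0 ->
  exists l, cderiv (dkern t) x l.
Proof.
move=> x0 nz; have hv := cderivV nz (cderiv_affine (zpath t) sg x).
have [l2 hv2] : exists l2, cderiv (fun x => (zpath t - (sg * x)%:C) ^- 2) x l2.
  eexists; apply: (cderiv_ext _ (cderivM hv hv)) => y; by rewrite -invfM -expr2.
eexists; apply: cderivM; first by apply: cderivM (cderiv_cst _ x) (cderiv_powR _ x0).
by apply: cderivD; apply: cderivM (cderiv_cst _ x) _; [exact: hv|exact: hv2].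
Qed.

Lemma derivable_kern_x t x : 0 < x -> zpath t - (sg * x)%:C != 0 ->
  exists l, cderiv (kern t) x l.
Proof.
move=> x0 nz; eexists; apply: cderivM; last exact: cderivV nz (cderiv_affine (zpath t) sg x).
exact: cderivM (cderiv_cst _ x) (cderiv_powR _ x0).
Qed.

Lemma normc_powR x (e : R) : normc (x `^ e)%:C = x `^ e.
Proof. by rewrite normc_real ger0_norm// powR_ge0. Qed.

Variable dl : R.
Hypothesis dl0 : 0 < dl.
Hypothesis zIm : forall t, - dl <= t <= 1 + dl -> complex.Im (zpath t) < 0.

Lemma Im_sub_real (z : R[i]) (y : R) : complex.Im (z - y%:C) = complex.Im z.
Proof. by rewrite ImD ImN /= oppr0 addr0. Qed.

Lemma sub_real_neq0 (z : R[i]) (y : R) : complex.Im z < 0 -> z - y%:C != 0.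
Proof. by move=> h; apply: Im_lt0_neq0; rewrite Im_sub_real. Qed.

(** By compactness the path keeps a positive distance from the real axis and a bounded modulus. The
    margin [dl] leaves room for two-sided derivatives at t = 0 and t = 1. *)
Lemma path_bounds : exists m P : R, [/\ 0 < m,
  forall t, - dl <= t <= 1 + dl -> m <= - complex.Im (zpath t) &
  forall t, - dl <= t <= 1 + dl -> complex.Re (path t) <= P].
Proof.
have le : - dl <= 1 + dl by rewrite (@le_trans _ _ 0)// ?oppr_le0 ?addr_ge0// ltW.
have cI : {within `[- dl, 1 + dl], continuous (fun t => - complex.Im (zpath t))}.
  by apply: continuous_subspaceT => t; apply: cvgN; have [_] := cderiv_continuous (cderiv_zpath t).
have cR : {within `[- dl, 1 + dl], continuous (fun t => complex.Re (path t))}.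
  by apply: continuous_subspaceT => t; have [] := cderiv_continuous (cderiv_path t).
have [a ain ha] := EVT_min le cI; have [b bin hb] := EVT_max le cR.
exists (- complex.Im (zpath a)), (complex.Re (path b)); split.
- by rewrite oppr_gt0 zIm//; move: ain; rewrite in_itv.
- by move=> t tin; apply: ha; rewrite in_itv.
- by move=> t tin; apply: hb; rewrite in_itv.
Qed.

Lemma cderiv_partial_integral t M : rho < M -> 0 <= t <= 1 ->
  cderiv (fun t => cint leb `[rho, M] (kern t)) t (De * (flux t rho - flux t M)).
Proof.
move=> rM t01; have [m [P [m0 hm hP]]] := path_bounds.
have nz u x : - dl <= u <= 1 + dl -> zpath u - (sg * x)%:C != 0.
  by move=> hu; apply: sub_real_neq0; exact: zIm.
have t_in : - dl < t < 1 + dl.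
  by case/andP: t01 => t0 t1; rewrite ltr_pwDr// andbT (lt_le_trans _ t0)// oppr_lt0.
have wt u : - dl < u < 1 + dl -> - dl <= u <= 1 + dl.
  by move=> /andP[? ?]; rewrite !ltW.
have x0 x : rho <= x <= M -> 0 < x by move=> /andP[/(lt_le_trans rho0)].
have E : De * (flux t rho - flux t M) = cint leb `[rho, M] (fun x => - De * dkern t x).
  have [i1 i2] := complex_FTC2 rM (fun x hx => cderiv_flux (x0 x hx) (nz t x (wt _ t_in)))
    (fun x hx => derivable_dkern (x0 x hx) (nz t x (wt _ t_in))).
  by rewrite cintZ// i2 mulNr -mulrN opprB.
rewrite E.
(* A bound for [dkern] uniform in both variables: [P] controls the modulus of z, [m] bounds z - sg x
   from below, and the negative power of x is largest at [rho]. *)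
pose C := expR ((be + 1) * P) * rho `^ (- (be + 1)) * ((be + 1) * m^-1 + expR P * m ^- 2).
apply: (@cderiv_under_integral _ kern (fun t x => - De * dkern t x) (- dl) (1 + dl) t rho M
  (normc De * C)) => //.
- exact: ltW.
- by move=> u x hu hx; apply: cderiv_kern; exact: nz (wt _ hu).
- by move=> u hu; apply: cintegrable_derivable => x hx; apply: derivable_kern_x (x0 _ hx) (nz _ _ (wt _ hu)).
move=> u x /wt hu hx; rewrite normcM normcN ler_wpM2l ?normc_ge0//.
have w_ge : m <= normc (zpath u - (sg * x)%:C).
  apply: le_trans (hm u hu) (le_trans (ler_norm _) _).
  by rewrite normrN -(Im_sub_real _ (sg * x)) normc_geIm.
have w0 : 0 < normc (zpath u - (sg * x)%:C) by exact: lt_le_trans w_ge.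
have b1 : 0 <= be + 1 by rewrite addr_ge0// ltW.
rewrite /dkern 2!normcM normc_powR; apply: ler_pM; rewrite ?mulr_ge0 ?normc_ge0 ?powR_ge0//.
  apply: ler_pM; rewrite ?normc_ge0 ?powR_ge0//.
    by rewrite normc_cexp ler_expR Re_realM ler_wpM2l// hP.
  case/andP: hx => rx _; rewrite !powRN lef_pV2 ?posrE ?powR_gt0 ?(lt_le_trans rho0 rx)//.
  by apply: ge0_ler_powR; rewrite ?nnegrE ?(ltW rho0)// (le_trans (ltW rho0) rx).
apply: le_trans (normcD _ _) _; apply: lerD.
  rewrite normcM normcN normc_real ger0_norm// ler_wpM2l// normcV.
  by rewrite lef_pV2 ?posrE.
rewrite normcM normcV normcX; apply: ler_pM; rewrite ?normc_ge0 ?invr_ge0 ?exprn_ge0 ?normc_ge0//.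
  by rewrite /zpath normc_cexp ler_expR hP.
by rewrite lef_pV2 ?posrE ?exprn_gt0// ler_pXn2r// nnegrE ltW.
Qed.

End power_kernel.

(** * The conservation law for one power *)

Lemma geometric_remainder (R : realType) (z y : R[i]) N : z != 0 -> z - y != 0 ->
  (z - y)^-1 = \sum_(n < N) y ^+ n * z ^- n.+1 + (y / z) ^+ N * (z - y)^-1.
Proof.
move=> z0 zy; elim: N => [|N IH]; first by rewrite big_ord0 add0r expr0 mul1r.
rewrite big_ord_recr /= {1}IH -addrA; congr (_ + _).
rewrite !expr_div_n.
have zN : z ^+ N != 0 by rewrite expf_neq0.
rewrite !exprS invfM; move: (y ^+ N) (z ^+ N) zN => p w w0.
by field; rewrite zy z0 w0.
Qed.

Section conservation.
Variable R : realType.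
Local Notation leb := (@lebesgue_measure R).
Variables (rho be al1 al2 : R) (ze0 De : R[i]).
Hypotheses (rho0 : 0 < rho) (be0 : 0 < be).
Hypothesis al_int : forall n : nat, n%:R = be -> al1 + (-1) ^+ n * al2 = 0.

(* At [n = be] the division gives [0], and the numerator vanishes by [al_int]. *)
Definition kappa (n : nat) : R := (al1 + (-1) ^+ n * al2) / (n%:R - be).

Lemma kappaM n : kappa n * (n%:R - be) = al1 + (-1) ^+ n * al2.
Proof.
rewrite /kappa; case: (eqVneq n%:R be) => [h|h]; last by rewrite divfK// subr_eq0.
by rewrite al_int// mul0r mul0r.
Qed.

(** A truncated conserved quantity: one [N] cuts both the integrals, at [rho + N.+1], and the
    Laurent series, after [N] terms. Differentiating the power of exponent be - n along the path
    produces the factor be - n, which the denominator of [kappa] cancels. *)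
Definition conserved (N : nat) (t : R) : R[i] :=
  al1%:C * cint leb `[rho, rho + N.+1%:R] (kern 1 be ze0 De t) +
  al2%:C * cint leb `[rho, rho + N.+1%:R] (kern (-1) be ze0 De t) +
  \sum_(n < N) (kappa n * rho `^ (n%:R - be))%:C * cexp ((be - n%:R)%:C * path ze0 De t).

Variables (dl r : R).
Hypotheses (dl0 : 0 < dl) (r_rho : rho < r).
Hypothesis zIm : forall t, - dl <= t <= 1 + dl -> complex.Im (zpath ze0 De t) < 0.
Hypothesis zr : forall t, 0 <= t <= 1 -> r <= normc (zpath ze0 De t).

Let dconserved (N : nat) (t : R) : R[i] :=
  al1%:C * (De * (flux 1 be ze0 De t rho - flux 1 be ze0 De t (rho + N.+1%:R))) +
  al2%:C * (De * (flux (-1) be ze0 De t rho - flux (-1) be ze0 De t (rho + N.+1%:R))) +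
  \sum_(n < N) (kappa n * rho `^ (n%:R - be))%:C *
    ((be - n%:R)%:C * De * cexp ((be - n%:R)%:C * path ze0 De t)).

Let cderiv_conserved N t : 0 <= t <= 1 -> cderiv (conserved N) t (dconserved N t).
Proof.
move=> t01; have rN : rho < rho + N.+1%:R by rewrite ltrDl.
apply: cderivD.
  by apply: cderivD; apply: cderivZ; exact: (cderiv_partial_integral _ rho0 be0 dl0 zIm rN t01).
apply: cderiv_sum => n; apply: cderivZ.
exact: cderiv_cexp_path.
Qed.

Let t_wide t : 0 <= t <= 1 -> - dl <= t <= 1 + dl.
Proof.
move=> /andP[t0 t1]; rewrite (le_trans _ t0) ?oppr_le0 ?(ltW dl0)//=.
by rewrite (le_trans t1)// lerDl ltW.
Qed.

Let cexp_shift t n : cexp ((be - n%:R)%:C * path ze0 De t) =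
  cexp ((be + 1)%:C * path ze0 De t) * zpath ze0 De t ^- n.+1.
Proof.
rewrite /zpath -cexpMn -cexpN -cexpD; congr cexp.
rewrite -mulrBl; congr (_ * _).
by rewrite !rmorphD rmorphN !rmorph_nat rmorph1 -natr1; ring.
Qed.

Let remainder (sg : R) (N : nat) (t : R) : R[i] :=
  cexp ((be + 1)%:C * path ze0 De t) * (rho `^ (- be))%:C *
  (((sg * rho)%:C / zpath ze0 De t) ^+ N * (zpath ze0 De t - (sg * rho)%:C)^-1).

Let flux_expansion sg N t : 0 <= t <= 1 ->
  flux sg be ze0 De t rho = \sum_(n < N) (sg ^+ n * rho `^ (n%:R - be))%:C *
    cexp ((be - n%:R)%:C * path ze0 De t) + remainder sg N t.
Proof.
move=> t01; have hIm := zIm (t_wide t01).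
have z0 := Im_lt0_neq0 hIm; have zy := sub_real_neq0 (sg * rho) hIm.
rewrite /flux (geometric_remainder N z0 zy) mulrDr; congr (_ + _).
rewrite mulr_sumr; apply: eq_bigr => n _.
rewrite cexp_shift.
have -> : rho `^ (n%:R - be) = rho ^+ n * rho `^ (- be).
  rewrite powRD; last by rewrite (gt_eqF rho0) implybT.
  by rewrite powR_mulrn ?(ltW rho0).
by rewrite -rmorphXn exprMn !rmorphM; ring.
Qed.

(** The Laurent terms cancel the first [N] terms of the geometric expansion of the inner flux,
    leaving its remainder and the flux through the outer end. *)
Let dconservedE N t : 0 <= t <= 1 -> dconserved N t =
  De * (al1%:C * (remainder 1 N t - flux 1 be ze0 De t (rho + N.+1%:R)) +
        al2%:C * (remainder (-1) N t - flux (-1) be ze0 De t (rho + N.+1%:R))).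
Proof.
move=> t01; rewrite /dconserved !(flux_expansion _ N t01).
have -> : \sum_(n < N) (kappa n * rho `^ (n%:R - be))%:C *
    ((be - n%:R)%:C * De * cexp ((be - n%:R)%:C * path ze0 De t)) =
  - (al1%:C * (De * \sum_(n < N) (1 ^+ n * rho `^ (n%:R - be))%:C *
    cexp ((be - n%:R)%:C * path ze0 De t)) +
   al2%:C * (De * \sum_(n < N) ((-1) ^+ n * rho `^ (n%:R - be))%:C *
    cexp ((be - n%:R)%:C * path ze0 De t))).
  rewrite !mulr_sumr -big_split /= -sumrN; apply: eq_bigr => n _.
  have -> : (kappa n * rho `^ (n%:R - be))%:C * ((be - n%:R)%:C * De *
      cexp ((be - n%:R)%:C * path ze0 De t)) =
      (- (kappa n * (n%:R - be)) * rho `^ (n%:R - be))%:C * (De * cexp ((be - n%:R)%:C * path ze0 De t)).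
    rewrite (_ : - (kappa n * (n%:R - be)) * _ = kappa n * rho `^ (n%:R - be) * (be - n%:R)); last by ring.
    by rewrite [in RHS]rmorphM -!mulrA.
  rewrite kappaM expr1n.
  rewrite !(rmorphM, rmorphN, rmorphD, rmorphXn, rmorph1) /=; ring.
ring.
Qed.

Let path_upper : exists P, forall t, 0 <= t <= 1 -> complex.Re (path ze0 De t) <= P.
Proof.
have [m [P [_ _ hP]]] := @path_bounds _ ze0 De _ dl0 zIm.
by exists P => t /t_wide; exact: hP.
Qed.

(** Uniformly on the path, the remainder is of order (rho / r)^N, and the outer flux of order 1 /
    (rho + N + 1 - Z), where Z bounds the modulus of z. The mean value inequality turns this into a
    bound on the increment. *)
Lemma conserved_ccvg : ccvg (fun N => conserved N 1 - conserved N 0) 0.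
Proof.
have [P hP] := path_upper.
have b1 : 0 <= be + 1 by rewrite addr_ge0// ltW.
have r0 : 0 < r by exact: lt_trans r_rho.
have rr0 : 0 < r - rho by rewrite subr_gt0.
pose E := expR ((be + 1) * P) * rho `^ (- be).
have E0 : 0 <= E by rewrite mulr_ge0 ?expR_ge0 ?powR_ge0.
pose Z := expR P.
have hZ t : 0 <= t <= 1 -> normc (zpath ze0 De t) <= Z.
  by move=> t01; rewrite /zpath normc_cexp ler_expR hP.
pose a N := (rho / r) ^+ N * (r - rho)^-1 + (rho + N.+1%:R - Z)^-1.
pose e N := 2 * (normc De * ((`|al1| + `|al2|) * E)) * a N.
have rem_le sg N t : `|sg| = 1 -> 0 <= t <= 1 ->
    normc (remainder sg N t) <= E * ((rho / r) ^+ N * (r - rho)^-1).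
  move=> sg1 t01; have rz := zr t01.
  have nz : normc (sg * rho)%:C = rho by rewrite normc_real normrM sg1 mul1r gtr0_norm.
  rewrite /remainder normcM; apply: ler_pM; rewrite ?normc_ge0//.
    rewrite normcM normc_powR /E ler_wpM2r ?powR_ge0//.
    by rewrite normc_cexp ler_expR Re_realM ler_wpM2l// hP.
  rewrite normcM; apply: ler_pM; rewrite ?normc_ge0//.
    rewrite normcX normcM nz normcV; apply: lerXn2r; rewrite ?nnegrE ?divr_ge0 ?normc_ge0 ?(ltW rho0) ?(ltW r0)//.
    by rewrite ler_pM2l// lef_pV2 ?posrE ?(lt_le_trans r0 rz).
  rewrite normcV lef_pV2 ?posrE//.
    by rewrite (le_trans _ (normcB_ge _ _))// nz lerB.
  by rewrite (lt_le_trans rr0)// (le_trans _ (normcB_ge _ _))// nz lerB.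
have flux_le sg N t : `|sg| = 1 -> 0 <= t <= 1 -> Z < rho + N.+1%:R ->
    normc (flux sg be ze0 De t (rho + N.+1%:R)) <= E * (rho + N.+1%:R - Z)^-1.
  move=> sg1 t01 ZM; set M := rho + _ in ZM *.
  have M0 : 0 < M by rewrite /M addr_gt0.
  have nz : normc (sg * M)%:C = M by rewrite normc_real normrM sg1 mul1r gtr0_norm.
  have hw : M - Z <= normc (zpath ze0 De t - (sg * M)%:C).
    rewrite normcBC (le_trans _ (normcB_ge _ _))// nz lerB// hZ//.
  rewrite /flux normcM; apply: ler_pM; rewrite ?normc_ge0//.
    rewrite normcM normc_powR /E; apply: ler_pM; rewrite ?normc_ge0 ?powR_ge0//.
      by rewrite normc_cexp ler_expR Re_realM ler_wpM2l// hP.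
    rewrite !powRN lef_pV2 ?posrE ?powR_gt0//; apply: ge0_ler_powR; rewrite ?nnegrE ?(ltW be0) ?(ltW rho0) ?(ltW M0)//.
    by rewrite lerDl.
  rewrite normcV lef_pV2 ?posrE ?subr_gt0//.
  by rewrite (lt_le_trans _ hw)// subr_gt0.
have near_big : \forall N \near \oo, Z < rho + N.+1%:R.
  near=> N; rewrite -ltrBlDl (le_lt_trans (ler_norm _))//.
  have /andP[_ h] := truncn_itv (normr_ge0 (Z - rho)).
  rewrite (lt_le_trans h)// ler_nat ltnS.
  by near: N; exists (Num.truncn `|Z - rho|).
apply: (@ccvg_squeeze_near _ _ _ e).
  near=> N; rewrite subr0 /e -mulrA; apply: (complex_mean_value (df := dconserved N)) => t t01.
    exact: cderiv_conserved.
  rewrite dconservedE// normcM -mulrA ler_wpM2l ?normc_ge0//.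
  have ZN : Z < rho + N.+1%:R by near: N.
  have one sg al : `|sg| = 1 ->
      normc (al%:C * (remainder sg N t - flux sg be ze0 De t (rho + N.+1%:R))) <= `|al| * (E * a N).
    move=> sg1; rewrite normc_realM ler_wpM2l// /a mulrDr (le_trans (normcD _ _))// normcN.
    by apply: lerD; [exact: rem_le|exact: flux_le].
  rewrite (le_trans (normcD _ _))// -mulrA mulrDl; apply: lerD; apply: one.
    by rewrite normr1.
  by rewrite normrN1.
apply: cvgn0Z; apply: cvgn0D.
  have -> : (fun N => (rho / r) ^+ N * (r - rho)^-1) = (fun N => (r - rho)^-1 * (rho / r) ^+ N).
    by apply/funext => N; rewrite mulrC.
  apply: cvgn0Z; apply: cvg_expr; rewrite ger0_norm ?divr_ge0 ?(ltW rho0) ?(ltW r0)//.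
  by rewrite ltr_pdivrMr ?mul1r.
have pos : \forall N \near \oo, 0 < rho + N.+1%:R - Z by near=> N; rewrite subr_gt0; near: N.
apply: (gtr0_cvgV0 pos).2.
apply/cvgryPge => A; near=> N.
rewrite lerBrDr -lerBlDl (le_trans (ler_norm _))//.
have /andP[_ /ltW h] := truncn_itv (normr_ge0 (A + Z - rho)).
rewrite (le_trans h)// ler_nat ltnS.
by near: N; exists (Num.truncn `|A + Z - rho|).
Unshelve. all: end_near. Qed.

End conservation.

(** * Integrals over the two outer half-lines *)

Section outside_integrals.
Variable R : realType.
Local Notation leb := (@lebesgue_measure R).
Variable rho : R.
Hypothesis rho0 : 0 < rho.
Local Notation D := [set x : R | rho <= `|x|].

(** The common majorant of the outer integrals: the density and the resolvent each contribute one
    factor 1 / |x|. *)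
Lemma integrable_inv_sqr : leb.-integrable D (EFin \o (fun x : R => x ^- 2)).
Proof.
have c2 (x : R) : x != 0 -> {for x, continuous (fun x : R => x ^- 2)}.
  by move=> x0; apply: cvgV; [rewrite expf_neq0|exact: exprn_continuous].
have I1 : (\int[leb]_(x in `[rho, +oo[) (x ^- 2)%:E = (rho^-1)%:E)%E.
  rewrite (@ge0_continuous_FTC2y _ (fun x => x ^- 2) (fun x => - x^-1) rho 0).
  - by rewrite sub0e -EFinN opprK.
  - by move=> x xr; rewrite invr_ge0 sqr_ge0.
  - apply: continuous_in_subspaceT => x /set_mem /=; rewrite in_itv /= andbT => xr.
    by apply: c2; rewrite gt_eqF// (lt_le_trans rho0).
  - rewrite -oppr0; apply: cvgN; apply: (gtr0_cvgV0 _).2; last exact: cvg_id.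
    by near=> x; near: x; exact: nbhs_pinfty_gt.
  - by move=> x xr; apply: derivableN; apply: derivableV => //; rewrite gt_eqF// (lt_trans rho0).
  - apply: cvgN; apply: cvg_at_right_filter; apply: cvgV; [by rewrite gt_eqF|exact: cvg_id].
  - move=> x; rewrite in_itv /= andbT => xr; have x0 : x != 0 by rewrite gt_eqF// (lt_trans rho0).
    rewrite derive1E deriveN; last exact: derivableV.
    by rewrite deriveV// derive_id -[_ *: 1]/(_ * 1) mulr1 opprK.
have I2 : (\int[leb]_(x in `]-oo, (- rho)%R]) (x ^- 2)%:E = (rho^-1)%:E)%E.
  rewrite ge0_integration_by_substitutionNy.
  - rewrite -I1; apply: eq_integral => x _ /=; by rewrite sqrrN.
  - apply: continuous_in_subspaceT => x /set_mem /=; rewrite in_itv /= => xr.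
    by apply: c2; rewrite lt_eqF// (le_lt_trans xr)// oppr_lt0.
  - by move=> x _; rewrite invr_ge0 sqr_ge0.
have DE : D = (`]-oo, - rho] `|` `[rho, +oo[)%classic.
  apply/seteqP; split => x /=; rewrite !in_itv /= andbT ler_normr [rho <= - x]lerNr.
    by move=> /orP[h|h]; [right|left].
  by move=> [->|->]; rewrite ?orbT.
have mf : measurable_fun D (fun x : R => x ^- 2).
  apply: subspace_continuous_measurable_fun; first exact: measurable_outside.
  apply: continuous_in_subspaceT => x /set_mem /= xr.
  by apply: c2; rewrite -normr_gt0 (lt_le_trans rho0).
apply/integrableP; split; first exact/measurable_EFinP.
under eq_integral do rewrite /= ger0_norm ?invr_ge0 ?sqr_ge0//.
rewrite DE ge0_integral_setU//=.
- by rewrite I1 I2 ltry.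
- by rewrite -DE; exact/measurable_EFinP.
- by move=> x _; rewrite lee_fin invr_ge0 sqr_ge0.
apply/disj_setPS => x [] /=; rewrite !in_itv /= andbT => h1 h2.
by move: rho0 (le_trans h2 h1); lra.
Unshelve. all: end_near. Qed.

Lemma cint_oppr (F : R -> R[i]) (a b : R) : a <= b ->
  (forall x, a <= x <= b -> exists l, cderiv F (- x) l) ->
  cint leb `[- b, - a] F = cint leb `[a, b] (fun x => F (- x)).
Proof.
move=> ab hF; have hc x : - b <= x <= - a -> exists l, cderiv F x l.
  by move=> /andP[bx xa]; have := hF (- x); rewrite opprK; apply; rewrite lerNr xa lerNl.
apply: complex_ext; rewrite ?Re_cint ?Im_cint /Rintegral; congr fine.
  apply: integration_by_substitution_oppr => //.
  by apply: continuous_in_subspaceT => x /set_mem /=; rewrite in_itv => /hc[l /cderiv_continuous[]].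
apply: integration_by_substitution_oppr => //.
by apply: continuous_in_subspaceT => x /set_mem /=; rewrite in_itv => /hc[l /cderiv_continuous[]].
Qed.

Lemma measurable_derivable (F : R -> R[i]) (A : set (measurableTypeR R)) : measurable A ->
  (forall x, A x -> exists l, cderiv F x l) ->
  measurable_fun A (fun x : R => complex.Re (F x)) /\ measurable_fun A (fun x : R => complex.Im (F x)).
Proof.
move=> mA hF; split; apply: subspace_continuous_measurable_fun => //;
  by apply: continuous_in_subspaceT => x /set_mem /hF[l /cderiv_continuous[]].
Qed.

Lemma cint_restrict (A E : set (measurableTypeR R)) (F : R -> R[i]) : E `<=` A ->
  cint leb A (fun x => if x \in E then F x else 0) = cint leb E F.
Proof.
move=> EA; have -> : E = A `&` E by rewrite setIidr.
rewrite /cint !Rintegral_mkcondr; congr (_ +i* _); apply: eq_Rintegral => x xA; rewrite patchE;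
  rewrite in_setI xA /=; by case: ifP.
Qed.

(** Exhausts the region by pairs of symmetric segments and reflects the left one, which matches the
    truncation used in [conserved]. *)
Lemma cint_outside_ccvg (F : R -> R[i]) (K : R) :
  (forall x, D x -> exists l, cderiv F x l) ->
  (forall x, D x -> normc (F x) <= K * x ^- 2) ->
  cintegrable leb D F /\
  ccvg (fun N => cint leb `[rho, rho + N.+1%:R] F + cint leb `[rho, rho + N.+1%:R] (fun x => F (- x)))
    (cint leb D F).
Proof.
move=> dF bF; have mD := @measurable_outside R rho.
have [mr mi] := measurable_derivable mD dF.
pose E N : set (measurableTypeR R) := (`[(- (rho + N.+1%:R))%R, (- rho)%R] `|` `[rho, (rho + N.+1%:R)%R])%classic.
have mE N : measurable (E N) by apply: measurableU; exact: measurable_itv.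
have ED N : E N `<=` D.
  move=> x [|] /=; rewrite in_itv /= ler_normr => /andP[h1 h2]; last by rewrite h1.
  by rewrite [rho <= - x]lerNr h2 orbT.
pose F_ N x := if x \in E N then F x else 0.
have FN N x : x \in E N -> F_ N x = F x by rewrite /F_ => ->.
have [|N|N|x Dx||N x Dx|iF cF] := @cint_dct _ _ R leb D F_ F (fun x => K * x ^- 2).
- exact: mD.
- have -> : (fun x => complex.Re (F_ N x)) = (fun x => complex.Re (F x)) \_ (E N).
    by apply/funext => x; rewrite patchE /F_; case: ifP.
  by apply/(measurable_restrict _ (mE N) mD); exact: measurable_funS mr.
- have -> : (fun x => complex.Im (F_ N x)) = (fun x => complex.Im (F x)) \_ (E N).
    by apply/funext => x; rewrite patchE /F_; case: ifP.
  by apply/(measurable_restrict _ (mE N) mD); exact: measurable_funS mi.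
- apply: (@ccvg_near _ (fun=> F x)); last exact: ccvg_cst.
  near=> N; rewrite FN// inE.
  have xN : `|x| <= rho + N.+1%:R.
    have /andP[_ /ltW h] := truncn_itv (normr_ge0 x).
    rewrite (le_trans h)// (@le_trans _ _ N.+1%:R)// ?lerDr ?(ltW rho0)// ler_nat ltnS.
    by near: N; exists (Num.truncn `|x|).
  move: Dx xN; rewrite /= ler_normr ler_norml [rho <= - x]lerNr => /orP[h|h] /andP[h1 h2].
    by right; rewrite /= in_itv /= h h2.
  by left; rewrite /= in_itv /= h h1.
- have -> : EFin \o (fun x : R => K * x ^- 2) = (fun x => K%:E * (x ^- 2)%:E)%E.
    by apply/funext => x /=; rewrite EFinM.
  by apply: integrableZl => //; exact: integrable_inv_sqr.
- rewrite /F_; case: ifP => _; first exact: bF.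
  rewrite normc0; apply: le_trans (bF x Dx); exact: normc_ge0.
split => //; apply: ccvg_near cF; near=> N.
rewrite /F_ (cint_restrict _ (ED N)).
have rN : rho <= rho + N.+1%:R by rewrite lerDl.
have dE x : E N x -> exists l, cderiv F x l by move=> /ED; exact: dF.
have iE : cintegrable leb (E N) F.
  by case: iF => i1 i2; split; [apply: integrableS i1|apply: integrableS i2].
have dj : [disjoint `[(- (rho + N.+1%:R))%R, (- rho)%R]%classic & `[rho, (rho + N.+1%:R)%R]%classic].
  apply/disj_setPS => x [] /=; rewrite !in_itv /= => /andP[_ h1] /andP[h2 _].
  by move: rho0 (le_trans h2 h1); lra.
have -> : cint leb (E N) F = cint leb `[- (rho + N.+1%:R), - rho] F + cint leb `[rho, rho + N.+1%:R] F.
  case: iE => i1 i2; apply: complex_ext; rewrite ?ReD ?ImD !(Re_cint, Im_cint) /E;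
    by rewrite Rintegral_setU//; exact: measurable_itv.
rewrite addrC; congr (_ + _); apply: cint_oppr => // x /andP[h1 h2].
by apply: dF; rewrite /= normrN ler_normr h1.
Unshelve. all: end_near. Qed.

End outside_integrals.

(** * The outer transform of a single power density *)

Lemma cderiv_near (R : realType) (f g : R -> R[i]) (t : R) (l : R[i]) :
  (\near t, f t = g t) -> cderiv f t l -> cderiv g t l.
Proof.
move=> fg [h1 h2]; split.
  by apply: near_eq_is_derive h1; apply: filterS fg => x /= ->.
by apply: near_eq_is_derive h2; apply: filterS fg => x /= ->.
Qed.

(** One has |x| <= |z - x| + |z|, and |z| is at most |z| / |Im z| times |z - x|. Hence the resolvent
    decays like 1 / |x|. *)
Lemma resolvent_bound (R : realType) (z : R[i]) (x : R) : complex.Im z < 0 ->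
  `|x| <= (1 + normc z / - complex.Im z) * normc (z - x%:C).
Proof.
move=> z0; have m0 : 0 < - complex.Im z by rewrite oppr_gt0.
have h1 : `|x| <= normc (z - x%:C) + normc z.
  rewrite -normc_real -(normcN (z - x%:C)); apply: le_trans (normcD _ _).
  by rewrite opprB subrK.
have h2 : - complex.Im z <= normc (z - x%:C).
  by apply: le_trans (ler_norm _) _; rewrite normrN -(Im_sub_real z x) normc_geIm.
apply: (le_trans h1); rewrite mulrDl mul1r lerD2l.
by rewrite -mulrA ler_peMr ?normc_ge0// ler_pdivlMl// mulr1.
Qed.

Lemma normc_cexp_sub1 (R : realType) (p : R) : normc (1 - cexp (0 +i* p)) <= 2 * `|p|.
Proof.
have h := @complex_mean_value R (fun t => cexp (t%:C * (0 +i* p)))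
  (fun t => (0 +i* p) * cexp (t%:C * (0 +i* p))) `|p|.
rewrite normcBC -cexp0 -[X in cexp X - _]mul1r -[X in _ - cexp X](mul0r (0 +i* p)); apply: h.
  move=> t _; apply: cderiv_cexp.
  have h1 := cderivM (cderiv_real (is_derive_id t 1)) (cderiv_cst (0 +i* p) t).
  by apply: cderiv_eq h1 _; rewrite mulr0 addr0 mul1r.
move=> t _; rewrite normcM normc_cexp Re_realM mulr0 expR0 mulr1.
by apply: le_trans (normc_leRI _) _; rewrite /= normr0 add0r.
Qed.

Section power_density.
Variable R : realType.
Local Notation leb := (@lebesgue_measure R).
Variables (rho be : R) (a : R[i]).
Hypotheses (rho0 : 0 < rho) (be0 : 0 < be).
Local Notation D := [set x : R | rho <= `|x|].

Definition right_coef : R := complex.Im a.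
Definition left_coef : R := complex.Im (a * cexp (0 +i* ((be + 1) * pi))).
Definition density (x : R) : R := complex.Im (a * inv_pow x (be + 1)).

Lemma density_pos x : 0 < x -> density x = right_coef * x `^ (- (be + 1)).
Proof.
move=> x0; rewrite /density /inv_pow x0 mulrC Im_realM mulrC; congr (_ * _).
by rewrite -(powR_inv1 (ltW x0)) -powRrM mulN1r.
Qed.

Lemma density_neg x : 0 < x -> density (- x) = left_coef * x `^ (- (be + 1)).
Proof.
move=> x0; rewrite /density /inv_pow oppr_gt0 ltNge (ltW x0) /= mulrA mulrC Im_realM mulrC.
by rewrite normrN gtr0_norm.
Qed.

(** Only one power of |x| is kept, and |x|^(-be) is replaced by its largest value rho^(-be). The
    decay rate is then the same for all exponents. *)
Lemma density_bound x : D x -> `|density x| <= normc a * rho `^ (- be) * `|x|^-1.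
Proof.
move=> Dx; have x0 : 0 < `|x| by exact: lt_le_trans Dx.
apply: le_trans (normc_geIm _) _; rewrite normcM normc_inv_pow -?normr_gt0// -mulrA ler_wpM2l ?normc_ge0//.
rewrite opprD powRD; last by rewrite (gt_eqF x0) implybT.
rewrite powR_inv1 ?(ltW x0)// ler_wpM2r ?invr_ge0 ?(ltW x0)//.
by rewrite !powRN lef_pV2 ?posrE ?powR_gt0//; apply: ge0_ler_powR; rewrite ?nnegrE ?(ltW be0) ?(ltW rho0) ?(ltW x0).
Qed.

Definition coef_sum (n : nat) : R := right_coef + (-1) ^+ n * left_coef.

(** The phases on the two half-lines differ by e^(i (be + 1) pi) = (-1)^(n+1) e^(i (be - n) pi), so
    the sum is Im (a (1 - e^(i (be - n) pi))). Its first-order zero at be = n compensates the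
    denominator of [kappa], and at be = n itself no logarithm arises. *)
Lemma coef_sum_bound n : `|coef_sum n| <= normc a * (2 * pi) * `|n%:R - be|.
Proof.
have -> : coef_sum n = complex.Im (a * (1 - cexp (0 +i* ((be - n%:R) * pi)))).
  have E : cexp (0 +i* ((be + 1) * pi)) = (-1) ^+ n.+1 * cexp (0 +i* ((be - n%:R) * pi)).
    have cpi : cexp (0 +i* pi : R[i]) = -1.
      by apply: complex_ext; rewrite ?Re_cexp ?Im_cexp /= expR0 mul1r ?cospi ?sinpi ?oppr0.
    rewrite -cpi -cexpMn -cexpD; congr cexp; apply: complex_ext.
      by rewrite ReD ReM /= -(rmorph_nat (real_complex R)) /= !mulr0 mul0r subr0 addr0.
    by rewrite ImD ImM -(rmorph_nat (real_complex R)) /= mul0r addr0 -natr1; ring.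
  rewrite /coef_sum /right_coef /left_coef E.
  have -> : a * ((-1) ^+ n.+1 * cexp (0 +i* ((be - n%:R) * pi))) =
     ((-1) ^+ n.+1)%:C * (a * cexp (0 +i* ((be - n%:R) * pi))).
    by rewrite rmorphXn rmorphN rmorph1; ring.
  rewrite Im_realM mulrA exprS mulN1r mulrN -expr2 sqrr_sign mulN1r.
  by rewrite mulrBr mulr1 ImD ImN.
apply: le_trans (normc_geIm _) _; rewrite normcM -mulrA -mulrA ler_wpM2l ?normc_ge0//.
apply: le_trans (normc_cexp_sub1 _) _; rewrite normrM (ger0_norm (pi_ge0 R)) distrC.
by rewrite ler_wpM2l// mulrC.
Qed.

Lemma coef_sum_int n : n%:R = be -> coef_sum n = 0.
Proof.
move=> nb; apply/eqP; rewrite -normr_le0; apply: le_trans (coef_sum_bound n) _.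
by rewrite nb subrr normr0 mulr0.
Qed.

Local Notation kap := (kappa be right_coef left_coef).

Lemma kappa_bound n : `|kap n| <= normc a * (2 * pi).
Proof.
rewrite /kappa normrM normfV; have [nb|nb] := eqVneq n%:R be.
  by rewrite nb subrr normr0 invr0 mulr0 mulr_ge0 ?normc_ge0// mulr_ge0 ?pi_ge0.
by rewrite ler_pdivrMr ?normr_gt0 ?subr_eq0// coef_sum_bound.
Qed.

Definition stieltjes (z : R[i]) : R[i] :=
  cint leb D (fun x => (density x)%:C * (z - x%:C)^-1).

Definition half_line (sg : R) (N : nat) (z : R[i]) : R[i] :=
  cint leb `[rho, rho + N.+1%:R] (fun x => (x `^ (- (be + 1)))%:C * (z - (sg * x)%:C)^-1).

Let cderiv_half sg z x : complex.Im z < 0 -> 0 < x ->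
  exists l, cderiv (fun x => (x `^ (- (be + 1)))%:C * (z - (sg * x)%:C)^-1) x l.
Proof.
move=> z0 x0; eexists; apply: cderivM; first exact: cderiv_powR.
by apply: cderivV; [exact: sub_real_neq0|exact: cderiv_affine].
Qed.

Lemma derivable_density x : x != 0 -> exists l, cderiv (fun y => (density y)%:C) x l.
Proof.
move=> xn0; case: (ltgtP 0 x) xn0 => [x0 _|x0 _|]; last by [].
  eexists; apply: cderiv_near (cderivZ right_coef%:C (cderiv_powR (- (be + 1)) x0)).
  by near=> y; rewrite density_pos ?rmorphM//; near: y; exact: lt_nbhsr.
have nx0 : 0 < - x by rewrite oppr_gt0.
have hneg := @is_derive1_comp _ (fun y => y `^ (- (be + 1))) -%R x _ _
  (is_derive1_powR (- (be + 1)) nx0) (is_deriveNid x 1).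
eexists; apply: cderiv_near (cderivZ left_coef%:C (cderiv_real hneg)).
near=> y; rewrite -{2}(opprK y) density_neg ?rmorphM// oppr_gt0.
by near: y; exact: lt_nbhsl.
Unshelve. all: end_near. Qed.

Let cderiv_stieltjes z x : complex.Im z < 0 -> D x ->
  exists l, cderiv (fun x => (density x)%:C * (z - x%:C)^-1) x l.
Proof.
move=> z0 Dx; have xn0 : x != 0 by rewrite -normr_gt0 (lt_le_trans rho0).
have haff : cderiv (fun y => z - y%:C) x (- 1%:C).
  by apply: (cderiv_ext _ (cderiv_affine z 1 x)) => y; rewrite mul1r.
have hinv := cderivV (sub_real_neq0 x z0) haff.
have [l hd] := derivable_density xn0.
by eexists; exact: cderivM hd hinv.
Qed.

Lemma stieltjes_bound z x : complex.Im z < 0 -> D x ->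
  normc ((density x)%:C * (z - x%:C)^-1) <=
    normc a * rho `^ (- be) * (1 + normc z / - complex.Im z) * x ^- 2.
Proof.
move=> z0 Dx; have x0 : 0 < `|x| by exact: lt_le_trans Dx.
have hr := resolvent_bound x z0.
have w0 : 0 < normc (z - x%:C) by rewrite normc_gt0 sub_real_neq0.
rewrite normc_realM normcV -[x ^+ 2]real_normK ?num_real// expr2 invfM mulrACA.
apply: ler_pM; rewrite ?invr_ge0 ?(ltW w0)//; first exact: density_bound.
by rewrite -ler_pdivrMr ?invr_gt0// invrK -ler_pdivlMl ?invr_gt0// invrK mulrC.
Qed.

Lemma stieltjes_ccvg z : complex.Im z < 0 ->
  cintegrable leb D (fun x => (density x)%:C * (z - x%:C)^-1) /\
  ccvg (fun N => right_coef%:C * half_line 1 N z + left_coef%:C * half_line (-1) N z) (stieltjes z).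
Proof.
move=> z0; have [i1 c1] := cint_outside_ccvg rho0 (fun x => cderiv_stieltjes z0)
  (fun x => stieltjes_bound z0).
split => //; apply: ccvg_near c1; near=> N.
have x0 x : rho <= x <= rho + N.+1%:R -> 0 < x by move=> /andP[/(lt_le_trans rho0)].
have mI : measurable (`[rho, rho + N.+1%:R]%classic : set (measurableTypeR R)) by exact: measurable_itv.
rewrite /half_line -!cintZ//;
  try by apply: cintegrable_derivable => x /x0; exact: cderiv_half.
congr (_ + _); apply: eq_cint => x /=; rewrite in_itv => /x0 xp; rewrite mulrA.
  by rewrite density_pos// mul1r rmorphM.
by rewrite density_neg// mulN1r rmorphM.
Unshelve. all: end_near. Qed.

End power_density.

(** * Segments in the logarithmic strip *)

Section log_segment.
Variable R : realType.
Implicit Types (z : R[i]) (q t : R).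

(** Between the ends, convexity of the strip suffices. With [et] the least distance of the ends to
    the boundary and |q1 - q0| <= pi, overshooting by [et / (2 * pi)] moves the point by at most
    [et / 2]. *)
Lemma segment_margin (q0 q1 : R) : - pi < q0 < 0 -> - pi < q1 < 0 ->
  exists2 dl : R, 0 < dl & forall t, - dl <= t <= 1 + dl -> - pi < q0 + t * (q1 - q0) < 0.
Proof.
move=> /andP[a0 b0] /andP[a1 b1]; have p0 := pi_gt0 R.
pose et := Num.min (Num.min (- q0) (- q1)) (Num.min (q0 + pi) (q1 + pi)).
have et0 : 0 < et by rewrite !lt_min !oppr_gt0 b0 b1 /=; apply/andP; split; lra.
have [e1 e2 e3 e4] : [/\ et <= - q0, et <= - q1, et <= q0 + pi & et <= q1 + pi].
  by split; rewrite !ge_min lexx ?orbT.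
exists (et / (2 * pi)); first by rewrite divr_gt0// mulr_gt0.
set dl := et / _; have pn : pi != 0 :> R by rewrite gt_eqF.
have dpi : dl * pi = et / 2 by rewrite /dl invfM mulrA mulfVK.
have dl0 : 0 < dl by rewrite /dl divr_gt0// mulr_gt0.
have dq : `|q1 - q0| <= pi by rewrite ler_norml; apply/andP; split; lra.
have small s : `|s| <= dl -> `|s * (q1 - q0)| <= et / 2.
  by move=> hs; rewrite normrM -dpi ler_pM.
move=> t /andP[t1 t2]; case: (leP t 0) => t0.
  have /small : `|t| <= dl by rewrite ler0_norm; [rewrite lerNl|].
  by rewrite ler_norml => /andP[h1 h2]; apply/andP; split; lra.
case: (leP t 1) => t3.
  have -> : q0 + t * (q1 - q0) = (1 - t) * q0 + t * q1 by ring.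
  have h1 : (1 - t) * q0 + t * q1 <= (1 - t) * - et + t * - et.
    by apply: lerD; apply: ler_wpM2l; lra.
  have h2 : (1 - t) * (et - pi) + t * (et - pi) <= (1 - t) * q0 + t * q1.
    by apply: lerD; apply: ler_wpM2l; lra.
  by apply/andP; split; lra.
have /small : `|t - 1| <= dl by rewrite ger0_norm; lra.
have -> : q0 + t * (q1 - q0) = q1 + (t - 1) * (q1 - q0) by ring.
by rewrite ler_norml => /andP[h1 h2]; apply/andP; split; lra.
Qed.

Lemma segment_lower (p0 p1 lo t : R) : lo <= p0 -> lo <= p1 -> 0 <= t <= 1 ->
  lo <= p0 + t * (p1 - p0).
Proof.
move=> h0 h1 /andP[t0 t1]; have -> : p0 + t * (p1 - p0) = (1 - t) * p0 + t * p1 by ring.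
have -> : lo = (1 - t) * lo + t * lo by ring.
by apply: lerD; apply: ler_wpM2l => //; rewrite subr_ge0.
Qed.

End log_segment.

(** * The invariant of one power and its expansion *)

Section laurent_part.
Variables (R : realType) (S : set R) (c : R).
Local Notation leb := (@lebesgue_measure R).
Hypothesis S_ge0 : S `<=` [set x | 0 <= x].
Hypothesis S1 : condition_S1 S.
Hypothesis S2 : condition_S2 S c.
Hypothesis c0 : 0 < c.

Let S_0 : S 0. Proof. exact: (S1 0). Qed.

(** Extension by 0 of a sequence to real exponents. By (S1) every natural number is an index, so a
    Laurent series in z^(-n-1) becomes a series over [S]. *)
Definition on_nat (F : nat -> R[i]) (g : R) : R[i] :=
  if g == (Num.truncn g)%:R then F (Num.truncn g) else 0.

Lemma psum_on_nat (F : nat -> R[i]) N : psum S (on_nat F) N = \sum_(n < N) F n.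
Proof.
rewrite /psum /on_nat -big_mkcond -big_filter.
transitivity (\sum_(g <- [seq n%:R | n <- iota 0 N]) F (Num.truncn (g : R))).
  apply: perm_big; apply: uniq_perm.
  - by rewrite filter_uniq// (uniq_below S2).
  - by rewrite map_inj_uniq ?iota_uniq//; exact: mulrIn (oner_neq0 R).
  move=> g; rewrite mem_filter (mem_below S_ge0 S2); apply/idP/mapP => [/and3P[/eqP gE _ gN]|[n]].
    exists (Num.truncn g) => //; rewrite mem_iota /= add0n -(ltr_nat R).
    by rewrite -gE.
  rewrite mem_iota /= add0n => nN ->; rewrite natrK; apply/and3P; split.
  - exact/eqP.
  - by apply/asboolP; exact: S1.
  - by rewrite ltr_nat.
rewrite big_map -[RHS](big_mkord predT F) /index_iota subn0.
by apply: eq_bigr => n _; rewrite natrK.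
Qed.

Lemma on_nat_cpow (F : nat -> R[i]) z g : z != 0 ->
  on_nat (fun n => F n * z ^- n.+1) g = on_nat F g / cpow z (g + 1).
Proof.
move=> z0; rewrite /on_nat; case: eqP => [gE|_]; last by rewrite mul0r.
suff -> : cpow z (g + 1) = z ^+ (Num.truncn g).+1 by [].
by rewrite -cpow_nat// -natr1 -gE.
Qed.

Lemma normc_on_nat (F : nat -> R[i]) (K x : R) g : 0 <= K -> 0 <= x -> S g ->
  (forall n, normc (F n) <= K * x ^+ n) -> normc (on_nat F g) <= K * x `^ g.
Proof.
move=> K0 x0 Sg hF; rewrite /on_nat; case: eqP => [gE|_].
  suff -> : x `^ g = x ^+ Num.truncn g by exact: hF.
  by rewrite -powR_mulrn// -gE.
by rewrite normc0 mulr_ge0 ?powR_ge0.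
Qed.

Variable rho : R.
Hypothesis rho0 : 0 < rho.

Section one_power.
Variables (be : R) (a : R[i]).
Hypothesis be0 : 0 < be.

Definition laurent_coef (n : nat) : R :=
  kappa be (right_coef a) (left_coef be a) n * rho `^ (n%:R - be).

Lemma laurent_coef_bound n :
  `|laurent_coef n| <= normc a * (2 * pi) * rho `^ (- be) * rho ^+ n.
Proof.
rewrite /laurent_coef normrM (ger0_norm (powR_ge0 _ _)) -[leRHS]mulrA.
apply: ler_pM; rewrite ?powR_ge0//; first exact: kappa_bound.
rewrite addrC powRD ?powR_mulrn ?(ltW rho0)//.
by rewrite (gt_eqF rho0) implybT.
Qed.

Let K : R := normc a * (2 * pi) * rho `^ (- be).

Let K0 : 0 <= K.
Proof. by rewrite !mulr_ge0 ?normc_ge0 ?powR_ge0 ?pi_ge0. Qed.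

Definition laurent_term (z : R[i]) (g : R) : R[i] :=
  on_nat (fun n => (laurent_coef n)%:C) g / cpow z (g + 1).

Lemma laurent_term_bound z g : z != 0 -> S g ->
  normc (laurent_term z g) <= K / normc z * (rho / normc z) `^ g.
Proof.
move=> z0 Sg; have n0 : 0 < normc z by rewrite normc_gt0.
rewrite /laurent_term cpowD cpow1// invfM mulrA normcM normcV mulrAC ler_wpM2r ?invr_ge0 ?(ltW n0)//.
apply: (@normc_term _ (on_nat (fun n => (laurent_coef n)%:C))) => //.
apply: normc_on_nat => // [|n]; first exact: ltW.
by rewrite normc_real laurent_coef_bound.
Qed.

Lemma psum_laurent z N : z != 0 ->
  psum S (laurent_term z) N = \sum_(n < N) (laurent_coef n)%:C * z ^- n.+1.
Proof.
move=> z0; rewrite -(psum_on_nat (fun n => (laurent_coef n)%:C * z ^- n.+1)).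
by apply: eq_bigr => g _; rewrite on_nat_cpow.
Qed.

Lemma laurent_ccvg z : c * rho < normc z ->
  exists l, ccvg (psum S (laurent_term z)) l.
Proof.
move=> hz; have [q0 q1 cq] := ratio_small S_0 S2 c0 rho0 hz.
have z0 : z != 0 by rewrite -normc_gt0 (lt_trans _ hz)// mulr_gt0.
apply: (psum_ccvg S_ge0 S2 (ltW c0) q0 q1 cq (M := K / normc z)).
  by move=> b Sb; exact: laurent_term_bound.
by rewrite mulr_ge0// invr_ge0 normc_ge0.
Qed.

(** The default 0 is taken only where the series has no limit, hence never for |z| > c rho. *)
Definition laurent_sum (z : R[i]) : R[i] := xget 0 [set l | ccvg (psum S (laurent_term z)) l].

Lemma laurent_sumP z : c * rho < normc z -> ccvg (psum S (laurent_term z)) (laurent_sum z).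
Proof.
by move=> /laurent_ccvg[l hl]; rewrite /laurent_sum; case: xgetP => // /(_ l).
Qed.

(** The limit in [N] of [conserved] at a parameter where the path has reached [clog z]; it depends
    on the point alone. *)
Definition invariant (z : R[i]) : R[i] :=
  cpow z (be + 1) * (stieltjes rho be a z + laurent_sum z).

Let conservedE ze0 De t z N : path ze0 De t = clog z -> complex.Im z < 0 ->
  conserved rho be (right_coef a) (left_coef be a) ze0 De N t =
  cpow z (be + 1) * ((right_coef a)%:C * half_line rho be 1 N z +
    (left_coef be a)%:C * half_line rho be (-1) N z + psum S (laurent_term z) N).
Proof.
move=> pE z0; have zn := Im_lt0_neq0 z0.
have zE : zpath ze0 De t = z by rewrite /zpath pE clogK.
have hk sg : cint leb `[rho, rho + N.+1%:R] (kern sg be ze0 De t) =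
    cpow z (be + 1) * half_line rho be sg N z.
  rewrite /half_line -cintZ.
  - by apply: eq_cint => x _; rewrite /kern zE pE -mulrA.
  - exact: measurable_itv.
  apply: cintegrable_derivable => x /andP[rx _]; eexists; apply: cderivM.
    exact: cderiv_powR (lt_le_trans rho0 rx).
  by apply: cderivV; [exact: sub_real_neq0|exact: cderiv_affine].
rewrite /conserved !hk psum_laurent// !mulrDr mulr_sumr; congr (_ + _ + _).
- by rewrite mulrCA.
- by rewrite mulrCA.
apply: eq_bigr => n _; rewrite [RHS]mulrCA; congr (_ * _); rewrite pE.
have -> : z ^- n.+1 = cexp (- (n.+1%:R * clog z)) by rewrite cexpN cexpMn clogK.
rewrite cpowE -cexpD; congr cexp; rewrite -mulrBl; congr (_ * _).
by rewrite !rmorphD rmorphN !rmorph_nat rmorph1 -natr1; ring.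
Qed.

(** The two points are joined by a segment in the logarithmic coordinate. It keeps the argument in
    (-pi, 0) and the modulus at least the smaller of the two, whereas a straight segment between
    them could enter the disc of radius rho. *)
Lemma invariant_const z0 z1 : complex.Im z0 < 0 -> complex.Im z1 < 0 ->
  c * rho < normc z0 -> c * rho < normc z1 -> invariant z0 = invariant z1.
Proof.
move=> i0 i1 h0 h1; pose ze0 := clog z0; pose De := clog z1 - clog z0.
have c1 := condition_S2_ge1 S2 S_0 (ltW c0).
have rc : rho <= c * rho by rewrite ler_peMl// ltW.
pose r := Num.min (normc z0) (normc z1).
have r_rho : rho < r by rewrite lt_min !(le_lt_trans rc).
have r0 : 0 < r by exact: lt_trans r_rho.
have [dl dl0 hdl] := segment_margin (Im_clog_lt0 i0) (Im_clog_lt0 i1).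
have zIm t : - dl <= t <= 1 + dl -> complex.Im (zpath ze0 De t) < 0.
  move=> ht; rewrite /zpath Im_cexp pmulr_rlt0 ?expR_gt0//.
  rewrite /path /ze0 /De ImD Im_realM ImD ImN.
  have /andP[p0 p1] := hdl t ht.
  rewrite -oppr_gt0 -sinN; apply: sin_gt0_pi; rewrite oppr_gt0 p1 /=.
  by rewrite ltrNl.
have zr t : 0 <= t <= 1 -> r <= normc (zpath ze0 De t).
  move=> ht; rewrite /zpath normc_cexp -[leLHS]lnK ?posrE// ler_expR.
  rewrite /path /ze0 /De ReD Re_realM ReD ReN !Re_clog.
  apply: segment_lower => //; rewrite ler_ln ?posrE// ?(lt_le_trans r0) ?ge_min ?lexx ?orbT//.
have p0 : path ze0 De 0 = clog z0 by rewrite /path mul0r addr0.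
have p1 : path ze0 De 1 = clog z1 by rewrite /path mul1r /De addrC subrK.
have al (n : nat) : n%:R = be -> right_coef a + (-1) ^+ n * left_coef be a = 0.
  exact: coef_sum_int.
have lim z : complex.Im z < 0 -> c * rho < normc z ->
  ccvg (fun N => cpow z (be + 1) * ((right_coef a)%:C * half_line rho be 1 N z +
    (left_coef be a)%:C * half_line rho be (-1) N z + psum S (laurent_term z) N)) (invariant z).
  move=> iz hz; apply: ccvgZ; apply: ccvgD; last exact: laurent_sumP.
  by have [] := stieltjes_ccvg a rho0 be0 iz.
have h := conserved_ccvg rho0 be0 al dl0 r_rho zIm zr.
apply/eqP; rewrite eq_sym -subr_eq0; apply/eqP; apply: ccvg_unique h.
apply: ccvgB.
  by apply: ccvg_near (lim z1 i1 h1); near=> N; rewrite (conservedE N p1 i1).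
by apply: ccvg_near (lim z0 i0 h0); near=> N; rewrite (conservedE N p0 i0).
Unshelve. all: end_near. Qed.

End one_power.

(* Here [- Im z = |z|] and [c * rho / |z| = 1 / 2], so that the bound on the
   invariant is uniform in the exponent. *)
Let base : R[i] := 0 -i* (2 * c * rho).

(** Both summands carry the factor rho^(-be), which is compensated by |base|^be = (2c)^be rho^be.
    Only the growth (2c)^be remains, and it can be absorbed in the base of a geometric bound. *)
Lemma invariant_bound : exists2 K, 0 <= K & forall be a, 0 < be ->
  normc (invariant be a base) <= K * (normc a * (2 * c) `^ be).
Proof.
pose I := \int[leb]_(x in [set x : R | rho <= `|x|]) (x ^- 2).
have cr : 0 < 2 * c * rho by rewrite !mulr_gt0.
have nb : normc base = 2 * c * rho.
  by rewrite /base /= expr0n /= add0r sqrrN sqrtr_sqr gtr0_norm.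
have ib : complex.Im base < 0 by rewrite /= oppr_lt0.
have hb : c * rho < normc base by rewrite nb -mulrA ltr_pMl ?mulr_gt0// ltr1n.
have b0 := Im_lt0_neq0 ib.
have [q0 q1 cq] := ratio_small S_0 S2 c0 rho0 hb.
have I0 : 0 <= I by apply: Rintegral_ge0 => x _; rewrite invr_ge0 sqr_ge0.
pose Q := c * (1 - c * (rho / normc base))^-1.
have Q0 : 0 <= Q by rewrite mulr_ge0 ?invr_ge0 ?subr_ge0 ?(ltW c0) ?(ltW cq).
(* One factor 2 is that of [normc_cint_le], the other is 1 + |z| / |Im z| at the base point; [Q]
   sums the geometric bound over [S]. *)
pose K1 := 2 * (2 * I) + (2 * pi) / normc base * Q.
exists (normc base * K1).
  apply: mulr_ge0; first exact: normc_ge0.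
  apply: addr_ge0; apply: mulr_ge0 => //; first exact: mulr_ge0.
  by rewrite divr_ge0 ?normc_ge0// mulr_ge0 ?pi_ge0.
move=> be a be0.
have hS : normc (stieltjes rho be a base) <= normc a * rho `^ (- be) * (2 * (2 * I)).
  have [i1 _] := stieltjes_ccvg a rho0 be0 ib.
  have mD := @measurable_outside R rho.
  have two : 1 + normc base / - complex.Im base = 2.
    by rewrite nb /= opprK divff ?gt_eqF.
  have iI := integrable_inv_sqr rho0.
  have h := @normc_cint_le _ _ R leb _ _ (fun x : R => normc a * rho `^ (- be) * 2 * x ^- 2) mD i1.
  apply: (le_trans (h _ _)).
  - have -> : EFin \o (fun x : R => normc a * rho `^ (- be) * 2 * x ^- 2) =
      (fun x => (normc a * rho `^ (- be) * 2)%:E * (x ^- 2)%:E)%E.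
      by apply/funext => x /=; rewrite EFinM.
    exact: integrableZl.
  - by move=> x Dx; have := stieltjes_bound a rho0 be0 ib Dx; rewrite two.
  rewrite RintegralZl// -/I le_eqVlt; apply/orP; left; apply/eqP; ring.
have hE : normc (laurent_sum be a base) <= normc a * rho `^ (- be) * ((2 * pi) / normc base * Q).
  apply: ccvg_le (laurent_sumP be a hb) => N.
  have h := psum_bound S_ge0 S2 (ltW c0) q0 q1 cq (f := laurent_term be a base)
    (M := normc a * (2 * pi) * rho `^ (- be) / normc base) _ _ N.
  apply: (le_trans (h _ _)).
  - by move=> b Sb; exact: laurent_term_bound.
  - by rewrite !mulr_ge0 ?invr_ge0 ?normc_ge0 ?powR_ge0 ?pi_ge0.
  by rewrite -/Q le_eqVlt; apply/orP; left; apply/eqP; ring.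
have nb0 : 0 < normc base by rewrite nb.
rewrite /invariant normcM normc_cpow//.
have -> : normc base `^ (be + 1) = (2 * c) `^ be * rho `^ be * normc base.
  rewrite powRD; last by rewrite (gt_eqF nb0) implybT.
  by rewrite powRr1 ?normc_ge0// {1}nb powRM ?mulr_ge0 ?(ltW rho0) ?(ltW c0).
have h : normc (stieltjes rho be a base + laurent_sum be a base) <= normc a * rho `^ (- be) * K1.
  by apply: le_trans (normcD _ _) _; rewrite /K1 mulrDr lerD.
apply: (@le_trans _ _ ((2 * c) `^ be * rho `^ be * normc base * (normc a * rho `^ (- be) * K1))).
  by rewrite ler_wpM2l// !mulr_ge0 ?powR_ge0 ?normc_ge0.
rewrite powRN; have rb : rho `^ be != 0 by rewrite gt_eqF// powR_gt0.
by rewrite le_eqVlt; apply/orP; left; apply/eqP; field.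
Qed.

(** Constancy of the invariant, solved for the outer integral: one term at exponent [be] and the
    Laurent correction at the natural exponents. *)
Lemma stieltjes_expansion be a z : 0 < be -> complex.Im z < 0 -> c * rho < normc z ->
  stieltjes rho be a z = invariant be a base / cpow z (be + 1) - laurent_sum be a z.
Proof.
move=> be0 iz hz.
have cr : 0 < 2 * c * rho by rewrite !mulr_gt0.
have nb : normc base = 2 * c * rho.
  by rewrite /base /= expr0n /= add0r sqrrN sqrtr_sqr gtr0_norm.
have ib : complex.Im base < 0 by rewrite /= oppr_lt0.
have hb : c * rho < normc base by rewrite nb -mulrA ltr_pMl ?mulr_gt0// ltr1n.
rewrite (invariant_const a be0 ib iz hb hz) /invariant [_ * (_ + _)]mulrC mulfK ?cpow_neq0//.
by rewrite addrK.
Qed.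

End laurent_part.

(** * Integration against the measure through its density *)

Section density_integral.
Variables (R : realType) (mu : probability (measurableTypeR R) R).
Local Notation leb := (@lebesgue_measure R).
Variables (D : set (measurableTypeR R)) (f : R -> R).
Hypotheses (mD : measurable D) (mf : measurable_fun D f).
Hypothesis muD : forall B, measurable B -> mu (B `&` D) = (\int[leb]_(x in B `&` D) (f x)%:E)%E.

(** Pointwise [f] carries no sign, so it is not directly the density of a measure. It is identified
    almost everywhere with the Radon-Nikodym derivative of [mu] restricted to [D], both having the
    same integrals over measurable subsets of [D]. *)
Lemma integral_with_density (h : R -> R) (K : R) : measurable_fun D h ->
  (forall x, D x -> `|h x| <= K) ->
  (\int[mu]_(x in D) (h x)%:E = \int[leb]_(x in D) (f x * h x)%:E)%E.
Proof.
move=> mh hK.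
have muoo : (mu D < +oo)%E by rewrite (le_lt_trans (probability_le1 _ _))// ltry.
pose nu : {finite_measure set (measurableTypeR R) -> \bar R} := mfrestr mD muoo.
have nuE B : nu B = mu (B `&` D) by [].
have dom : nu `<< leb.
  apply/null_content_dominatesP => A mA A0.
  rewrite -[LHS]/(mu (A `&` D)) muD//; apply: null_set_integral.
  - exact: measurableI.
  - by apply/measurable_EFinP; apply: measurable_funS mf.
  apply/eqP; rewrite eq_le measure_ge0 andbT -A0; apply: le_measure; rewrite ?inE//.
  exact: measurableI.
have mfE : measurable_fun D (EFin \o f) by exact/measurable_EFinP.
pose g := Radon_Nikodym (charge_of_finite_measure nu) leb.
have gi : leb.-integrable setT g by exact: Radon_Nikodym_integrable.
have gf : ae_eq leb D g (EFin \o f).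
  apply: integral_ae_eq => //; first by apply: (integrableS measurableT).
  move=> E ED mE; rewrite -Radon_Nikodym_integral//.
  by rewrite -[LHS]/(mu (E `&` D)) muD// setIidl.
have ih : nu.-integrable D (EFin \o h).
  apply: measurable_bounded_integrable => //.
    by rewrite -[X in (X < _)%E]/(mu (D `&` D)) setIid.
  exists K; split; first exact: num_real.
  by move=> M KM x Dx /=; rewrite (le_trans (hK _ Dx))// ltW.
rewrite (@eq_measure_integral _ _ R D nu); last by move=> A mA AD; rewrite -[RHS]/(mu (A `&` D)) setIidl.
rewrite -(Radon_Nikodym_change_of_variables dom mD ih).
rewrite (_ : (fun x => (f x * h x)%:E) = fun x => ((h x)%:E * (f x)%:E)%E); last first.
  by apply/funext => x; rewrite mulrC EFinM.
apply: ae_eq_integral => //.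
- apply: emeasurable_funM; first exact/measurable_EFinP.
  by apply: (measurable_funS measurableT) => //; exact: measurable_int gi.
- by apply: emeasurable_funM => //; exact/measurable_EFinP.
- by apply: filterS gf => x /= e Dx; congr (_ * _)%E; exact: e.
Qed.

Lemma cint_with_density (h : R -> R[i]) (K : R) :
  measurable_fun D (fun x => complex.Re (h x)) -> measurable_fun D (fun x => complex.Im (h x)) ->
  (forall x, D x -> normc (h x) <= K) ->
  cint mu D h = cint leb D (fun x => (f x)%:C * h x).
Proof.
move=> mr mi hK; apply: complex_ext; rewrite ?Re_cint ?Im_cint /Rintegral; congr fine.
  rewrite (integral_with_density mr (fun x Dx => le_trans (normc_geRe _) (hK x Dx))).
  by apply: eq_integral => x _; rewrite Re_realM.
rewrite (integral_with_density mi (fun x Dx => le_trans (normc_geIm _) (hK x Dx))).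
by apply: eq_integral => x _; rewrite Im_realM.
Qed.

End density_integral.

(** * Restriction to the positive exponents *)

Section positive_part.
Variables (R : realType) (S : set R) (c : R).
Hypothesis S2 : condition_S2 S c.

Lemma condition_S2_positive : condition_S2 (S `&` [set b | 0 < b]) c.
Proof.
move=> n; have [fS cS] := S2 n.
have sub : S `&` [set b | 0 < b] `&` `[n%:R, n.+1%:R[ `<=` S `&` `[n%:R, n.+1%:R[.
  by move=> x [[? _] ?].
have fT := sub_finite_set sub fS; split => //; apply: le_trans cS.
by rewrite ler_nat; apply: fsubset_leq_card; rewrite -fset_set_sub.
Qed.

Lemma psum_positive (f : R -> R[i]) N : S `<=` [set x | 0 <= x] ->
  psum (S `&` [set b | 0 < b]) f N = psum S (fun b => if 0 < b then f b else 0) N.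
Proof.
move=> S_ge0; rewrite /psum -big_mkcond -big_filter; apply: perm_big; apply: uniq_perm.
- exact: uniq_below condition_S2_positive _.
- by rewrite filter_uniq// (uniq_below S2).
have T_ge0 : S `&` [set b | 0 < b] `<=` [set x | 0 <= x] by move=> x [/S_ge0].
move=> b; rewrite mem_filter (mem_below T_ge0 condition_S2_positive) (mem_below S_ge0 S2).
by rewrite andbA; congr (_ && _); apply/asboolP/andP => [[? ?]|[? /asboolP]]; split => //; exact/asboolP.
Qed.

End positive_part.

Lemma has_sum_complex (R : realType) (S : set R) (f : R -> R) (l : R) :
  has_sum S f l -> has_sum S (fun b => (f b)%:C) l%:C.
Proof.
move=> /has_sumP h; apply/has_sumP => e; rewrite ltcE => /andP[/eqP /= ie re].
have [A AS AB] := h _ re; exists A => // B BS sAB.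
have -> : e = (complex.Re e)%:C by apply: complex_ext.
by rewrite normr_normc ltcR -rmorph_sum -rmorphB normc_real AB.
Qed.

(** * The Cauchy transform and its part near the origin *)

Section prob_integrals.
Variables (R : realType) (mu : probability (measurableTypeR R) R).
Implicit Type z : R[i].

Lemma cintegrable_bounded (D : set (measurableTypeR R)) (h : R -> R[i]) (K : R) : measurable D ->
  measurable_fun D (fun x => complex.Re (h x)) -> measurable_fun D (fun x => complex.Im (h x)) ->
  (forall x, D x -> normc (h x) <= K) -> cintegrable mu D h.
Proof.
move=> mD mr mi hK; split; apply: (@integrable_bounded_prob _ mu _ _ K) => // x Dx.
  exact: le_trans (normc_geRe _) (hK x Dx).
exact: le_trans (normc_geIm _) (hK x Dx).
Qed.

Lemma derivable_resolvent z x : complex.Im z < 0 -> exists l, cderiv (fun x => (z - x%:C)^-1) x l.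
Proof.
move=> z0; have haff : cderiv (fun y => z - y%:C) x (- 1%:C).
  by apply: (cderiv_ext _ (cderiv_affine z 1 x)) => y; rewrite mul1r.
by eexists; exact: cderivV (sub_real_neq0 x z0) haff.
Qed.

Lemma resolvent_le z x : complex.Im z < 0 -> normc (z - x%:C)^-1 <= (- complex.Im z)^-1.
Proof.
move=> z0; have m0 : 0 < - complex.Im z by rewrite oppr_gt0.
have h : - complex.Im z <= normc (z - x%:C).
  by apply: le_trans (ler_norm _) _; rewrite normrN -(Im_sub_real z x) normc_geIm.
by rewrite normcV lef_pV2 ?posrE// (lt_le_trans m0).
Qed.

Lemma cintegrable_resolvent (D : set (measurableTypeR R)) z : measurable D -> complex.Im z < 0 ->
  cintegrable mu D (fun x => (z - x%:C)^-1).
Proof.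
move=> mD z0; have [mr mi] := measurable_derivable mD (fun x _ => derivable_resolvent x z0).
by apply: cintegrable_bounded mr mi (fun x _ => resolvent_le x z0).
Qed.

Lemma cauchy_transform_split (D : set (measurableTypeR R)) z : measurable D -> complex.Im z < 0 ->
  cauchy_transform mu z = cint mu D (fun x => (z - x%:C)^-1) + cint mu (~` D) (fun x => (z - x%:C)^-1).
Proof.
move=> mD z0; have mC := measurableC mD.
have [i1 i2] := cintegrable_resolvent measurableT z0.
have dj : [disjoint D & ~` D] by apply/disj_setPS => x [].
apply: complex_ext; rewrite ?ReD ?ImD ?Re_cint ?Im_cint -Rintegral_setU ?setUv//.
Qed.

Variable rho : R.
Hypothesis rho0 : 0 < rho.
Local Notation I := (~` [set x : R | rho <= `|x|]).

Definition inner_moment (n : nat) : R := \int[mu]_(x in I) x ^+ n.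

Let mI : measurable (I : set (measurableTypeR R)).
Proof. by apply: measurableC; exact: measurable_outside. Qed.

Let I_lt x : I x -> `|x| < rho.
Proof. by move=> /negP; rewrite -ltNge. Qed.

Lemma inner_moment_bound n : `|inner_moment n| <= rho ^+ n.
Proof.
have mx : measurable_fun I (fun x : measurableTypeR R => (x : R) ^+ n).
  by apply: measurable_funX; exact: measurable_id.
have bx x : I x -> `|x ^+ n| <= rho ^+ n.
  by move=> /I_lt xr; rewrite normrX lerXn2r ?nnegrE// ltW.
have ix : mu.-integrable I (EFin \o (fun x : R => x ^+ n)) by exact: integrable_bounded_prob bx.
have ic : mu.-integrable I (EFin \o cst (rho ^+ n)).
  by apply: (@integrable_bounded_prob _ mu _ _ (rho ^+ n)) => // x _; rewrite ger0_norm// exprn_ge0// ltW.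
apply: le_trans (le_normr_Rintegral mI ix) _.
apply: le_trans (le_Rintegral mI (integrable_norm ix) ic bx) _.
rewrite Rintegral_cst// ler_piMr ?exprn_ge0 ?(ltW rho0)//.
have fI : mu I \is a fin_num by rewrite ge0_fin_numE// (le_lt_trans (probability_le1 _ _))// ltry.
by rewrite -lee_fin fineK// probability_le1.
Qed.

(** For |x| < rho < |z| the resolvent is a geometric series in x / z whose partial sums are
    dominated by the constant 1 / (|z| - rho), so it may be integrated term by term. *)
Lemma inner_expansion z : complex.Im z < 0 -> rho < normc z ->
  ccvg (fun N => \sum_(n < N) (inner_moment n)%:C * z ^- n.+1) (cint mu I (fun x => (z - x%:C)^-1)).
Proof.
move=> z0 hz; have zn := Im_lt0_neq0 z0; have n0 : 0 < normc z by rewrite normc_gt0.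
pose F N (x : R) : R[i] := \sum_(n < N) x%:C ^+ n * z ^- n.+1.
have dX (n : nat) (x : R) : exists l, cderiv (fun x : R => (x ^+ n)%:C) x l.
  elim: n => [|n [l hl]]; first by exists 0; exact: (cderiv_cst (1%:C) x).
  eexists; apply: (cderiv_ext _ (cderivM (cderiv_real (is_derive_id x 1)) hl)) => y.
  by rewrite exprS rmorphM.
have mX n := measurable_derivable mI (fun x _ => dX n x).
have iX n : cintegrable mu I (fun x : R => (x ^+ n)%:C).
  have [mr mi] := mX n.
  apply: (cintegrable_bounded (K := rho ^+ n) mI mr mi) => x /I_lt xr.
  by rewrite normc_real normrX lerXn2r ?nnegrE ?(ltW rho0)// ltW.
have Fe N : F N = fun x : R => \sum_(n < N) z ^- n.+1 * (x ^+ n)%:C.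
  by apply/funext => x; apply: eq_bigr => n _; rewrite mulrC rmorphXn.
have iF N : cintegrable mu I (F N).
  by rewrite Fe; apply: cintegrable_sum => // n _; exact: cintegrableZ.
have cF N : cint mu I (F N) = \sum_(n < N) (inner_moment n)%:C * z ^- n.+1.
  rewrite Fe.
  rewrite cint_sum//; last by move=> n _; exact: cintegrableZ.
  apply: eq_bigr => n _; rewrite cintZ// mulrC; congr (_ * _).
  by apply: complex_ext; rewrite ?Re_cint ?Im_cint //= /Rintegral integral0.
have q0 : 0 <= rho / normc z by rewrite divr_ge0// ltW.
have q1 : rho / normc z < 1 by rewrite ltr_pdivrMr// mul1r.
have xq x : I x -> `|x| / normc z <= rho / normc z.
  by move=> /I_lt xr; rewrite ler_pM2r ?invr_gt0// ltW.
have [||x Ix||N x Ix|_ h] := @cint_dct _ _ R mu I F (fun x => (z - x%:C)^-1)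
    (fun=> (normc z)^-1 * (1 - rho / normc z)^-1) mI.
- by move=> N; have [/measurable_int/measurable_EFinP] := iF N.
- by move=> N; have [_ /measurable_int/measurable_EFinP] := iF N.
- have zx := sub_real_neq0 x z0.
  apply: (@ccvg_squeeze _ _ _ (fun N => normc (z - x%:C)^-1 * (rho / normc z) ^+ N)).
    move=> N; rewrite normcBC {1}(geometric_remainder N zn zx) /F addrAC subrr add0r normcM mulrC.
    rewrite ler_wpM2l ?normc_ge0// normcX lerXn2r ?nnegrE ?normc_ge0//.
    by rewrite normcM normcV normc_real xq.
  by apply: cvgn0Z; apply: cvg_expr; rewrite ger0_norm.
- apply: (@integrable_bounded_prob _ mu _ _ ((normc z)^-1 * (1 - rho / normc z)^-1)) => // x _.
  by rewrite ger0_norm// mulr_ge0 ?invr_ge0 ?normc_ge0// subr_ge0 ltW.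
- apply: le_trans (normc_sum _ _ _) _.
  apply: (@le_trans _ _ ((normc z)^-1 * \sum_(0 <= n < N) (rho / normc z) ^+ n)); last first.
    by rewrite ler_wpM2l ?invr_ge0 ?normc_ge0//; have := sum_geo_le 0 N q0 q1; rewrite expr0 mul1r.
  rewrite big_mkord mulr_sumr; apply: ler_sum => n _.
  rewrite normcM normcV !normcX exprS invfM mulrCA ler_wpM2l ?invr_ge0 ?normc_ge0//.
  rewrite normc_real -exprVn -exprMn; apply: lerXn2r; last exact: xq.
    by rewrite nnegrE divr_ge0 ?normr_ge0 ?normc_ge0.
  by rewrite nnegrE.
by apply: ccvg_near h; near=> N; rewrite cF.
Unshelve. all: end_near. Qed.

End prob_integrals.

(** * A density in series form yields a series for the Cauchy transform *)

Section density_to_series.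
Variables (R : realType) (S : set R) (c : R) (mu : probability (measurableTypeR R) R).
Local Notation leb := (@lebesgue_measure R).
Hypothesis S_ge0 : S `<=` [set x | 0 <= x].
Hypothesis S1 : condition_S1 S.
Hypothesis S2 : condition_S2 S c.
Hypothesis c0 : 0 < c.
Local Notation T := (S `&` [set b : R | 0 < b]).

Variables (a : R -> R[i]) (r rho : R) (f : R -> R).
Hypotheses (r0 : 0 < r) (rho0 : 0 < rho) (r_rho : c * r < rho).
Hypothesis a_bound : forall b, S b -> 0 < b -> normc (a b) <= r `^ b.
Local Notation D := [set x : R | rho <= `|x|].
Hypothesis f_series : forall x, D x -> has_sum T (fun b => density b (a b) x) (f x).
Hypothesis f_density : forall B : set (measurableTypeR R), measurable B ->
  mu (B `&` D) = (\int[leb]_(x in B `&` D) (f x)%:E)%E.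

Let S_0 : S 0. Proof. exact: (S1 0). Qed.

Let T_ge0 : T `<=` [set x | 0 <= x]. Proof. by move=> x [/S_ge0]. Qed.
Let T2 : condition_S2 T c. Proof. exact: condition_S2_positive. Qed.

Let mD : measurable (D : set (measurableTypeR R)). Proof. exact: measurable_outside. Qed.

Let q := r / rho.

Let ratio : [/\ 0 < q, q <= 1 & c * q < 1].
Proof. exact: (ratio_small S_0 S2 c0 r0 r_rho). Qed.

Let belowT N b : b \in below T N -> S b /\ 0 < b.
Proof. by rewrite (mem_below T_ge0 T2) => /andP[/asboolP[]]. Qed.

Let Q := c * (1 - c * q)^-1.

Let Q0 : 0 <= Q.
Proof.
have [q0 q1 cq] := ratio.
by rewrite mulr_ge0 ?invr_ge0 ?subr_ge0 ?(ltW c0) ?(ltW cq).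
Qed.

Let weight b : S b -> 0 < b -> normc (a b) * rho `^ (- b) <= q `^ b.
Proof.
move=> Sb b0; rewrite /q powRM ?invr_ge0 ?(ltW r0) ?(ltW rho0)//.
apply: ler_pM; rewrite ?normc_ge0 ?powR_ge0 ?a_bound//.
by rewrite -(powR_inv1 (ltW rho0)) -powRrM mulN1r.
Qed.

(** Uniform in the number of terms; this dominates the outer integrals as well as the Laurent
    coefficients. *)
Let weight_sum N : \sum_(b <- below T N) normc (a b) * rho `^ (- b) <= Q.
Proof.
have [q0 q1 cq] := ratio.
apply: (@le_trans _ _ (\sum_(b <- below T N) q `^ b)).
  by rewrite big_seq [leRHS]big_seq ler_sum// => b /belowT[Sb b0]; exact: weight.
by have := slices_bound T2 0 N q0 q1 (ltW c0) cq; rewrite expr0 mul1r.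
Qed.

Let dens_ccvg x : D x -> ccvg (psum T (fun b => (density b (a b) x)%:C)) (f x)%:C.
Proof. by move=> /f_series/has_sum_complex/(has_sum_psum T_ge0 T2). Qed.

Let derivable_psum N x : D x ->
  exists l, cderiv (fun x => psum T (fun b => (density b (a b) x)%:C) N) x l.
Proof.
move=> Dx; have xn0 : x != 0 by rewrite -normr_gt0 (lt_le_trans rho0).
rewrite /psum; elim: (below T N) => [|b s [l hl]].
  by exists 0; under eq_fun do rewrite big_nil; exact: cderiv_cst.
have [l' hl'] := derivable_density b (a b) xn0.
by exists (l' + l); under eq_fun do rewrite big_cons; exact: cderivD.
Qed.

(** Measurability is inherited from the partial sums of the series, which are differentiable on the
    outer region. *)
Let mf : measurable_fun (D : set (measurableTypeR R)) f.
Proof.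
apply: (@measurable_fun_cvg _ _ _ _
    (fun N x => complex.Re (psum T (fun b => (density b (a b) x)%:C) N))).
  by move=> N; have [] := measurable_derivable mD (fun x Dx => @derivable_psum N x Dx).
by move=> x /dens_ccvg/ccvg_Re.
Qed.

(** The bounds on single powers, weighted and summed, give one majorant in x^(-2) for all partial
    sums, so integral and series may be exchanged. *)
Lemma outer_ccvg z : complex.Im z < 0 ->
  ccvg (fun N => \sum_(b <- below T N) stieltjes rho b (a b) z)
    (cint mu D (fun x => (z - x%:C)^-1)).
Proof.
move=> z0.
have [mr mi] := measurable_derivable mD (fun x _ => derivable_resolvent x z0).
rewrite (cint_with_density mD mf f_density mr mi (fun x _ => resolvent_le x z0)).
pose Cz := 1 + normc z / - complex.Im z.
have Cz0 : 0 <= Cz by rewrite addr_ge0// divr_ge0 ?normc_ge0// oppr_ge0 ltW.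
pose F N x := psum T (fun b => (density b (a b) x)%:C) N * (z - x%:C)^-1.
have dF N x : D x -> exists l, cderiv (F N) x l.
  move=> Dx; have [l1 h1] := derivable_psum N Dx; have [l2 h2] := derivable_resolvent x z0.
  by eexists; exact: cderivM h1 h2.
have FE N x : F N x = \sum_(b <- below T N) (density b (a b) x)%:C * (z - x%:C)^-1.
  by rewrite /F /psum mulr_suml.
have [||x Dx||N x Dx|_ h] := @cint_dct _ _ R leb D F (fun x => (f x)%:C * (z - x%:C)^-1)
    (fun x => Q * Cz * x ^- 2) mD.
- by move=> N; have [] := measurable_derivable mD (dF N).
- by move=> N; have [] := measurable_derivable mD (dF N).
- by apply: ccvgM; [exact: dens_ccvg|exact: ccvg_cst].
- have -> : EFin \o (fun x : R => Q * Cz * x ^- 2) = (fun x => (Q * Cz)%:E * (x ^- 2)%:E)%E.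
    by apply/funext => x /=; rewrite EFinM.
  by apply: integrableZl => //; exact: integrable_inv_sqr.
- rewrite FE; apply: le_trans (normc_sum _ _ _) _.
  apply: (@le_trans _ _ ((\sum_(b <- below T N) normc (a b) * rho `^ (- b)) * Cz * x ^- 2)).
    rewrite !mulr_suml big_seq [leRHS]big_seq; apply: ler_sum => b /belowT[Sb b0].
    exact: stieltjes_bound.
  by rewrite ler_wpM2r ?invr_ge0 ?sqr_ge0// ler_wpM2r.
apply: ccvg_near h; near=> N.
have -> : F N = fun x : R => \sum_(b <- below T N) (density b (a b) x)%:C * (z - x%:C)^-1.
  by apply/funext => x; rewrite FE.
rewrite cint_sum// => b /belowT[_ b0].
by have [] := stieltjes_ccvg (a b) rho0 b0 z0.
Unshelve. all: end_near. Qed.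

(* Total Laurent coefficient at [z^(-n-1)] of the arc corrections of the first powers. *)
Let W N n : R[i] := psum T (fun b => (laurent_coef rho b (a b) n)%:C) N.

Let W_bound N n : normc (W N n) <= 2 * pi * Q * rho ^+ n.
Proof.
rewrite /W /psum; apply: le_trans (normc_sum _ _ _) _.
apply: (@le_trans _ _ (2 * pi * rho ^+ n * \sum_(b <- below T N) normc (a b) * rho `^ (- b))).
  rewrite mulr_sumr big_seq [leRHS]big_seq; apply: ler_sum => b /belowT[Sb b0].
  rewrite normc_real; apply: le_trans (laurent_coef_bound rho0 b (a b) n) _.
  by rewrite le_eqVlt; apply/orP; left; apply/eqP; ring.
rewrite mulrAC ler_wpM2r ?exprn_ge0 ?(ltW rho0)// ler_wpM2l ?mulr_ge0 ?pi_ge0//.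
Qed.

Let w n : R[i] := xget 0 [set l | ccvg (W ^~ n) l].

Let W_ccvg n : ccvg (W ^~ n) (w n).
Proof.
have [q0 q1 cq] := ratio.
have [l hl] : exists l, ccvg (W ^~ n) l.
  apply: (psum_ccvg T_ge0 T2 (ltW c0) q0 q1 cq (M := 2 * pi * rho ^+ n)).
    move=> b [Sb b0]; rewrite normc_real; apply: le_trans (laurent_coef_bound rho0 b (a b) n) _.
    have -> : normc (a b) * (2 * pi) * rho `^ (- b) * rho ^+ n =
      2 * pi * rho ^+ n * (normc (a b) * rho `^ (- b)) by ring.
    by rewrite ler_wpM2l ?weight// !mulr_ge0 ?pi_ge0 ?exprn_ge0 ?(ltW rho0).
  by rewrite !mulr_ge0 ?pi_ge0 ?exprn_ge0 ?(ltW rho0).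
by rewrite /w; case: xgetP => // /(_ l).
Qed.

Let w_bound n : normc (w n) <= 2 * pi * Q * rho ^+ n.
Proof. by apply: ccvg_le (W_ccvg n) => N; exact: W_bound. Qed.

Let K20 : 0 <= 2 * pi * Q.
Proof. by apply: mulr_ge0; [rewrite mulr_ge0 ?pi_ge0|exact: Q0]. Qed.

(** Exchanges the sum over the exponents of the density with the Laurent sum: the coefficients
    [W N n] converge in [N] and are at most 2 pi Q rho^n for every [N]. *)
Lemma laurent_total z : c * rho < normc z -> exists2 l,
  ccvg (psum S (fun g => on_nat w g / cpow z (g + 1))) l &
  ccvg (fun N => \sum_(b <- below T N) laurent_sum S rho b (a b) z) l.
Proof.
move=> hz; have [q0 q1 cq] := ratio_small S_0 S2 c0 rho0 hz.
have z0 : z != 0 by rewrite -normc_gt0 (lt_trans _ hz)// mulr_gt0.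
have n0 : 0 < normc z by rewrite normc_gt0.
have bnd (F : nat -> R[i]) g : (forall n, normc (F n) <= 2 * pi * Q * rho ^+ n) -> S g ->
    normc (on_nat F g / cpow z (g + 1)) <= 2 * pi * Q / normc z * (rho / normc z) `^ g.
  move=> hF Sg; rewrite cpowD cpow1// invfM mulrA normcM normcV mulrAC ler_wpM2r ?invr_ge0 ?(ltW n0)//.
  by apply: (@normc_term _ (on_nat F)) => //; apply: (normc_on_nat _ _ Sg) => //; exact: ltW.
have K0 : 0 <= 2 * pi * Q / normc z by rewrite divr_ge0// ltW.
have [l hl] := psum_ccvg S_ge0 S2 (ltW c0) q0 q1 cq (fun g => bnd w g w_bound) K0.
exists l => //.
apply: (tannery S_ge0 S2 (ltW c0) q0 q1 cq K0 (u := fun N g => on_nat (W N) g / cpow z (g + 1))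
  (v := fun g => on_nat w g / cpow z (g + 1))) => //.
- by move=> N g; apply: bnd; exact: W_bound.
- move=> g Sg; under eq_fun do rewrite mulrC; rewrite mulrC; apply: ccvgZ; rewrite /on_nat.
  by case: ifP => _; [exact: W_ccvg|exact: ccvg_cst].
move=> N.
have -> : psum S (fun g => on_nat (W N) g / cpow z (g + 1)) =
    fun m => \sum_(b <- below T N) psum S (laurent_term rho b (a b) z) m.
  apply/funext => m; rewrite /psum exchange_big /=; apply: eq_bigr => g _.
  rewrite /laurent_term -mulr_suml; congr (_ / _); rewrite /on_nat.
  by case: ifP => // _; rewrite big1.
apply: ccvg_sum => b /belowT[Sb b0].
exact: (laurent_sumP S_ge0 S1 S2 c0 rho0 b (a b) hz).
Qed.

Lemma density_series_exists : exists (d : R -> R[i]) (K B : R),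
  [/\ 0 <= K, 0 < B, forall g, S g -> normc (d g) <= K * B `^ g &
    forall z, complex.Im z < 0 -> c * B < normc z ->
      ccvg (psum S (fun g => d g / cpow z (g + 1))) (cauchy_transform mu z)].
Proof.
have c1 := condition_S2_ge1 S2 S_0 (ltW c0).
have [K1 K10 hK1] := invariant_bound S_ge0 S1 S2 c0 rho0.
pose base : R[i] := 0 -i* (2 * c * rho).
pose C b := invariant S rho b (a b) base.
(* The invariants grow at most like (2c)^b r^b; the Laurent coefficients and the inner moments grow
   at most like rho^n. *)
pose B := Num.max rho (2 * c * r).
have B0 : 0 < B by rewrite lt_max rho0.
have rhoB : rho <= B by rewrite le_max lexx.
have crB : 2 * c * r <= B by rewrite le_max lexx orbT.
have powB x g : S g -> 0 <= x -> x <= B -> x `^ g <= B `^ g.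
  by move=> /S_ge0 g0 x0 xB; apply: ge0_ler_powR; rewrite ?nnegrE ?(ltW B0).
pose d1 g := if 0 < g then C g else 0.
pose m n := (inner_moment mu rho n)%:C.
have d1b g : S g -> normc (d1 g) <= K1 * B `^ g.
  move=> Sg; rewrite /d1; case: ifPn => g0; last by rewrite normc0 mulr_ge0 ?powR_ge0.
  apply: le_trans (hK1 g (a g) g0) _; rewrite ler_wpM2l//.
  apply: (@le_trans _ _ ((2 * c * r) `^ g)); last by rewrite powB// !mulr_ge0 ?(ltW c0) ?(ltW r0).
  by rewrite [leRHS]powRM ?mulr_ge0 ?(ltW c0) ?(ltW r0)// [leLHS]mulrC ler_wpM2l ?powR_ge0 ?a_bound.
have onb (F : nat -> R[i]) K g : 0 <= K -> S g -> (forall n, normc (F n) <= K * rho ^+ n) ->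
    normc (on_nat F g) <= K * B `^ g.
  move=> K0 Sg hF; apply: le_trans (normc_on_nat K0 (ltW rho0) Sg hF) _.
  by rewrite ler_wpM2l// powB// ltW.
have mb n : normc (m n) <= 1 * rho ^+ n by rewrite normc_real mul1r inner_moment_bound.
(* Three contributions: the invariants at the positive exponents, minus the Laurent corrections,
   plus the moments of the inner part; [K] adds up their constants. *)
exists (fun g => d1 g - on_nat w g + on_nat m g), (K1 + 2 * pi * Q + 1), B; split => //.
- by rewrite !addr_ge0.
- move=> g Sg; apply: le_trans (normcD _ _) _; rewrite 2!mulrDl.
  apply: lerD; last exact: onb.
  apply: le_trans (normcD _ _) _; rewrite normcN; apply: lerD; first exact: d1b.
  exact: onb.
move=> z z0 hz; have zn := Im_lt0_neq0 z0; have n0 : 0 < normc z by rewrite normc_gt0.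
have hrho : c * rho < normc z by rewrite (le_lt_trans _ hz)// ler_wpM2l// ltW.
have [q0 q1 cq] := ratio_small S_0 S2 c0 B0 hz.
have [l2 h2 h2'] := laurent_total hrho.
have d1q g : S g -> normc (d1 g / cpow z (g + 1)) <= K1 / normc z * (B / normc z) `^ g.
  move=> Sg; rewrite cpowD cpow1// invfM mulrA normcM normcV mulrAC ler_wpM2r ?invr_ge0 ?(ltW n0)//.
  by apply: normc_term => //; exact: d1b.
have [l1 h1] := psum_ccvg S_ge0 S2 (ltW c0) q0 q1 cq d1q (divr_ge0 K10 (ltW n0)).
have h3 : ccvg (psum S (fun g => on_nat m g / cpow z (g + 1)))
    (cint mu (~` D) (fun x => (z - x%:C)^-1)).
  have := inner_expansion mu rho0 z0 (le_lt_trans (ler_peMl (ltW rho0) c1) hrho).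
  apply: ccvg_near; near=> N; rewrite -(psum_on_nat S_ge0 S1 S2 (fun n => m n * z ^- n.+1)).
  by apply: eq_bigr => g _; rewrite on_nat_cpow.
have h1' : ccvg (fun N => \sum_(b <- below T N) (C b / cpow z (b + 1))) l1.
  apply: ccvg_near h1; near=> N; rewrite -/(psum T (fun b => C b / cpow z (b + 1)) N).
  rewrite (psum_positive S2)//; apply: eq_bigr => g _; rewrite /d1.
  by case: ifP => _ //; rewrite mul0r.
have hD : cint mu D (fun x => (z - x%:C)^-1) = l1 - l2.
  apply: ccvg_unique (outer_ccvg z0) _; apply: ccvg_near (ccvgB h1' h2'); near=> N.
  rewrite -sumrB big_seq [RHS]big_seq; apply: eq_bigr => b /belowT[Sb b0].
  by rewrite (stieltjes_expansion S_ge0 S1 S2 c0 rho0 (a b) b0 z0 hrho).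
rewrite (cauchy_transform_split mu mD z0) hD.
apply: ccvg_near (ccvgD (ccvgB h1 h2) h3); near=> N.
rewrite /psum -sumrB -big_split; apply: eq_bigr => g _ /=.
by rewrite -mulrBl -mulrDl.
Unshelve. all: end_near. Qed.

End density_to_series.

(** * The constant coefficient *)

Section normalization.
Variables (R : realType) (S : set R) (c : R) (mu : probability (measurableTypeR R) R).
Hypothesis S_ge0 : S `<=` [set x | 0 <= x].
Hypothesis S_0 : S 0.
Hypothesis S2 : condition_S2 S c.
Hypothesis c0 : 0 < c.
Variables (d : R -> R[i]) (K B : R).
Hypotheses (K0 : 0 <= K) (B0 : 0 < B) (dK : forall g, S g -> normc (d g) <= K * B `^ g).
Hypothesis dG : forall z : R[i], complex.Im z < 0 -> c * B < normc z ->
  ccvg (psum S (fun g => d g / cpow z (g + 1))) (cauchy_transform mu z).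

Let Y := c * B + 1.

Let Y0 : 0 < Y. Proof. by rewrite /Y ltr_wpDl ?mulr_ge0 ?ltW. Qed.

(** Points tending to infinity on the negative imaginary axis. Their exponential growth makes the
    term of exponent g decay at least like the geometric sequence e^(-g n). *)
Let zz (n : nat) : R[i] := 0 -i* (Y * expR n%:R).

Let zz_Im n : complex.Im (zz n) < 0.
Proof. by rewrite /= oppr_lt0 mulr_gt0 ?expR_gt0. Qed.

Let normc_zz n : normc (zz n) = Y * expR n%:R.
Proof.
by rewrite /zz /= expr0n /= add0r sqrrN sqrtr_sqr ger0_norm// mulr_ge0 ?expR_ge0 ?(ltW Y0).
Qed.

Let Y_zz n : Y <= normc (zz n).
Proof. by rewrite normc_zz ler_peMr ?(ltW Y0)// -expR0 ler_expR. Qed.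

Let expRN_lt1 (g : R) : 0 < g -> `|expR (- g)| < 1.
Proof. by move=> g0; rewrite ger0_norm ?expR_ge0// -expR0 ltr_expR oppr_lt0. Qed.

(** On the imaginary axis |z / (z - x)| <= 1, so dominated convergence gives the total mass of [mu]
    as the limit. *)
Let zzG_ccvg : ccvg (fun n => zz n * cauchy_transform mu (zz n)) 1.
Proof.
have z0 n := zz_Im n; have zn n := Im_lt0_neq0 (z0 n).
pose F n (x : R) : R[i] := zz n * (zz n - x%:C)^-1.
have dF n x : [set: measurableTypeR R] x -> exists l, cderiv (F n) x l.
  by move=> _; have [l hl] := derivable_resolvent x (z0 n); exists (zz n * l); exact: cderivZ.
have im n : - complex.Im (zz n) = normc (zz n) by rewrite normc_zz /= opprK.
have [||x _||n x _|_ h] := @cint_dct _ _ R mu setT F (fun=> 1) (fun=> 1) measurableT.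
- by move=> n; have [] := measurable_derivable measurableT (dF n).
- by move=> n; have [] := measurable_derivable measurableT (dF n).
- apply: (@ccvg_squeeze _ _ _ (fun n => `|x| / Y * expR (- 1) ^+ n)).
    move=> n; have zx := sub_real_neq0 x (z0 n).
    have -> : F n x - 1 = x%:C * (zz n - x%:C)^-1.
      by rewrite /F -[X in _ - X](mulfV zx) -mulrBl opprB addrC subrK.
    rewrite normc_realM -mulrA ler_wpM2l//; apply: le_trans (resolvent_le x (z0 n)) _.
    by rewrite im normc_zz invfM -expRM_natl mulrN1 expRN.
  by apply: cvgn0Z; apply: cvg_expr; exact: expRN_lt1.
- by apply: (@integrable_bounded_prob _ mu _ _ 1) => // x _; rewrite normr1.
- rewrite /F normcM; apply: le_trans (ler_wpM2l (normc_ge0 _) (resolvent_le x (z0 n))) _.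
  by rewrite im mulfV// gt_eqF// normc_gt0.
have -> : 1 = cint mu setT (fun=> 1) :> R[i].
  have muT : fine (mu setT) = 1 by have -> : mu setT = 1%E by exact: probability_setT.
  by apply: complex_ext; rewrite ?Re_cint ?Im_cint /= Rintegral_cst// ?mul0r// muT mulr1.
apply: ccvg_near h; near=> n; rewrite cintZ//; exact: cintegrable_resolvent.
Unshelve. all: end_near. Qed.

(** In the series for z G(z) every positive exponent disappears at infinity, leaving [d 0], which is
    compared with the total mass. *)
Lemma constant_coef : d 0 = 1.
Proof.
have cY : c * B < Y by rewrite ltrDl.
have [q0 q1 cq] := ratio_small S_0 S2 c0 B0 cY.
have zn n := Im_lt0_neq0 (zz_Im n).
have n0 n : 0 < normc (zz n) by rewrite normc_gt0.
pose v (g : R) : R[i] := if g == 0 then d 0 else 0.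
have term n g : S g -> normc (d g / cpow (zz n) g) <= K * (B / normc (zz n)) `^ g.
  by move=> Sg; apply: normc_term => //; exact: dK.
suff h : ccvg (fun n => zz n * cauchy_transform mu (zz n)) (d 0) by exact: ccvg_unique h zzG_ccvg.
refine (tannery S_ge0 S2 (ltW c0) q0 q1 cq K0 (u := fun n g => d g / cpow (zz n) g) (v := v) _ _ _ _).
- move=> n g Sg; apply: le_trans (term n g Sg) _; rewrite ler_wpM2l//.
  apply: ge0_ler_powR; rewrite ?nnegrE ?divr_ge0 ?normc_ge0 ?(ltW B0) ?(ltW Y0)//; first exact: S_ge0.
  by rewrite ler_pM2l// lef_pV2 ?posrE.
- move=> g Sg; rewrite /v; case: eqVneq => [->|g0].
    by under eq_fun do rewrite cpow0 invr1 mulr1; exact: ccvg_cst.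
  have gp : 0 < g by rewrite lt_def g0 S_ge0.
  apply: (@ccvg_squeeze _ _ _ (fun n => K * (B / Y) `^ g * expR (- g) ^+ n)).
    move=> n; rewrite subr0; apply: le_trans (term n g Sg) _.
    rewrite normc_zz invfM mulrA powRM ?divr_ge0 ?invr_ge0 ?expR_ge0 ?(ltW B0) ?(ltW Y0)// mulrA.
    rewrite ler_wpM2l ?mulr_ge0 ?powR_ge0//.
    by rewrite -expRN /powR gt_eqF ?expR_gt0// expRK -expRM_natl !mulrN mulrC.
  by apply: cvgn0Z; apply: cvg_expr; exact: expRN_lt1.
- move=> n.
  have -> : psum S (fun g => d g / cpow (zz n) g) =
      fun N => zz n * psum S (fun g => d g / cpow (zz n) (g + 1)) N.
    apply/funext => N; rewrite /psum mulr_sumr; apply: eq_bigr => g _.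
    by rewrite cpowD cpow1//; move: (cpow _ g) => p; rewrite invfM [RHS]mulrC -!mulrA mulVf// mulr1.
  apply: ccvgZ; apply: dG; [exact: zz_Im|exact: lt_le_trans cY (Y_zz n)].
apply: (@ccvg_near _ (fun=> d 0)); last exact: ccvg_cst.
near=> N; rewrite /psum (bigD1_seq 0)/= ?(uniq_below S2)//.
  rewrite big1 ?addr0; first by rewrite /v eqxx.
  by move=> g g0; rewrite /v (negPf g0).
rewrite (mem_below S_ge0 S2) asboolT// ltr0n.
by near: N; exists 1%N.
Unshelve. all: end_near. Qed.

End normalization.

(** * Normalized coefficient bounds and the cycle of implications *)

Lemma has_sum_shift (R : realType) (S : set R) (c : R) (d : R -> R[i]) (A : R) (z s : R[i]) :
  S `<=` [set x | 0 <= x] -> S 0 -> condition_S2 S c -> 0 < c -> 0 < A -> c * A < normc z ->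
  (forall g, S g -> normc (d g) <= A `^ g) ->
  (has_sum S (fun g => d g / cpow z g) s <-> has_sum S (fun g => d g / cpow z (g + 1)) (z^-1 * s)).
Proof.
move=> S_ge0 S_0 S2 c0 A0 hz dA.
have [q0 q1 cq] := ratio_small S_0 S2 c0 A0 hz.
have z0 : z != 0 by rewrite -normc_gt0 (lt_trans _ hz)// mulr_gt0.
have term g : S g -> normc (d g / cpow z g) <= 1 * (A / normc z) `^ g.
  by move=> Sg; apply: normc_term => //; rewrite mul1r dA.
have sh g : z^-1 * (d g / cpow z g) = d g / cpow z (g + 1).
  by rewrite cpowD cpow1//; move: (cpow _ g) => p; rewrite invfM mulrC -mulrA.
split=> h.
  refine (eq_has_sum _ (has_sumZ S_ge0 S2 c0 (k := z^-1) q0 q1 cq ler01 term h)) => g _.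
  exact: sh.
have term' g : S g -> normc (d g / cpow z (g + 1)) <= (normc z)^-1 * (A / normc z) `^ g.
  move=> Sg; rewrite -sh normcM normcV ler_wpM2l ?invr_ge0 ?normc_ge0//.
  by rewrite -[leRHS]mul1r term.
have n0 : 0 <= (normc z)^-1 by rewrite invr_ge0 normc_ge0.
have h' := has_sumZ S_ge0 S2 c0 (k := z) q0 q1 cq n0 term' h.
have e : z * (z^-1 * s) = s by rewrite mulrA mulfV// mul1r.
rewrite e in h'; refine (eq_has_sum _ h') => g _.
by rewrite -sh mulrA mulfV// mul1r.
Qed.

Lemma normc_lt_complex (R : realType) (z : R[i]) (x : R) : (x%:C < `|z|) = (x < normc z).
Proof. by rewrite normr_normc ltcR. Qed.

Lemma normc_le_complex (R : realType) (z : R[i]) (x : R) : (`|z| <= x%:C) = (normc z <= x).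
Proof. by rewrite normr_normc lecR. Qed.

Lemma class_P_series (R : realType) (S : set R) (c : R) (mu : probability (measurableTypeR R) R) :
  S `<=` [set x | 0 <= x] -> condition_S1 S -> 0 < c -> condition_S2 S c -> class_P S c mu ->
  exists (d : R -> R[i]) (A : R),
    [/\ d 0 = 1, 0 < A, forall g, S g -> normc (d g) <= A `^ g &
      forall z, complex.Im z < 0 -> c * A < normc z ->
        has_sum S (fun g => d g / cpow z (g + 1)) (cauchy_transform mu z)].
Proof.
move=> S_ge0 S1 c0 S2 [a [r [rho [f [[r0 rho0 r_rho aB] [f_series f_density]]]]]].
have S_0 : S 0 by exact: (S1 0).
have cr : c * r < rho by rewrite -ltr_pdivlMl.
have aB' b : S b -> 0 < b -> normc (a b) <= r `^ b.
  by move=> Sb b0; rewrite -normc_le_complex; exact: aB.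
have [d [K [B [K0 B0 dK dG]]]] :=
  density_series_exists S_ge0 S1 S2 c0 r0 rho0 cr aB' f_series f_density.
have d0 := constant_coef S_ge0 S_0 S2 c0 K0 B0 dK dG.
(* The factor [K] can be absorbed only at positive exponents; at 0 the bound holds because [d 0 = 1]
   is already established. *)
have [A BA hA] := absorb_constant S2 K B0.
have A0 : 0 < A := lt_le_trans B0 BA.
have dA g : S g -> normc (d g) <= A `^ g.
  move=> Sg; have [->|g0] := eqVneq g 0; first by rewrite d0 powRr0 normc1.
  by apply: le_trans (dK g Sg) (hA g Sg _); rewrite lt_def g0 S_ge0.
exists d, A; split=> // z z0 hz.
have n0 : 0 < normc z by rewrite normc_gt0 Im_lt0_neq0.
have [q0 q1 cq] := ratio_small S_0 S2 c0 A0 hz.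
have hB : c * B < normc z by apply: le_lt_trans hz; rewrite ler_pM2l.
have n0' : 0 <= (normc z)^-1 by rewrite invr_ge0 ltW.
refine (psum_has_sum S_ge0 S2 (ltW c0) q0 q1 cq _ n0' (dG z z0 hB)) => g Sg.
have term : normc (d g / cpow z g) <= 1 * (A / normc z) `^ g.
  by apply: normc_term; rewrite ?mul1r ?dA// Im_lt0_neq0.
have -> : d g / cpow z (g + 1) = z^-1 * (d g / cpow z g).
  rewrite cpowD cpow1 ?Im_lt0_neq0//; move: (cpow _ g) => p.
  by rewrite invfM [RHS]mulrC -mulrA.
by rewrite normcM normcV ler_wpM2l// -[leRHS]mul1r.
Qed.

Theorem theorem3p3 (R : realType) (S : set R) (c : R)
    (mu : probability (measurableTypeR R) R)
    (S_semigroup : additive_subsemigroup S)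
    (S1 : condition_S1 S)
    (c_gt0 : 0 < c) (S2 : condition_S2 S c) :
  [<-> class_P S c mu;
       exists (d : R -> R[i]) (A : R),
         [/\ d 0 = 1, 0 < A,
             (forall g, S g -> `|d g| <= (A `^ g)%:C) &
             (forall z : R[i], complex.Im z < 0 -> (c * A)%:C < `|z| ->
                has_sum S (fun g => d g / cpow z (g + 1))
                  (cauchy_transform mu z))];
       exists (b : R -> R[i]) (A : R),
         [/\ b 0 = 1, 0 < A,
             (forall g, S g -> `|b g| <= (A `^ g)%:C) &
             (forall z : R[i], complex.Im z < 0 -> (c * A)%:C < `|z| ->
                exists2 s : R[i], has_sum S (fun g => b g / cpow z g) s &
                  recip_cauchy_transform mu z = z * s)]].

Proof.
have [S_ge0 S_add] := S_semigroup; have S_0 : S 0 by exact: (S1 0).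
split.
  move=> muP; have [d [A [d0 A0 dA dG]]] := class_P_series S_ge0 S1 c_gt0 S2 muP.
  exists d, A; split=> // [g Sg|z z0 hz]; first by rewrite normc_le_complex dA.
  by apply: dG => //; rewrite -normc_lt_complex.
split.
  move=> [d [A [d0 A0 dA dG]]].
  have dA' g : S g -> normc (d g) <= A `^ g.
    by move=> Sg; rewrite -normc_le_complex dA.
  have [b [B [b0 AB bB hb]]] := reciprocal_series S_ge0 S_add S_0 S2 c_gt0 d0 A0 dA'.
  have B0 : 0 < B := lt_le_trans A0 AB.
  exists b, B; split=> // [g Sg|z z0]; first by rewrite normc_le_complex bB.
  rewrite normc_lt_complex => hB.
  have zn := Im_lt0_neq0 z0.
  have hA : c * A < normc z by apply: le_lt_trans hB; rewrite ler_pM2l.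
  have hG := dG z z0; rewrite normc_lt_complex in hG.
  (* Inversion is applied to z G(z), whose series has constant term 1 and whose reciprocal is F(z) /
     z. *)
  have e : cauchy_transform mu z = z^-1 * (z * cauchy_transform mu z).
    by rewrite mulrA mulVf// mul1r.
  have h := hG hA; rewrite e in h.
  have h' := (has_sum_shift (z * cauchy_transform mu z) S_ge0 S_0 S2 c_gt0 A0 hA dA').2 h.
  exists (z * cauchy_transform mu z)^-1; first exact: hb.
  by rewrite /recip_cauchy_transform invfM mulrA mulfV// mul1r.
(* Inverting the series of F(z) / z gives back (2), possibly with a larger base, and (1) follows
   from it. *)
move=> [b [A [b0 A0 bA bF]]].
have bA' g : S g -> normc (b g) <= A `^ g.
  by move=> Sg; rewrite -normc_le_complex bA.
have [d [B [d0 AB dB hd]]] := reciprocal_series S_ge0 S_add S_0 S2 c_gt0 b0 A0 bA'.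
have B0 : 0 < B := lt_le_trans A0 AB.
apply: (series_class_P S_ge0 S_0 S2 c_gt0 d0 B0 dB) => z z0 hB.
have hA : c * A < normc z by apply: le_lt_trans hB; rewrite ler_pM2l.
have hF := bF z z0; rewrite normc_lt_complex in hF; have [s hs eF] := hF hA.
have -> : cauchy_transform mu z = z^-1 * s^-1.
  by rewrite -[LHS]invrK -/(recip_cauchy_transform mu z) eF invfM.
exact: (has_sum_shift _ S_ge0 S_0 S2 c_gt0 B0 hB dB).1 (hd z s hB hs).
Qed.
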